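(* Let $M,M_1,M_2$ be positive integers and let $\mathcal{A}\in\mathscr{A}_{2,M}$ be an operator of the form $$\mathcal{A}\mathbf{u}=\mathbf{A}_0\mathbf{u}+\mathbf{A}_1\langle \mathbf{B}_1\mathbf{u}\rangle_1+\mathbf{A}_2\langle \mathbf{B}_2\mathbf{u}\rangle_2+\mathcal{K}\mathbf{u},\qquad \mathbf{u}\in L^2_{2,M},$$ where $\mathcal{K}\in\mathscr{K}_{2,M}$ and $\mathbf{A}_0$, $\mathbf{A}_j$, $\mathbf{B}_j$ ($j=1,2$) are continuous complex matrix-valued functions on $[0,1]^2$ of sizes $M\times M$, $M\times M_j$, $M_j\times M$ respectively. For $\lambda\in\mathbb{C}$ let $\mathbf{E}_0,\mathbf{E}_1,\mathbf{E}_2$ and $\mathcal{K}_1$ be the $\lambda$-dependent matrix-valued functions and compact operator defined in the context (obtained by replacing $\mathbf{A}_0$ with $\mathbf{A}_0-\lambda\mathbf{I}$). Then the spectrum of $\mathcal{A}$ is $$\sigma(\mathcal{A})=\sigma_0\cup\sigma_1\cup\sigma_2\cup\sigma_3,$$ where $$\sigma_0=\{\lambda\in\mathbb{C}:\ \det\mathbf{E}_0(\mathbf{k})=0\ \text{for some}\ \mathbf{k}\in[0,1]^2\},$$ $$\sigma_1=\{\lambda\in\mathbb{C}\setminus\sigma_0:\ \det\mathbf{E}_1(k_2)=0\ \text{for some}\ k_2\in[0,1]\},$$ $$\sigma_2=\{\lambda\in\mathbb{C}\setminus\sigma_0:\ \det\mathbf{E}_2(k_1)=0\ \text{for some}\ k_1\in[0,1]\},$$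 $$\sigma_3=\{\lambda\in\mathbb{C}\setminus(\sigma_0\cup\sigma_1\cup\sigma_2):\ \mathcal{I}+\mathcal{K}_1\ \text{is non-invertible}\}.$$
   Context: Let $L^2_{2,M}:=L^2([0,1]^2,\mathbb{C}^M)$. Points of $[0,1]^2$ are written $\mathbf{k}=(k_1,k_2)$, $\mathbf{k}'=(k_1',k_2')$. For a matrix- or vector-valued function of $\mathbf{k}\in[0,1]^2$ put $\langle\cdot\rangle_i:=\int_0^1\cdot\,dk_i$ for $i=1,2$; thus $\langle\cdot\rangle_1$ yields a function of $k_2$ only and $\langle\cdot\rangle_2$ yields a function of $k_1$ only, again regarded as functions on $[0,1]^2$. In operator expressions the dot $\cdot$ denotes the operator argument, e.g. $\mathbf{C}_0\,\cdot$ is multiplication by $\mathbf{C}_0$, and $\mathbf{C}_1\mathbf{E}_1^{-1}\langle\mathbf{B}_1\,\cdot\rangle_1$ is the operator $\mathbf{u}\mapsto\mathbf{C}_1\mathbf{E}_1^{-1}\langle\mathbf{B}_1\mathbf{u}\rangle_1$. Let $\mathscr{B}_{2,M}$ be the algebra of all bounded linear operators on $L^2_{2,M}$ and $\mathscr{K}_{2,M}$ the set of all compact operators on $L^2_{2,M}$. The algebra $\mathscr{A}_{2,M}$ is the minimal (non-closed, i.e. no topological closure is taken) subalgebra of $\mathscr{B}_{2,M}$ containing all operators of multiplication by continuous $M\times M$ matrix-valued functions on $[0,1]^2$, the integral projectors $\langle\cdot\rangle_1$, $\langle\cdot\rangle_2$, and all compact operators $\mathcal{K}\in\mathscr{K}_{2,M}$.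 Invertibility and the spectrum are understood in $\mathscr{B}_{2,M}$. $\mathcal{I}$ is the identity operator and $\mathbf{I}$ the identity matrix of the appropriate size. For $\lambda\in\mathbb{C}$ and $\mathcal{A}$ given by $\mathbf{A}_0,\mathbf{A}_1,\mathbf{A}_2,\mathbf{B}_1,\mathbf{B}_2,\mathcal{K}$ as in the claim, define (all objects depend on $\lambda$) $$\mathbf{E}_0=\mathbf{A}_0-\lambda\mathbf{I};$$ if $\lambda\notin\sigma_0$, $$\mathbf{C}_0=(\mathbf{A}_0-\lambda\mathbf{I})^{-1},\quad \mathbf{C}_1=\mathbf{C}_0\mathbf{A}_1,\quad \mathbf{C}_2=\mathbf{C}_0\mathbf{A}_2,$$ $$\mathbf{E}_1=\mathbf{E}_1(k_2)=\mathbf{I}+\langle\mathbf{B}_1\mathbf{C}_1\rangle_1,\qquad \mathbf{E}_2=\mathbf{E}_2(k_1)=\mathbf{I}+\langle\mathbf{B}_2\mathbf{C}_2\rangle_2;$$ and if $\lambda\notin\sigma_0\cup\sigma_1\cup\sigma_2$, $$\mathbf{D}_1(\mathbf{k},\mathbf{k}')=\mathbf{C}_1(\mathbf{k})\mathbf{E}_1^{-1}(k_2)\mathbf{B}_1(k_1',k_2)\mathbf{C}_2(k_1',k_2)\mathbf{B}_2(\mathbf{k}'),$$ $$\mathbf{D}_2(\mathbf{k},\mathbf{k}')=\mathbf{C}_2(\mathbf{k})\mathbf{E}_2^{-1}(k_1)\int_0^1\mathbf{B}_2(k_1,k_2'')\mathbf{D}_1(k_1,k_2'',\mathbf{k}')\,dk_2'',$$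 $$\mathcal{R}=(\mathcal{I}-\mathbf{C}_2\mathbf{E}_2^{-1}\langle\mathbf{B}_2\,\cdot\rangle_2)\circ(\mathcal{I}-\mathbf{C}_1\mathbf{E}_1^{-1}\langle\mathbf{B}_1\,\cdot\rangle_1)\circ(\mathbf{C}_0\,\cdot),$$ $$\mathcal{K}_1\mathbf{u}=\int_{[0,1]^2}(\mathbf{D}_2-\mathbf{D}_1)(\mathbf{k},\mathbf{k}')\,\mathbf{u}(\mathbf{k}')\,d\mathbf{k}'+\mathcal{R}\circ\mathcal{K}\mathbf{u},\qquad \mathbf{u}\in L^2_{2,M}.$$ *)

(* Defs.v *)
(* Written in MathComp and MathComp-Analysis, over an arbitrary realType R, the
   complex numbers being R[i]. *)
From HB Require Import structures.
From mathcomp Require Import all_boot all_order all_algebra.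
From mathcomp Require Import all_classical all_reals all_analysis measurable_realfun.
From mathcomp Require Import complex ring_quotient generic_quotient ring.
Set Implicit Arguments.
Unset Strict Implicit.
Unset Printing Implicit Defensive.
Import Order.TTheory GRing.Theory Num.Theory numFieldNormedType.Exports.
Local Open Scope classical_set_scope.
Local Open Scope ring_scope.
Local Open Scope complex_scope.
Local Notation Re := complex.Re.
Local Notation Im := complex.Im.

(* R[i] with the topology of the modulus, needed to speak of continuous
   functions with values in 'M[R[i]]_(m, n). *)
HB.instance Definition _ (R : realType) := NormedModule.copy R[i] R[i]^o.

Section Integrals.
Context {R : realType}.
Local Notation C := R[i].

Definition unit_itv : set (measurableTypeR R) := `[0, 1].

Definition unit_square : set (measurableTypeR R * measurableTypeR R) :=
  unit_itv `*` unit_itv.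

Definition leb2 :
    {measure set (measurableTypeR R * measurableTypeR R) -> \bar R} :=
  (@lebesgue_measure R \x @lebesgue_measure R)%E.

Definition Cintegral d (T : measurableType d) (mu : {measure set T -> \bar R})
    (D : set T) (f : T -> C) : C :=
  (\int[mu]_(x in D) Re (f x)) +i* (\int[mu]_(x in D) Im (f x)).

Definition mxintegral d (T : measurableType d) (mu : {measure set T -> \bar R})
    (D : set T) (m n : nat) (F : T -> 'M[C]_(m, n)) : 'M[C]_(m, n) :=
  \matrix_(i, j) Cintegral mu D (fun x => F x i j).

(* <F>_1 is a function of k_2 and <F>_2 a function of k_1. *)
Definition avg1 (m n : nat) (F : R * R -> 'M[C]_(m, n)) (k2 : R) :
    'M[C]_(m, n) :=
  mxintegral (@lebesgue_measure R) unit_itv (fun t => F (t, k2)).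

Definition avg2 (m n : nat) (F : R * R -> 'M[C]_(m, n)) (k1 : R) :
    'M[C]_(m, n) :=
  mxintegral (@lebesgue_measure R) unit_itv (fun t => F (k1, t)).

Definition avg12 (m n : nat) (F : R * R -> 'M[C]_(m, n)) : 'M[C]_(m, n) :=
  mxintegral leb2 unit_square F.

End Integrals.

Section SquareIntegrable.
Context {R : realType} {m : nat}.
Local Notation C := R[i].
Implicit Types (f g : R * R -> 'cV[C]_m) (v w : 'cV[C]_m).

(* Squared Euclidean norm of C^m. *)
Definition sqnorm v : R := \sum_i (Re (v i 0) ^+ 2 + Im (v i 0) ^+ 2).

Definition measurable_on_square f := forall i,
  measurable_fun unit_square (fun k => Re (f k i 0)) /\
  measurable_fun unit_square (fun k => Im (f k i 0)).

Definition square_integrable f :=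
  measurable_on_square f /\
  (\int[leb2]_(k in unit_square) (sqnorm (f k))%:E < +oo)%E.

Definition L2fun : {pred R * R -> 'cV[C]_m} := [pred f | `[< square_integrable f >]].

Lemma L2funP f : reflect (square_integrable f) (f \in L2fun).
Proof. exact: asboolP. Qed.

Lemma sqnorm_ge0 v : 0 <= sqnorm v.
Proof. by apply: sumr_ge0 => i _; rewrite addr_ge0 ?sqr_ge0. Qed.

Lemma sqnorm0 : sqnorm 0 = 0.
Proof. by rewrite /sqnorm big1// => i _; rewrite mxE/= expr0n addr0. Qed.

Lemma sqnorm_eq0 v : sqnorm v = 0 -> v = 0.
Proof.
move=> /eqP; rewrite psumr_eq0; last by move=> i _; rewrite addr_ge0 ?sqr_ge0.
move=> /allP v0; apply/matrixP => i j; rewrite ord1 mxE.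
have /= := v0 i (mem_index_enum i); rewrite paddr_eq0 ?sqr_ge0// !sqrf_eq0.
by case: (v i 0) => a b /= /andP[/eqP -> /eqP ->].
Qed.

Lemma ReD (x y : C) : Re (x + y) = Re x + Re y. Proof. by case: x; case: y. Qed.
Lemma ImD (x y : C) : Im (x + y) = Im x + Im y. Proof. by case: x; case: y. Qed.
Lemma ReM (x y : C) : Re (x * y) = Re x * Re y - Im x * Im y.
Proof. by case: x; case: y. Qed.
Lemma ImM (x y : C) : Im (x * y) = Re x * Im y + Im x * Re y.
Proof. by case: x; case: y. Qed.

Lemma sqnormZ (a : C) v : sqnorm (a *: v) = (Re a ^+ 2 + Im a ^+ 2) * sqnorm v.
Proof.
rewrite /sqnorm mulr_sumr; apply: eq_bigr => i _; rewrite mxE ReM ImM; ring.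
Qed.

Lemma sqnormD_le (t : R) v w : 0 < t ->
  sqnorm (v + w) <= (1 + t) * sqnorm v + (1 + t^-1) * sqnorm w.
Proof.
move=> t0; rewrite /sqnorm !mulr_sumr -big_split/=; apply: ler_sum => i _.
have sqD (x y : R) : (x + y) ^+ 2 <= (1 + t) * x ^+ 2 + (1 + t^-1) * y ^+ 2.
  rewrite -subr_ge0.
  have -> : (1 + t) * x ^+ 2 + (1 + t^-1) * y ^+ 2 - (x + y) ^+ 2
            = t^-1 * (t * x - y) ^+ 2 by field; rewrite gt_eqF.
  by rewrite mulr_ge0 ?invr_ge0 ?(ltW t0)// sqr_ge0.
rewrite !mxE ReD ImD; apply: (le_trans (lerD (sqD _ _) (sqD _ _))).
by rewrite le_eqVlt; apply/orP; left; apply/eqP; ring.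
Qed.

Lemma measurable_unit_square : measurable (@unit_square R).
Proof. by apply: measurableX; exact: measurable_itv. Qed.

Lemma measurable_on_square_lin (a : C) f g :
  measurable_on_square f -> measurable_on_square g ->
  measurable_on_square (a *: f + g).
Proof.
move=> mf mg i; have [mfr mfi] := mf i; have [mgr mgi] := mg i; split.
- have -> : (fun k => Re ((a *: f + g) k i 0)) =
    (fun k => Re a * Re (f k i 0) - Im a * Im (f k i 0) + Re (g k i 0)).
    by apply/funext => k; rewrite !fctE !mxE ReD ReM.
  apply: measurable_funD => //; apply: measurable_funB;
    exact: measurable_funM.
- have -> : (fun k => Im ((a *: f + g) k i 0)) =
    (fun k => Re a * Im (f k i 0) + Im a * Re (f k i 0) + Im (g k i 0)).
    by apply/funext => k; rewrite !fctE !mxE ImD ImM.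
  apply: measurable_funD => //; apply: measurable_funD;
    exact: measurable_funM.
Qed.

Lemma measurable_sqnorm f : measurable_on_square f ->
  measurable_fun unit_square (fun k => (sqnorm (f k))%:E).
Proof.
move=> mf; apply/measurable_EFinP; apply: measurable_sum => i.
by have [mfr mfi] := mf i; apply: measurable_funD; exact: measurable_funX.
Qed.

Lemma ge0_int_sqnorm f : (0 <= \int[leb2]_(k in unit_square) (sqnorm (f k))%:E)%E.
Proof. by apply: integral_ge0 => k _; rewrite lee_fin sqnorm_ge0. Qed.

Lemma int_sqnormZ (a : C) f : measurable_on_square f ->
  (\int[leb2]_(k in unit_square) (sqnorm ((a *: f) k))%:E =
   (Re a ^+ 2 + Im a ^+ 2)%:E * \int[leb2]_(k in unit_square) (sqnorm (f k))%:E)%E.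
Proof.
move=> mf; under eq_integral do rewrite fctE sqnormZ EFinM.
rewrite ge0_integralZl_EFin//; first exact: measurable_unit_square.
- by move=> k _; rewrite lee_fin sqnorm_ge0.
- exact: measurable_sqnorm.
- by rewrite addr_ge0 ?sqr_ge0.
Qed.

Lemma int_sqnormD (t : R) f g : 0 < t ->
  measurable_on_square f -> measurable_on_square g ->
  (\int[leb2]_(k in unit_square) (sqnorm ((f + g)%R k))%:E <=
   (1 + t)%:E * \int[leb2]_(k in unit_square) (sqnorm (f k))%:E +
   (1 + t^-1)%:E * \int[leb2]_(k in unit_square) (sqnorm (g k))%:E)%E.
Proof.
move=> t0 mf mg; have t1 : 0 < t^-1 by rewrite invr_gt0.
have mQ := measurable_unit_square.
have mfg : measurable_on_square (f + g).
  by rewrite -[f]scale1r; exact: measurable_on_square_lin.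
have pt : 0 <= 1 + t by rewrite addr_ge0// ltW.
have pt1 : 0 <= 1 + t^-1 by rewrite addr_ge0// ltW.
have mZ c h : measurable_on_square h ->
    measurable_fun unit_square (fun k => (c%:E * (sqnorm (h k))%:E)%E).
  by move=> mh; apply: emeasurable_funM => //; exact: measurable_sqnorm.
rewrite -!ge0_integralZl_EFin//; last 4 first.
- by move=> k _; rewrite lee_fin sqnorm_ge0.
- exact: measurable_sqnorm.
- by move=> k _; rewrite lee_fin sqnorm_ge0.
- exact: measurable_sqnorm.
rewrite -ge0_integralD//; last 4 first.
- by move=> k _; rewrite -EFinM lee_fin mulr_ge0// sqnorm_ge0.
- exact: mZ.
- by move=> k _; rewrite -EFinM lee_fin mulr_ge0// sqnorm_ge0.
- exact: mZ.
apply: ge0_le_integral => //.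
- by move=> k _; rewrite lee_fin sqnorm_ge0.
- exact: measurable_sqnorm.
- by apply: emeasurable_funD; exact: mZ.
- by move=> k _; rewrite -!EFinM -EFinD lee_fin; exact: sqnormD_le.
Qed.

Lemma measurable_on_square0 : measurable_on_square 0.
Proof.
have e0 k i : (0 : R * R -> 'cV[C]_m) k i 0 = 0.
  by rewrite -[(0 : R * R -> 'cV[C]_m) k]/(0 : 'cV[C]_m) mxE.
by move=> i; split; under eq_fun do rewrite e0; exact: measurable_cst.
Qed.

Lemma int_sqnorm0 :
  (\int[leb2]_(k in unit_square) (sqnorm ((0 : R * R -> 'cV[C]_m) k))%:E = 0)%E.
Proof.
under eq_integral => k _ do
  rewrite -[(0 : R * R -> 'cV[C]_m) k]/(0 : 'cV[C]_m) sqnorm0.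
exact: integral0.
Qed.

Lemma L2fun_submod_closed : submod_closed L2fun.
Proof.
split.
  apply/L2funP; split; first exact measurable_on_square0.
  by have -> := int_sqnorm0.
move=> a f g /L2funP[mf lf] /L2funP[mg lg]; apply/L2funP.
have maf : measurable_on_square (a *: f).
  by rewrite -[a *: f]addr0; apply: measurable_on_square_lin;
    [exact: mf|exact measurable_on_square0].
split; first exact: measurable_on_square_lin.
apply: le_lt_trans (int_sqnormD ltr01 maf mg) _.
rewrite int_sqnormZ//.
have fin (h : \bar R) : (0 <= h)%E -> (h < +oo)%E -> h \is a fin_num.
  by move=> h0 hoo; rewrite ge0_fin_numE.
by rewrite ltey_eq fin_numD !fin_numM// fin// ge0_int_sqnorm.
Qed.

HB.instance Definition _ :=
  GRing.isSubmodClosed.Build _ (R * R -> 'cV[C]_m) L2fun L2fun_submod_closed.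

End SquareIntegrable.

Section L2space.
Context (R : realType) (m : nat).
Local Notation C := R[i].

Record L2fun_type := L2Fun {
  L2fun_val :> R * R -> 'cV[C]_m;
  L2fun_valP : L2fun_val \in L2fun }.

HB.instance Definition _ := [isSub for L2fun_val].
HB.instance Definition _ := [Choice of L2fun_type by <:].
HB.instance Definition _ := [SubChoice_isSubLmodule of L2fun_type by <:].

Definition L2null : {pred L2fun_type} :=
  [pred f : L2fun_type | `[< {ae leb2, forall k, unit_square k -> f k = 0} >]].

Lemma L2nullP (f : L2fun_type) :
  reflect {ae leb2, forall k, unit_square k -> f k = 0} (f \in L2null).
Proof. exact: asboolP. Qed.

Lemma L2null_submod_closed : submod_closed L2null.
Proof.
split; first by apply/L2nullP; apply: aeW => k _.
move=> a f g /L2nullP f0 /L2nullP g0; apply/L2nullP.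
apply: filterS2 f0 g0 => k f0 g0 kQ.
rewrite -[LHS]/(a *: (f : R * R -> 'cV[C]_m) k + (g : R * R -> 'cV[C]_m) k).
by rewrite f0// g0// scaler0 addr0.
Qed.

HB.instance Definition _ :=
  GRing.isSubmodClosed.Build _ L2fun_type L2null L2null_submod_closed.

(* L^2([0,1]^2, C^m): square integrable functions modulo equality almost
   everywhere on the square.  Functions are defined on R * R, but their values
   outside the square are irrelevant. *)
Definition L2 : Type := Quotient.quot L2null.
HB.instance Definition _ := Choice.on L2.
HB.instance Definition _ := EqQuotient.on L2.
HB.instance Definition _ := GRing.Zmodule.on L2.

Local Open Scope quotient_scope.

Definition L2class (f : L2fun_type) : L2 := \pi f.

Lemma L2class_eq f g :
  L2class f = L2class g <-> {ae leb2, forall k, unit_square k -> f k = g k}.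
Proof.
have -> : (L2class f = L2class g) <-> (f - g \in L2null).
  by rewrite (Quotient.idealrBE L2null); split=> /eqP.
split.
- move=> /L2nullP; apply: filterS => k + kQ => /(_ kQ) /eqP.
  by rewrite -[X in X == _]/((f : R * R -> 'cV[C]_m) k - g k) subr_eq0 => /eqP.
- move=> fg; apply/L2nullP; apply: filterS fg => k + kQ => /(_ kQ) fg.
  by rewrite -[LHS]/((f : R * R -> 'cV[C]_m) k - g k) fg subrr.
Qed.

Lemma L2classK (u : L2) : L2class (repr u) = u.
Proof. exact: reprK. Qed.

Lemma L2classD f g : L2class (f + g) = L2class f + L2class g.
Proof. by rewrite /L2class piE. Qed.

Definition L2scale (a : C) (u : L2) : L2 := L2class (a *: repr u).

Lemma L2scaleE a f : L2scale a (L2class f) = L2class (a *: f).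
Proof.
apply/L2class_eq; have /L2class_eq := L2classK (L2class f).
apply: filterS => k + kQ => /(_ kQ) fk.
by rewrite -[LHS]/(a *: (repr (L2class f) : R * R -> 'cV[C]_m) k) fk.
Qed.

Lemma L2scaleA a b u : L2scale a (L2scale b u) = L2scale (a * b) u.
Proof. by rewrite -[u]L2classK !L2scaleE scalerA. Qed.
Lemma L2scale1 : left_id 1 L2scale.
Proof. by move=> u; rewrite -[u]L2classK L2scaleE scale1r. Qed.
Lemma L2scaleDr : right_distributive L2scale +%R.
Proof.
move=> a u v; rewrite -[u]L2classK -[v]L2classK.
by rewrite -L2classD !L2scaleE -L2classD scalerDr.
Qed.
Lemma L2scaleDl u : {morph L2scale^~ u : a b / a + b}.
Proof. by move=> a b; rewrite -[u]L2classK !L2scaleE -L2classD scalerDl. Qed.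

HB.instance Definition _ :=
  GRing.Zmodule_isLmodule.Build C L2 L2scaleA L2scale1 L2scaleDr L2scaleDl.

Lemma L2classZ a f : L2class (a *: f) = a *: L2class f.
Proof. by rewrite -[RHS]/(L2scale a (L2class f)) L2scaleE. Qed.

Definition L2norm (u : L2) : C :=
  (Num.sqrt (\int[leb2]_(k in unit_square) sqnorm (repr u k)))%:C.

Lemma L2norm_class f :
  L2norm (L2class f) =
  (Num.sqrt (\int[leb2]_(k in unit_square) sqnorm (f k)))%:C.
Proof.
congr (Num.sqrt (fine _))%:C; apply: ae_eq_integral.
- exact: measurable_unit_square.
- by have /L2funP[] := L2fun_valP (repr (L2class f)) => /measurable_sqnorm.
- by have /L2funP[] := L2fun_valP f => /measurable_sqnorm.
- have /L2class_eq := L2classK (L2class f).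
  by apply: filterS => k + kQ => /(_ kQ) ->.
Qed.

Lemma L2norm_fin f :
  (\int[leb2]_(k in unit_square) (sqnorm ((f : L2fun_type) k))%:E)%E \is a fin_num.
Proof.
by rewrite ge0_fin_numE ?ge0_int_sqnorm//; have /L2funP[] := L2fun_valP f.
Qed.

Lemma L2normZ a u : L2norm (a *: u) = `|a| * L2norm u.
Proof.
rewrite -[u]L2classK -L2classZ !L2norm_class.
have /L2funP[mf _] := L2fun_valP (repr u).
rewrite /Rintegral (int_sqnormZ a mf) fineM ?L2norm_fin//=.
by rewrite normc_def -rmorphM -sqrtrM// addr_ge0 ?sqr_ge0.
Qed.

Lemma L2norm0_eq0 u : L2norm u = 0 -> u = 0.
Proof.
rewrite -[u]L2classK L2norm_class.
have /L2funP[mf _] := L2fun_valP (repr u).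
move=> [/eqP]; rewrite sqrtr_eq0 => int0.
have {}int0 : (\int[leb2]_(k in unit_square) (sqnorm (repr u k))%:E = 0)%E.
  by rewrite -(fineK (L2norm_fin _)); congr EFin; apply/le_anti;
    rewrite int0 fine_ge0// ge0_int_sqnorm.
have -> : (0 : L2) = L2class 0 by rewrite /L2class piE.
apply/L2class_eq.
have /(ae_eq_integral_abs _ measurable_unit_square (measurable_sqnorm mf)) : 
  (\int[leb2]_(k in unit_square) `|(sqnorm (repr u k))%:E| = 0)%E.
  by under eq_integral do rewrite gee0_abs ?lee_fin ?sqnorm_ge0//.
apply: filterS => k + kQ => /(_ kQ) [] /sqnorm_eq0 ->.
by [].
Qed.

Lemma ler_L2normD u v : L2norm (u + v) <= L2norm u + L2norm v.
Proof.
rewrite -[u]L2classK -[v]L2classK -L2classD !L2norm_class.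
have /L2funP[mf _] := L2fun_valP (repr u).
have /L2funP[mg _] := L2fun_valP (repr v).
have mfg : measurable_on_square (repr u + repr v).
  by have /L2funP[] := L2fun_valP (repr u + repr v).
set S := Rintegral _ _ _; set A := Rintegral _ _ _; set B := Rintegral _ _ _.
have key t : 0 < t -> S <= (1 + t) * A + (1 + t^-1) * B.
  move=> t0; have := int_sqnormD t0 mf mg.
  rewrite -(fineK (L2norm_fin (repr u))) -(fineK (L2norm_fin (repr v))).
  by rewrite -(fineK (L2norm_fin (repr u + repr v))) -!EFinM -EFinD lee_fin.
have A0 : 0 <= A by apply: Rintegral_ge0 => k _; exact: sqnorm_ge0.
have B0 : 0 <= B by apply: Rintegral_ge0 => k _; exact: sqnorm_ge0.
rewrite -rmorphD/= lecR; apply/ler_addgt0Pr => e e0.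
pose a := Num.sqrt A + e / 2; pose b := Num.sqrt B + e / 2.
have a0 : 0 < a by rewrite ltr_wpDl ?sqrtr_ge0// divr_gt0.
have b0 : 0 < b by rewrite ltr_wpDl ?sqrtr_ge0// divr_gt0.
have -> : Num.sqrt A + Num.sqrt B + e = a + b.
  by rewrite /a /b addrACA -splitr.
have Aa : A <= a ^+ 2.
  rewrite -[leLHS]sqr_sqrtr// ler_pXn2r ?nnegrE ?sqrtr_ge0 ?(ltW a0)//.
  by rewrite lerDl divr_ge0// ltW.
have Bb : B <= b ^+ 2.
  rewrite -[leLHS]sqr_sqrtr// ler_pXn2r ?nnegrE ?sqrtr_ge0 ?(ltW b0)//.
  by rewrite lerDl divr_ge0// ltW.
have -> : a + b = Num.sqrt ((a + b) ^+ 2).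
  by rewrite sqrtr_sqr ger0_norm// ltW// addr_gt0.
apply: ler_wsqrtr.
apply: (le_trans (key _ (divr_gt0 b0 a0))).
have -> : (a + b) ^+ 2 = (1 + b / a) * a ^+ 2 + (1 + (b / a)^-1) * b ^+ 2.
  by field; rewrite !gt_eqF.
apply: lerD; apply: ler_wpM2l => //.
- by rewrite addr_ge0// divr_ge0// ltW.
- by rewrite addr_ge0// invr_ge0 divr_ge0// ltW.
Qed.

HB.instance Definition _ :=
  Lmodule_isNormed.Build C L2 ler_L2normD L2normZ L2norm0_eq0.

Lemma L2normE f :
  `|L2class f| = (Num.sqrt (\int[leb2]_(k in unit_square) sqnorm (f k)))%:C.
Proof. exact: L2norm_class. Qed.

End L2space.

(* An arbitrary representative. *)
Definition L2repr (R : realType) (m : nat) (u : L2 R m) : R * R -> 'cV[R[i]]_m :=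
  L2fun_val (repr u).
Coercion L2repr : L2 >-> Funclass.

(* The class of [f], with 0 as default value if [f] is not square integrable.
   The default is not reached for the operators of interest: the average of a
   square integrable function, its product with a function that is continuous
   on the square, and its image under a bounded measurable kernel are square
   integrable, and their classes do not depend on the representative chosen. *)
Definition toL2 (R : realType) (m : nat) (f : R * R -> 'cV[R[i]]_m) : L2 R m :=
  oapp (@L2class R m) 0 (insub f).

Lemma toL2E (R : realType) (m : nat) (f : R * R -> 'cV[R[i]]_m)
  (fL2 : f \in L2fun) : toL2 f = L2class (L2Fun fL2).
Proof.
by rewrite /toL2 insubT /=; congr L2class; exact: val_inj.
Qed.

Section Operators.
Context {K : numFieldType} {V : normedModType K}.
Implicit Types S T : V -> V.

Definition bounded_operator T : Prop :=
  linear T /\ exists c : K, forall u, `|T u| <= c * `|u|.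

Definition compact_operator T : Prop :=
  linear T /\ precompact (T @` [set u | `|u| <= 1]).

Definition invertible_operator T : Prop :=
  exists S, [/\ bounded_operator S, cancel S T & cancel T S].

Definition spectrum T : set K :=
  [set lambda | ~ invertible_operator (fun u => T u - lambda *: u)].

(* Subalgebras of the algebra of all bounded operators, with composition as
   product and without any topological closure. *)
Definition operator_subalgebra (A : set (V -> V)) : Prop :=
  [/\ A `<=` bounded_operator,
      forall (a : K) S T, A S -> A T -> A (fun u => a *: S u + T u) &
      forall S T, A S -> A T -> A (S \o T)].

End Operators.

Section L2operators.
Context {R : realType}.
Local Notation C := R[i].

Definition mulop (m n : nat) (A : R * R -> 'M[C]_(m, n)) (u : L2 R n) :
    L2 R m :=
  toL2 (fun k => A k *m u k).

Definition avg1op (m : nat) (u : L2 R m) : L2 R m := toL2 (fun k => avg1 u k.2).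

Definition avg2op (m : nat) (u : L2 R m) : L2 R m := toL2 (fun k => avg2 u k.1).

(* The integral operator with kernel D over the whole square. *)
Definition kernelop (m n : nat) (D : R * R -> R * R -> 'M[C]_(m, n))
    (u : L2 R n) : L2 R m :=
  toL2 (fun k => avg12 (fun k' => D k k' *m u k')).

Definition continuous_on_square (m n : nat) (A : R * R -> 'M[C]_(m, n)) : Prop :=
  {within unit_square, continuous A}.

Definition operator_algebra (M : nat) : set (L2 R M -> L2 R M) :=
  smallest operator_subalgebra
    ([set mulop A | A in @continuous_on_square M M]
     `|` [set @avg1op M; @avg2op M] `|` compact_operator).

End L2operators.

(* All inverses are given by [invmx], which is the inverse of the matrix only
   if its determinant is nonzero; accordingly [sigma1], [sigma2] and [sigma3]
   only involve the values of lambda for which the inverses exist everywhere on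
   the square. *)
Section Symbols.
Context {R : realType} {M M1 M2 : nat}.
Local Notation C := R[i].
Variables (A0 : R * R -> 'M[C]_M).
Variables (A1 : R * R -> 'M[C]_(M, M1)) (B1 : R * R -> 'M[C]_(M1, M)).
Variables (A2 : R * R -> 'M[C]_(M, M2)) (B2 : R * R -> 'M[C]_(M2, M)).
Variable K : L2 R M -> L2 R M.
Implicit Types (lambda : C) (k : R * R).

Definition E0 lambda k : 'M[C]_M := A0 k - lambda%:M.

Definition C0 lambda k : 'M[C]_M := invmx (E0 lambda k).
Definition C1 lambda k : 'M[C]_(M, M1) := C0 lambda k *m A1 k.
Definition C2 lambda k : 'M[C]_(M, M2) := C0 lambda k *m A2 k.

Definition E1 lambda (k2 : R) : 'M[C]_M1 :=
  1%:M + avg1 (fun k => B1 k *m C1 lambda k) k2.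
Definition E2 lambda (k1 : R) : 'M[C]_M2 :=
  1%:M + avg2 (fun k => B2 k *m C2 lambda k) k1.

Definition D1 lambda k k' : 'M[C]_M :=
  C1 lambda k *m invmx (E1 lambda k.2) *m B1 (k'.1, k.2)
    *m C2 lambda (k'.1, k.2) *m B2 k'.
Definition D2 lambda k k' : 'M[C]_M :=
  C2 lambda k *m invmx (E2 lambda k.1)
    *m avg2 (fun q => B2 q *m D1 lambda q k') k.1.

(* I - C_1 E_1^-1 <B_1 .>_1 and I - C_2 E_2^-1 <B_2 .>_2. *)
Definition elim1 lambda (u : L2 R M) : L2 R M :=
  u - mulop (fun k => C1 lambda k *m invmx (E1 lambda k.2))
        (avg1op (mulop B1 u)).
Definition elim2 lambda (u : L2 R M) : L2 R M :=
  u - mulop (fun k => C2 lambda k *m invmx (E2 lambda k.1))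
        (avg2op (mulop B2 u)).

Definition Rop lambda : L2 R M -> L2 R M :=
  elim2 lambda \o elim1 lambda \o mulop (C0 lambda).

Definition K1 lambda (u : L2 R M) : L2 R M :=
  kernelop (fun k k' => D2 lambda k k' - D1 lambda k k') u + Rop lambda (K u).

Definition sigma0 : set C :=
  [set lambda | exists2 k, unit_square k & \det (E0 lambda k) = 0].
Definition sigma1 : set C :=
  [set lambda | ~ sigma0 lambda /\
    exists2 k2 : R, unit_itv k2 & \det (E1 lambda k2) = 0].
Definition sigma2 : set C :=
  [set lambda | ~ sigma0 lambda /\
    exists2 k1 : R, unit_itv k1 & \det (E2 lambda k1) = 0].
Definition sigma3 : set C :=
  [set lambda | ~ (sigma0 `|` sigma1 `|` sigma2) lambda /\
    ~ invertible_operator (fun u => u + K1 lambda u)].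

End Symbols.

(* Main.v *)
Require Import Defs.
From mathcomp Require Import all_boot all_order all_algebra.
From mathcomp Require Import all_classical all_reals all_analysis.
From mathcomp Require Import complex measurable_realfun ring lra.
Import Order.TTheory GRing.Theory Num.Theory numFieldNormedType.Exports.
Local Open Scope classical_set_scope.
Local Open Scope ring_scope.

Set Implicit Arguments.
Unset Strict Implicit.
Unset Printing Implicit Defensive.

(** Write P_j u for the average < B_j u >_j, so that the operator is
    A_0 + A_1 P_1 + A_2 P_2 + K, and subtract lambda.

    Outside sigma_0, multiplication by C_0 turns A_0 - lambda into the
    identity.  The function P_j u does not depend on k_j, hence
    P_j (C_j P_j u) = (E_j - I) P_j u, and it follows that I + C_j P_j has the
    inverse I - C_j E_j^-1 P_j as soon as E_j is invertible everywhere
    ([blockK], [block_invK]).  Outside sigma_1 and sigma_2 as well, the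
    operator R, a product of such inverses, is therefore a bounded bijection.
    Multiplying A - lambda by R leaves the identity, the term R K, and the
    cross terms in which P_1 and P_2 both occur; by Fubini the cross terms are
    the integral operator with kernel D_2 - D_1 ([kernelop_D2D1],
    [Rop_elimination]).  So A - lambda and I + K_1 are invertible together
    ([invertible_operator_left]).

    For lambda in one of the first three sets, A - lambda is not invertible
    because the part without K annihilates, in the limit, a bounded sequence
    whose members stay away from each other, while K maps two of them close
    together ([singular_sequence]).  Where E_0 degenerates, the sequence
    consists of a kernel vector of E_0 times normalized indicators of disjoint
    rectangles that shrink to the point: E_0 is small on that vector there by
    continuity, and the averages are small because the rectangles are
    ([singular_E0]).  Where E_j degenerates at a value of the free
    variable, the sequence consists of C_j v, with v in the kernel, times
    normalized indicators of disjoint intervals in the free variable; then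
    P_j gives (E_j - I) v, so the first two terms add up to A_j E_j v, which is
    small, and the average in the other direction is small since it runs over
    the short intervals ([singular_E]).

    On L2 everything is computed pointwise on representatives whose sections
    in both directions are square integrable ([nice]); every class has one
    ([nice_repr]).  Both averaging directions are treated at once by means of a
    boolean, true standing for the average in the first variable. *)

(** * Uniformly continuous functions on the square *)

Local Notation cabs := ComplexField.Normc.normc.

Section Modulus.
Local Open Scope complex_scope.
Local Notation Re := complex.Re.
Local Notation Im := complex.Im.
Context {R : realType}.
Local Notation C := R[i].
Implicit Types (x y z : C).

Lemma cabsE z : `|z| = (cabs z)%:C.
Proof. by case: z => a b; rewrite normc_def. Qed.

Lemma cabs_ge0 z : 0 <= cabs z.
Proof. by case: z => a b; exact: sqrtr_ge0. Qed.

Lemma cabsM x y : cabs (x * y) = cabs x * cabs y.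
Proof. exact: ComplexField.Normc.normcM. Qed.

Lemma cabsD x y : cabs (x + y) <= cabs x + cabs y.
Proof. by rewrite -lecR rmorphD/= -!cabsE; exact: ler_normD. Qed.

Lemma cabsN x : cabs (- x) = cabs x.
Proof. exact: (@normcN R). Qed.

Lemma cabsBC x y : cabs (x - y) = cabs (y - x).
Proof. by rewrite -cabsN opprB. Qed.

Lemma cabs0 : cabs (0 : C) = 0.
Proof. exact: ComplexField.Normc.normc0. Qed.

Lemma cabs_gt0 x : x != 0 -> 0 < cabs x.
Proof.
move=> x0; rewrite lt0r cabs_ge0 andbT; apply: contra_neq x0.
exact: ComplexField.Normc.eq0_normc.
Qed.

Lemma cabsV x : cabs x^-1 = (cabs x)^-1.
Proof. exact: ComplexField.Normc.normcV. Qed.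

Lemma cabs_sum (I : Type) (s : seq I) (P : pred I) (F : I -> C) :
  cabs (\sum_(i <- s | P i) F i) <= \sum_(i <- s | P i) cabs (F i).
Proof.
elim/big_ind2 : _ => // [|x a y b xa yb]; first by rewrite cabs0.
by rewrite (le_trans (cabsD _ _))// lerD.
Qed.

Lemma cabs_sqr z : cabs z ^+ 2 = Re z ^+ 2 + Im z ^+ 2.
Proof. by case: z => a b /=; rewrite sqr_sqrtr// addr_ge0 ?sqr_ge0. Qed.

Lemma Re_cabs z : `|Re z| <= cabs z.
Proof.
rewrite -(@ler_pXn2r _ 2)// ?nnegrE ?cabs_ge0// cabs_sqr.
by rewrite real_normK ?num_real// lerDl sqr_ge0.
Qed.

Lemma Im_cabs z : `|Im z| <= cabs z.
Proof.
rewrite -(@ler_pXn2r _ 2)// ?nnegrE ?cabs_ge0// cabs_sqr.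
by rewrite real_normK ?num_real// lerDr sqr_ge0.
Qed.

Lemma cabs_ReIm z : cabs z <= `|Re z| + `|Im z|.
Proof.
rewrite -(@ler_pXn2r _ 2)// ?nnegrE ?cabs_ge0 ?addr_ge0// cabs_sqr.
rewrite sqrrD -[Re z ^+ 2]real_normK ?num_real//.
rewrite -[Im z ^+ 2]real_normK ?num_real// lerD2r lerDl.
by rewrite mulrn_wge0// mulr_ge0.
Qed.

Lemma sqnormE m (v : 'cV[C]_m) : sqnorm v = \sum_i cabs (v i 0) ^+ 2.
Proof. by apply: eq_bigr => i _; rewrite cabs_sqr. Qed.

Lemma cabs_sqnorm m (v : 'cV[C]_m) i : cabs (v i 0) ^+ 2 <= sqnorm v.
Proof.
rewrite sqnormE (bigD1 i)//= lerDl sumr_ge0// => j _; exact: sqr_ge0.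
Qed.

Lemma sqnorm_le m (v : 'cV[C]_m) (c : R) : 
  (forall i, cabs (v i 0) <= c) -> sqnorm v <= m%:R * c ^+ 2.
Proof.
move=> vc; rewrite sqnormE -[m in leRHS]card_ord -sumr_const mulr_suml.
apply: ler_sum => i _; rewrite mul1r ler_pXn2r ?nnegrE ?cabs_ge0//.
exact: le_trans (cabs_ge0 _) (vc i).
Qed.

Lemma sqnorm_mulmx m n (A : 'M[C]_(m, n)) (v : 'cV[C]_n) (c : R) :
  (forall i j, cabs (A i j) <= c) ->
  sqnorm (A *m v) <= (m%:R * (n%:R * c) ^+ 2) * sqnorm v.
Proof.
move=> Ac; rewrite -mulrA -[X in _ * (_ * X)]sqr_sqrtr ?sqnorm_ge0// -exprMn.
apply: sqnorm_le => i; rewrite mxE; apply: (le_trans (cabs_sum _ _ _)).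
have -> : n%:R * c * Num.sqrt (sqnorm v) = \sum_(j < n) c * Num.sqrt (sqnorm v).
  by rewrite sumr_const card_ord -mulrA mulr_natl.
apply: ler_sum => j _; rewrite cabsM ler_pM ?cabs_ge0//.
rewrite -(@ler_pXn2r _ 2)// ?nnegrE ?cabs_ge0 ?sqrtr_ge0//.
by rewrite sqr_sqrtr ?sqnorm_ge0// cabs_sqnorm.
Qed.

End Modulus.

Section Ucont.
Local Open Scope complex_scope.
Local Notation Re := complex.Re.
Local Notation Im := complex.Im.
Context {R : realType}.
Local Notation C := R[i].
Local Notation Q := (@unit_square R).
Implicit Types (f g : R * R -> C).

Definition ucont f := forall e : R, 0 < e -> exists2 d : R, 0 < d &
  forall k k' : R * R, Q k -> Q k' -> `|k.1 - k'.1| < d -> `|k.2 - k'.2| < d ->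
    cabs (f k - f k') < e.

Lemma unit_square_compact : compact (Q : set (R * R)).
Proof.
have := compact_setX (@segment_compact R 0 1) (@segment_compact R 0 1).
exact.
Qed.

Lemma eq_ucont f g : (forall k, Q k -> f k = g k) -> ucont f -> ucont g.
Proof.
move=> fg uf e /uf[d d0 H]; exists d => // k k' Qk Qk' *.
by rewrite -!fg//; exact: H.
Qed.

(** A pointwise estimate that holds near every point of the square, with a
    large enough constant, holds on the whole square by compactness. *)
Lemma unit_square_uniform (P : R -> R * R -> Prop) :
  (forall k, Q k -> exists d M : R, 0 < d /\ forall k' N, Q k' ->
     `|k.1 - k'.1| < d -> `|k.2 - k'.2| < d -> M <= N -> P N k') ->
  exists2 M, 0 < M & forall k, Q k -> P M k.
Proof.
move=> H.
have /compact_near_coveringP/near_covering_withinP cQ := unit_square_compact.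
suff [M [Mr HM]] : \forall N \near +oo, Q `<=` P N.
  exists (Num.max (M + 1) 1); first by rewrite lt_max ltr01 orbT.
  by move=> k Qk; apply: HM => //; rewrite lt_max ltrDl ltr01.
apply: cQ => k /H [d [M [d0 HP]]].
exists (ball k d, [set N | M <= N]).
  split => /=; first exact: nbhsx_ballx.
  by apply: nbhs_pinfty_ge; rewrite num_real.
by move=> [k' N] /= [[k1 k2] MN] Qk'; apply: HP.
Qed.

Lemma ucont_bounded f : ucont f ->
  exists2 M, 0 < M & forall k, Q k -> cabs (f k) <= M.
Proof.
move=> /(_ 1 ltr01) [d d0 uf]; apply: unit_square_uniform => k Qk.
exists d, (cabs (f k) + 1); split => // k' N Qk' k1 k2; apply: le_trans.
rewrite -[f k'](subrK (f k)) (le_trans (cabsD _ _))// addrC lerD2l ltW//.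
by rewrite cabsBC; exact: uf.
Qed.

(** By compactness 1 <= M |f| holds with one constant M. *)
Lemma ucont_neq0 f : ucont f -> (forall k, Q k -> f k != 0) ->
  exists2 c, 0 < c & forall k, Q k -> c <= cabs (f k).
Proof.
move=> uf f0; have [|M M0 HM] := @unit_square_uniform (fun M k => 1 <= M * cabs (f k)).
  move=> k Qk; have fk0 := cabs_gt0 (f0 _ Qk).
  have [d d0 ud] := uf (cabs (f k) / 2) (divr_gt0 fk0 (ltr0n _ 2)).
  exists d, (2 / cabs (f k)); split => // k' N Qk' k1 k2 MN.
  have N0 : 0 <= N by rewrite (le_trans _ MN)// divr_ge0// ltW.
  apply: (@le_trans _ _ (N * (cabs (f k) / 2))).
    by rewrite mulrA ler_pdivlMr// mul1r -ler_pdivrMr.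
  rewrite ler_wpM2l//.
  have := cabsD (f k') (f k - f k'); rewrite addrC subrK.
  have := ud _ _ Qk Qk' k1 k2; lra.
by exists M^-1; rewrite ?invr_gt0// => k /HM; rewrite mulrC -ler_pdivrMr// mul1r.
Qed.

Lemma ucont_cst (c : C) : ucont (fun=> c).
Proof. by move=> e e0; exists 1 => // k k' *; rewrite subrr cabs0. Qed.

Lemma ucontD f g : ucont f -> ucont g -> ucont (fun k => f k + g k).
Proof.
move=> uf ug e e0; have e2 : 0 < e / 2 by rewrite divr_gt0.
have [d d0 fd] := uf _ e2; have [d' d'0 gd] := ug _ e2.
exists (Num.min d d'); first by rewrite lt_min d0.
move=> k k' Qk Qk'; rewrite !lt_min => /andP[? ?] /andP[? ?].
rewrite opprD addrACA (le_lt_trans (cabsD _ _))// [e]splitr ltrD//; 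
 [exact: fd|exact: gd].
Qed.

Lemma ucontM f g : ucont f -> ucont g -> ucont (fun k => f k * g k).
Proof.
move=> uf ug e e0.
have [a a0 fa] := ucont_bounded uf; have [b b0 gb] := ucont_bounded ug.
have [d d0 fd] := uf _ (divr_gt0 (divr_gt0 e0 (ltr0n _ 2)) b0).
have [d' d'0 gd] := ug _ (divr_gt0 (divr_gt0 e0 (ltr0n _ 2)) a0).
exists (Num.min d d'); first by rewrite lt_min d0.
move=> k k' Qk Qk'; rewrite !lt_min => /andP[k1 k1'] /andP[k2 k2'].
have -> : f k * g k - f k' * g k' = (f k - f k') * g k + f k' * (g k - g k').
  by ring.
rewrite (le_lt_trans (cabsD _ _))// [e]splitr !cabsM ltrD//.
- apply: (@le_lt_trans _ _ (cabs (f k - f k') * b)).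
    by rewrite ler_wpM2l ?cabs_ge0 ?gb.
  by rewrite -ltr_pdivlMr//; exact: fd.
- apply: (@le_lt_trans _ _ (a * cabs (g k - g k'))).
    by rewrite ler_wpM2r ?cabs_ge0 ?fa.
  by rewrite mulrC -ltr_pdivlMr//; exact: gd.
Qed.

Lemma ucontN f : ucont f -> ucont (fun k => - f k).
Proof.
move=> uf; apply: (@eq_ucont (fun k => -1 * f k)); first by move=> *; rewrite mulN1r.
by apply: ucontM => //; exact: ucont_cst.
Qed.

Lemma ucontV f : ucont f -> (forall k, Q k -> f k != 0) ->
  ucont (fun k => (f k)^-1).
Proof.
move=> uf f0; have [c c0 fc] := ucont_neq0 uf f0.
move=> e e0; have [d d0 fd] := uf _ (mulr_gt0 e0 (mulr_gt0 c0 c0)).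
exists d => // k k' Qk Qk' k1 k2.
have -> : (f k)^-1 - (f k')^-1 = (f k' - f k) * (f k)^-1 * (f k')^-1.
  by field; rewrite !f0.
rewrite !cabsM !cabsV cabsBC -ltr_pdivlMr ?invr_gt0 ?cabs_gt0 ?f0//.
rewrite -ltr_pdivlMr ?invr_gt0 ?cabs_gt0 ?f0// !invrK -mulrA.
apply: lt_le_trans (fd _ _ Qk Qk' k1 k2) _.
by rewrite ler_wpM2l ?(ltW e0)// ler_pM ?(ltW c0)// fc.
Qed.

Lemma ucont_sum (I : Type) (s : seq I) (P : pred I) (F : I -> R * R -> C) :
  (forall i, P i -> ucont (F i)) -> ucont (fun k => \sum_(i <- s | P i) F i k).
Proof.
move=> uF; elim: s => [|i s IH].
  by apply: (@eq_ucont (fun=> 0)); [move=> *; rewrite big_nil|exact: ucont_cst].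
have [Pi|Pi] := boolP (P i).
  by apply: (eq_ucont _ (ucontD (uF i Pi) IH)) => k _; rewrite big_cons Pi.
by apply: (eq_ucont _ IH) => k _; rewrite big_cons (negbTE Pi).
Qed.

Lemma ucont_prod (I : Type) (s : seq I) (P : pred I) (F : I -> R * R -> C) :
  (forall i, P i -> ucont (F i)) -> ucont (fun k => \prod_(i <- s | P i) F i k).
Proof.
move=> uF; elim: s => [|i s IH].
  by apply: (@eq_ucont (fun=> 1)); [move=> *; rewrite big_nil|exact: ucont_cst].
have [Pi|Pi] := boolP (P i).
  by apply: (eq_ucont _ (ucontM (uF i Pi) IH)) => k _; rewrite big_cons Pi.
by apply: (eq_ucont _ IH) => k _; rewrite big_cons (negbTE Pi).
Qed.

Definition mcont m n (F : R * R -> 'M[C]_(m, n)) :=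
  forall i j, ucont (fun k => F k i j).

Lemma eq_mcont m n (F G : R * R -> 'M[C]_(m, n)) :
  (forall k, Q k -> F k = G k) -> mcont F -> mcont G.
Proof. by move=> FG uF i j; apply: eq_ucont (uF i j) => k Qk; rewrite FG. Qed.

Lemma mcont_cst m n (A : 'M[C]_(m, n)) : mcont (fun=> A).
Proof. by move=> i j; exact: ucont_cst. Qed.

Lemma mcontD m n (F G : R * R -> 'M[C]_(m, n)) :
  mcont F -> mcont G -> mcont (fun k => F k + G k).
Proof.
by move=> uF uG i j; apply: eq_ucont (ucontD (uF i j) (uG i j)) => k _; rewrite mxE.
Qed.

Lemma mcontN m n (F : R * R -> 'M[C]_(m, n)) :
  mcont F -> mcont (fun k => - F k).
Proof.
by move=> uF i j; apply: eq_ucont (ucontN (uF i j)) => k _; rewrite mxE.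
Qed.

Lemma mcontB m n (F G : R * R -> 'M[C]_(m, n)) :
  mcont F -> mcont G -> mcont (fun k => F k - G k).
Proof. by move=> uF uG; apply: mcontD => //; exact: mcontN. Qed.

Lemma mcontM m n p (F : R * R -> 'M[C]_(m, n)) (G : R * R -> 'M[C]_(n, p)) :
  mcont F -> mcont G -> mcont (fun k => F k *m G k).
Proof.
move=> uF uG i j.
apply: (@eq_ucont (fun k => \sum_l F k i l * G k l j)); first by move=> k _; rewrite mxE.
by apply: ucont_sum => l _; exact: ucontM.
Qed.

Lemma ucont_det n (F : R * R -> 'M[C]_n) : mcont F -> ucont (fun k => \det (F k)).
Proof.
move=> uF; rewrite /determinant; apply: ucont_sum => s _.
by apply: ucontM; [exact: ucont_cst|apply: ucont_prod => i _; exact: uF].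
Qed.

(** The entries of the inverse are cofactors divided by the determinant. *)
Lemma mcont_invmx n (F : R * R -> 'M[C]_n) : mcont F ->
  (forall k, Q k -> \det (F k) != 0) -> mcont (fun k => invmx (F k)).
Proof.
move=> uF F0 i j; apply: (@eq_ucont (fun k => (\det (F k))^-1 * cofactor (F k) j i)).
  by move=> k Qk; rewrite /invmx unitmxE unitfE F0// !mxE.
apply: ucontM; first by apply: ucontV => //; exact: ucont_det.
apply: ucontM; first exact: ucont_cst.
apply: ucont_det => a b; have := uF (lift j a) (lift i b).
by apply: eq_ucont => k _; rewrite !mxE.
Qed.

Lemma mcont_bounded m n (F : R * R -> 'M[C]_(m, n)) : mcont F ->
  exists2 M, 0 < M & forall k, Q k -> forall i j, cabs (F k i j) <= M.
Proof.
move=> uF; have cb i j := cid2 (ucont_bounded (uF i j)).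
exists (1 + \sum_i \sum_j s2val (cb i j)).
  rewrite ltr_pwDl//; apply: sumr_ge0 => i _; apply: sumr_ge0 => j _.
  by case: (cb i j) => M /= /ltW.
move=> k Qk i j; have c0 i' j' : 0 <= s2val (cb i' j') by case: (cb i' j') => M /= /ltW.
rewrite (bigD1 i)//= (bigD1 j)//=; have : cabs (F k i j) <= s2val (cb i j).
  by case: (cb i j) => M /= _; exact.
move=> h; have s0 (I : finType) (P : pred I) (G : I -> R) : (forall i, 0 <= G i) ->
  0 <= \sum_(i | P i) G i by move=> G0; apply: sumr_ge0 => *; exact: G0.
rewrite (le_trans h)// -addrA [leRHS]addrCA lerDl addr_ge0// addr_ge0// s0//.
by move=> i'; apply: s0 => j'; exact: c0.
Qed.

(** The Heine-Cantor theorem; all coefficients are used through this modulus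
    of continuity, which survives products, averages and inverses. *)
Lemma continuous_mcont m n (F : R * R -> 'M[C]_(m, n)) :
  continuous_on_square F -> mcont F.
Proof.
move=> cF i j e e0.
have [|M M0 HM] := @unit_square_uniform (fun M k => forall k', Q k' ->
    `|k.1 - k'.1| < M^-1 -> `|k.2 - k'.2| < M^-1 -> cabs (F k i j - F k' i j) < e).
  move=> k Qk.
  have e2 : 0 < (e / 2)%:C :> C by rewrite ltcR divr_gt0.
  have := cF; rewrite /continuous_on_square continuous_subspace_in => /(_ k (mem_set Qk)).
  move=> /cvg_ballP/(_ _ e2).
  rewrite /nbhs/= -nbhs_subspace_in//.
  rewrite /within/= => /nbhs_ballP[d /= d0 dF].
  exists (d / 2), (2 / d); split; first by rewrite divr_gt0.
  move=> k' N Qk' k1 k2 dN k'' Qk'' k1' k2'.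
  have N0 : 0 < N by rewrite (lt_le_trans _ dN)// divr_gt0.
  have Nd : N^-1 <= d / 2 by rewrite -[d / 2]invrK lef_pV2 ?posrE ?invr_gt0 ?divr_gt0// invf_div.
  have dFC y : Q y -> `|k.1 - y.1| < d -> `|k.2 - y.2| < d ->
      cabs (F k i j - F y i j) < e / 2.
    move=> Qy y1 y2; have [] := dF y (conj y1 y2) Qy => _ /(_ i j).
    by rewrite -ball_normE/= cabsE ltcR.
  have -> : F k' i j - F k'' i j = - (F k i j - F k' i j) + (F k i j - F k'' i j).
    by ring.
  rewrite (le_lt_trans (cabsD _ _))// [e]splitr cabsN ltrD//.
    by apply: dFC => //; lra.
  have tri (x y z : R) : `|x - y| < d / 2 -> `|y - z| < N^-1 -> `|x - z| < d.
    move=> xy yz; have := ler_distD y x z; lra.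
  by apply: dFC => //; [exact: tri k1 k1'|exact: tri k2 k2'].
exists M^-1; first by rewrite invr_gt0.
by move=> k k' Qk Qk'; exact: HM.
Qed.
End Ucont.

(** * Integration of complex and matrix-valued functions *)

Section ComplexIntegral.
Local Open Scope complex_scope.
Local Notation Re := complex.Re.
Local Notation Im := complex.Im.
Context {d : measure_display} {T : measurableType d} {R : realType}.
Variables (mu : {measure set T -> \bar R}) (D : set T).
Hypotheses (mD : measurable D) (muD : (mu D < +oo)%E).
Local Notation C := R[i].
Implicit Types (f g : T -> C).

Definition cmeas f :=
  measurable_fun D (fun x => Re (f x)) /\ measurable_fun D (fun x => Im (f x)).

Lemma eq_cmeas f g : (forall x, D x -> f x = g x) -> cmeas f -> cmeas g.
Proof.
move=> fg [mr mi]; split.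
  by apply: eq_measurable_fun mr => x /set_mem Dx; rewrite fg.
by apply: eq_measurable_fun mi => x /set_mem Dx; rewrite fg.
Qed.

Lemma cmeas_cst (c : C) : cmeas (fun=> c).
Proof. by split; exact: measurable_cst. Qed.

Lemma cmeasD f g : cmeas f -> cmeas g -> cmeas (fun x => f x + g x).
Proof.
move=> [fr fi] [gr gi]; split.
  by under eq_fun do rewrite Defs.ReD; exact: measurable_funD.
by under eq_fun do rewrite Defs.ImD; exact: measurable_funD.
Qed.

Lemma cmeasM f g : cmeas f -> cmeas g -> cmeas (fun x => f x * g x).
Proof.
move=> [fr fi] [gr gi]; split.
  under eq_fun do rewrite Defs.ReM.
  by apply: measurable_funB; exact: measurable_funM.
under eq_fun do rewrite Defs.ImM.
by apply: measurable_funD; exact: measurable_funM.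
Qed.

Lemma cmeas_sum (I : Type) (s : seq I) (F : I -> T -> C) :
  (forall i, cmeas (F i)) -> cmeas (fun x => \sum_(i <- s) F i x).
Proof.
move=> mF; elim: s => [|i s IH].
  by apply: eq_cmeas (cmeas_cst 0) => x _; rewrite big_nil.
by apply: eq_cmeas (cmeasD (mF i) IH) => x _; rewrite big_cons.
Qed.

Lemma cmeas_cabs_sqr f : cmeas f -> measurable_fun D (fun x => cabs (f x) ^+ 2).
Proof.
move=> [fr fi]; under eq_fun do rewrite cabs_sqr.
by apply: measurable_funD; exact: measurable_funX.
Qed.

Definition cintegrable f :=
  mu.-integrable D (fun x => (Re (f x))%:E) /\
  mu.-integrable D (fun x => (Im (f x))%:E).

Lemma cintegrable_meas f : cintegrable f -> cmeas f.
Proof.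
by move=> [/integrableP[+ _] /integrableP[+ _]] => /measurable_EFinP ? /measurable_EFinP.
Qed.

(** Domination, for the real and the imaginary part separately. *)
Lemma le_cintegrable f (h : T -> R) : cmeas f ->
  mu.-integrable D (EFin \o h) -> (forall x, D x -> cabs (f x) <= h x) ->
  cintegrable f.
Proof.
move=> [fr fi] ih fh; split; apply: le_integrable ih => //.
- exact/measurable_EFinP.
- move=> x Dx; rewrite /= lee_fin (le_trans (Re_cabs _))// (le_trans (fh _ Dx))//.
  exact: ler_norm.
- exact/measurable_EFinP.
- move=> x Dx; rewrite /= lee_fin (le_trans (Im_cabs _))// (le_trans (fh _ Dx))//.
  exact: ler_norm.
Qed.

Lemma integrable_cst (c : R) : mu.-integrable D (fun=> c%:E).
Proof.
apply/integrableP; split; first exact: measurable_cst.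
rewrite integral_cst// -ge0_fin_numE ?mule_ge0//.
by rewrite fin_numM// ge0_fin_numE.
Qed.

Lemma bounded_cintegrable f (c : R) : cmeas f ->
  (forall x, D x -> cabs (f x) <= c) -> cintegrable f.
Proof. by move=> mf fc; apply: le_cintegrable (integrable_cst c) _. Qed.

Lemma eq_cintegrable f g : (forall x, D x -> f x = g x) ->
  cintegrable f -> cintegrable g.
Proof.
move=> fg [fr fi]; split.
  by apply: eq_integrable fr => // x /set_mem Dx; rewrite fg.
by apply: eq_integrable fi => // x /set_mem Dx; rewrite fg.
Qed.

Lemma cintegrableD f g :
  cintegrable f -> cintegrable g -> cintegrable (fun x => f x + g x).
Proof.
move=> [fr fi] [gr gi]; split.
  by under eq_fun do rewrite Defs.ReD EFinD; exact: integrableD.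
by under eq_fun do rewrite Defs.ImD EFinD; exact: integrableD.
Qed.

Lemma cintegrableZ (c : C) f : cintegrable f -> cintegrable (fun x => c * f x).
Proof.
move=> [fr fi]; split.
  under eq_fun do rewrite Defs.ReM EFinB !EFinM.
  by apply: integrableB => //; exact: integrableZl.
under eq_fun do rewrite Defs.ImM EFinD !EFinM.
by apply: integrableD => //; exact: integrableZl.
Qed.

Lemma cintegrable_sum (I : Type) (s : seq I) (F : I -> T -> C) :
  (forall i, cintegrable (F i)) -> cintegrable (fun x => \sum_(i <- s) F i x).
Proof.
move=> mF; elim: s => [|i s IH].
  apply: (@eq_cintegrable (fun=> 0)) => [x _|]; first by rewrite big_nil.
  by split; exact: integrable_cst.
by apply: eq_cintegrable (cintegrableD (mF i) IH) => x _; rewrite big_cons.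
Qed.

Lemma eq_Cintegral f g : (forall x, D x -> f x = g x) -> Cintegral mu D f = Cintegral mu D g.
Proof.
by move=> fg; congr (_ +i* _); apply: eq_Rintegral => x /set_mem Dx; rewrite fg.
Qed.

Lemma CintegralD f g : cintegrable f -> cintegrable g ->
  Cintegral mu D (fun x => f x + g x) = Cintegral mu D f + Cintegral mu D g.
Proof.
move=> [fr fi] [gr gi]; rewrite /Cintegral; under eq_Rintegral do rewrite Defs.ReD.
under [X in _ +i* X]eq_Rintegral do rewrite Defs.ImD.
by rewrite !RintegralD.
Qed.

Lemma CintegralZ (c : C) f : cintegrable f ->
  Cintegral mu D (fun x => c * f x) = c * Cintegral mu D f.
Proof.
move=> [fr fi]; rewrite /Cintegral; under eq_Rintegral do rewrite Defs.ReM.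
under [X in _ +i* X]eq_Rintegral do rewrite Defs.ImM.
have iZ (a : R) (h : T -> R) : mu.-integrable D (fun x => (h x)%:E) ->
    mu.-integrable D (EFin \o (fun x => a * h x)).
  by move=> /(integrableZl mD a); apply: eq_integrable => // x _; rewrite /= EFinM.
rewrite RintegralB ?RintegralD ?RintegralZl//; try exact: iZ.
by case: c => a b.
Qed.

Lemma Cintegral0 : Cintegral mu D (fun=> 0) = 0.
Proof. by rewrite /Cintegral /Rintegral/= integral0. Qed.

Lemma Cintegral_sum (I : Type) (s : seq I) (F : I -> T -> C) :
  (forall i, cintegrable (F i)) ->
  Cintegral mu D (fun x => \sum_(i <- s) F i x) =
  \sum_(i <- s) Cintegral mu D (F i).
Proof.
move=> mF; elim: s => [|i s IH].
  by rewrite big_nil -[RHS]Cintegral0; apply: eq_Cintegral => x _; rewrite big_nil.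
rewrite big_cons -IH -CintegralD//; last exact: cintegrable_sum.
by apply: eq_Cintegral => x _; rewrite big_cons.
Qed.

(** The factor 2 comes from bounding the real and the imaginary part
    separately. *)
Lemma cabs_Cintegral f (h : T -> R) : cmeas f ->
  mu.-integrable D (EFin \o h) -> (forall x, D x -> cabs (f x) <= h x) ->
  cabs (Cintegral mu D f) <= 2 * \int[mu]_(x in D) h x.
Proof.
move=> mf ih fh; have [fr fi] := le_cintegrable mf ih fh.
rewrite mulr_natl mulr2n (le_trans (cabs_ReIm _))//= lerD//.
- rewrite (le_trans (le_normr_Rintegral _ _))// le_Rintegral//.
    exact: integrable_norm.
  by move=> x Dx; rewrite (le_trans (Re_cabs _))// fh.
- rewrite (le_trans (le_normr_Rintegral _ _))// le_Rintegral//.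
    exact: integrable_norm.
  by move=> x Dx; rewrite (le_trans (Im_cabs _))// fh.
Qed.

Definition mxmeas m n (F : T -> 'M[C]_(m, n)) := forall i j, cmeas (fun x => F x i j).
Definition mxintegrable m n (F : T -> 'M[C]_(m, n)) :=
  forall i j, cintegrable (fun x => F x i j).

Lemma mxmeasM m n p (F : T -> 'M[C]_(m, n)) (G : T -> 'M[C]_(n, p)) :
  mxmeas F -> mxmeas G -> mxmeas (fun x => F x *m G x).
Proof.
move=> mF mG i j.
apply: (@eq_cmeas (fun x => \sum_l F x i l * G x l j)); first by move=> x _; rewrite mxE.
by apply: cmeas_sum => l; exact: cmeasM.
Qed.

Lemma mxmeasD m n (F G : T -> 'M[C]_(m, n)) :
  mxmeas F -> mxmeas G -> mxmeas (fun x => F x + G x).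
Proof.
by move=> mF mG i j; apply: eq_cmeas (cmeasD (mF i j) (mG i j)) => x _; rewrite mxE.
Qed.

Lemma mxintegrableMr m n p (F : T -> 'M[C]_(m, n)) (A : 'M[C]_(n, p)) :
  mxintegrable F -> mxintegrable (fun x => F x *m A).
Proof.
move=> iF i j; apply: (@eq_cintegrable (fun x => \sum_l A l j * F x i l)).
  by move=> x _; rewrite mxE; apply: eq_bigr => l _; rewrite mulrC.
by apply: cintegrable_sum => l; exact: cintegrableZ.
Qed.

Lemma eq_mxintegral m n (F G : T -> 'M[C]_(m, n)) :
  (forall x, D x -> F x = G x) -> mxintegral mu D F = mxintegral mu D G.
Proof.
by move=> FG; apply/matrixP => i j; rewrite !mxE; apply: eq_Cintegral => x Dx; rewrite FG.
Qed.

Lemma mxintegralD m n (F G : T -> 'M[C]_(m, n)) :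
  mxintegrable F -> mxintegrable G ->
  mxintegral mu D (fun x => F x + G x) = mxintegral mu D F + mxintegral mu D G.
Proof.
move=> iF iG; apply/matrixP => i j; rewrite !mxE -CintegralD//.
by apply: eq_Cintegral => x Dx; rewrite mxE.
Qed.

Lemma mxintegralMl m n p (A : 'M[C]_(m, n)) (F : T -> 'M[C]_(n, p)) :
  mxintegrable F ->
  mxintegral mu D (fun x => A *m F x) = A *m mxintegral mu D F.
Proof.
move=> iF; apply/matrixP => i j; rewrite !mxE.
under eq_bigr => l _ do rewrite mxE -CintegralZ//.
rewrite -Cintegral_sum; last by move=> l; exact: cintegrableZ.
by apply: eq_Cintegral => x Dx; rewrite mxE.
Qed.

Lemma mxintegralMr m n p (F : T -> 'M[C]_(m, n)) (A : 'M[C]_(n, p)) :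
  mxintegrable F ->
  mxintegral mu D (fun x => F x *m A) = mxintegral mu D F *m A.
Proof.
move=> iF; apply/matrixP => i j; rewrite !mxE.
under eq_bigr => l _ do rewrite mxE mulrC -CintegralZ//.
rewrite -Cintegral_sum; last by move=> l; exact: cintegrableZ.
by apply: eq_Cintegral => x Dx; rewrite mxE; apply: eq_bigr => l _; rewrite mulrC.
Qed.

(** The same condition serves on the square and on its sections. *)
Definition sqint m (F : T -> 'cV[C]_m) :=
  mxmeas F /\ (\int[mu]_(x in D) (sqnorm (F x))%:E < +oo)%E.

Lemma mxmeas_sqnorm m (F : T -> 'cV[C]_m) : mxmeas F ->
  measurable_fun D (fun x => (sqnorm (F x))%:E).
Proof.
move=> mF; apply/measurable_EFinP; under eq_fun do rewrite sqnormE.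
by apply: measurable_sum => i; exact: cmeas_cabs_sqr.
Qed.

Lemma le_int_sqnorm m m' (F : T -> 'cV[C]_m) (G : T -> 'cV[C]_m') (c : R) :
  mxmeas F -> mxmeas G -> 0 <= c ->
  (forall x, D x -> sqnorm (G x) <= c * sqnorm (F x)) ->
  (\int[mu]_(x in D) (sqnorm (G x))%:E <=
   c%:E * \int[mu]_(x in D) (sqnorm (F x))%:E)%E.
Proof.
move=> mF mG c0 GF; rewrite -ge0_integralZl ?lee_fin//; last 2 first.
- exact: mxmeas_sqnorm.
- by move=> x _; rewrite lee_fin sqnorm_ge0.
apply: ge0_le_integral => //.
- by move=> x _; rewrite lee_fin sqnorm_ge0.
- exact: mxmeas_sqnorm.
- by apply: emeasurable_funM; [exact: measurable_cst|exact: mxmeas_sqnorm].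
Qed.

Lemma sqint_le m m' (F : T -> 'cV[C]_m) (G : T -> 'cV[C]_m') (c : R) :
  0 <= c -> mxmeas G -> (forall x, D x -> sqnorm (G x) <= c * sqnorm (F x)) ->
  sqint F -> sqint G.
Proof.
move=> c0 mG GF [mF iF]; split => //.
apply: (le_lt_trans (le_int_sqnorm mF mG c0 GF)).
rewrite lte_mul_pinfty ?lee_fin//.
Qed.

Lemma eq_sqint m (F G : T -> 'cV[C]_m) : (forall x, D x -> F x = G x) ->
  sqint F -> sqint G.
Proof.
move=> FG sF; apply: (sqint_le (c := 1)) (sF) => //.
  by move=> i j; apply: eq_cmeas (sF.1 i j) => x Dx; rewrite FG.
by move=> x Dx; rewrite mul1r FG.
Qed.

Lemma sqintD m (F G : T -> 'cV[C]_m) : sqint F -> sqint G ->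
  sqint (fun x => F x + G x).
Proof.
move=> [mF iF] [mG iG]; split; first exact: mxmeasD.
apply: (@le_lt_trans _ _ (\int[mu]_(x in D) ((1 + 1) * sqnorm (F x))%:E +
  \int[mu]_(x in D) ((1 + 1) * sqnorm (G x))%:E)%E); last first.
  rewrite lte_add_pinfty//; under eq_integral do rewrite EFinM;
    rewrite ge0_integralZl ?lee_fin//; try exact: mxmeas_sqnorm;
    try (by move=> x _; rewrite lee_fin sqnorm_ge0);
    by rewrite lte_mul_pinfty ?lee_fin.
have mm H : mxmeas H -> measurable_fun D (fun x => ((1 + 1) * sqnorm (H x : 'cV[C]_m))%:E).
  move=> mH; under eq_fun do rewrite EFinM.
  by apply: emeasurable_funM; [exact: measurable_cst|exact: mxmeas_sqnorm].
rewrite -ge0_integralD//; try exact: mm;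
  try (by move=> x _; rewrite lee_fin mulr_ge0 ?sqnorm_ge0).
apply: ge0_le_integral => //.
- by move=> x _; rewrite lee_fin sqnorm_ge0.
- by apply: mxmeas_sqnorm; exact: mxmeasD.
- by apply: emeasurable_funD; exact: mm.
- move=> x _; rewrite -EFinD lee_fin.
  by have := @sqnormD_le R m 1 (F x) (G x) ltr01; rewrite invr1.
Qed.

Lemma sqintM m n (A : T -> 'M[C]_(m, n)) (F : T -> 'cV[C]_n) (c : R) :
  mxmeas A -> (forall x, D x -> forall i j, cabs (A x i j) <= c) ->
  sqint F -> sqint (fun x => A x *m F x).
Proof.
move=> mA Ac sF; apply: (sqint_le (c := m%:R * (n%:R * c) ^+ 2)) (sF).
- by rewrite mulr_ge0 ?sqr_ge0.
- by apply: mxmeasM => //; exact: sF.1.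
- by move=> x Dx; apply: sqnorm_mulmx => i j; exact: Ac.
Qed.

(** On a set of finite measure, since |z| <= 1 + |z|^2. *)
Lemma sqint_integrable m (F : T -> 'cV[C]_m) : sqint F -> mxintegrable F.
Proof.
move=> [mF iF] i j; apply: (@le_cintegrable _ (fun x => 1 + sqnorm (F x))).
- exact: mF.
- under [X in integrable _ _ X]eq_fun do rewrite /= EFinD.
  apply: integrableD => //; first exact: integrable_cst.
  apply/integrableP; split; first exact: mxmeas_sqnorm.
  by under eq_integral do rewrite gee0_abs ?lee_fin ?sqnorm_ge0//.
- move=> x Dx; rewrite ord1; have := cabs_sqnorm (F x) i.
  have := sqr_ge0 (cabs (F x i 0) - 1); have := cabs_ge0 (F x i 0); nra.
Qed.

End ComplexIntegral.

(** * Sections and averages on the square *)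

Section Square.
Local Open Scope complex_scope.
Local Notation Re := complex.Re.
Local Notation Im := complex.Im.
Context {R : realType}.
Local Notation C := R[i].
Local Notation I := (@unit_itv R).
Local Notation Q := (@unit_square R).
Local Notation lam := (@lebesgue_measure R).

(** The average in direction b integrates over the variable t and leaves x
    free: [pt b t x] is the point with these coordinates, and [co b] is the
    free coordinate of a point. *)
Definition pt (b : bool) (t x : R) : R * R := if b then (t, x) else (x, t).
Definition co (b : bool) (k : R * R) : R := if b then k.2 else k.1.

Lemma co_pt b t x : co b (pt b t x) = x. Proof. by case: b. Qed.
Lemma coN_pt b t x : co (~~ b) (pt b t x) = t. Proof. by case: b. Qed.
Lemma co_ptN b t x : co b (pt (~~ b) t x) = t. Proof. by case: b. Qed.
Lemma square_pt b t x : I t -> I x -> Q (pt b t x).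
Proof. by case: b. Qed.

Lemma square_co b k : Q k -> I (co b k).
Proof. by case: b => -[]. Qed.

Lemma measurable_itv01 : measurable I.
Proof. exact: measurable_itv. Qed.

Lemma measure_itv01 : lam I = 1%E.
Proof. by rewrite lebesgue_measure_itv/= lte_fin ltr01 sube0. Qed.

Lemma measure_itv01_fin : (lam I < +oo)%E.
Proof. by rewrite measure_itv01 ltry. Qed.

Lemma measure_square_fin : (@leb2 R Q < +oo)%E.
Proof.
have mI := measurable_itv01.
have -> : leb2 Q = (lam I * lam I)%E by exact: product_measure1E.
by rewrite measure_itv01 mule1 ltry.
Qed.

Lemma Rintegral_itv01_cst (c : R) : \int[lam]_(t in I) c = c.
Proof.
rewrite -[RHS]mulr1 -[X in _ * X]/(fine 1%:E) -measure_itv01.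
by apply: Rintegral_cst; exact: measurable_itv01.
Qed.

Lemma measurable_pt b x : measurable_fun setT (fun t : measurableTypeR R =>
  pt b t x : measurableTypeR R * measurableTypeR R).
Proof. by case: b; apply: measurable_fun_pair => //; exact: measurable_cst. Qed.

Lemma measurable_section d (U : measurableType d) b x
  (g : measurableTypeR R * measurableTypeR R -> U) : I x -> measurable_fun Q g ->
  measurable_fun I (fun t => g (pt b t x)).
Proof.
move=> Ix mg; apply: (measurable_comp (F := Q) (g := fun t => pt b t x)) => //.
- exact: measurable_unit_square.
- by move=> _ [t It <-]; exact: square_pt.
- exact: measurable_funTS (measurable_pt b x).
Qed.

Lemma measurable_co d (U : measurableType d) b (h : measurableTypeR R -> U) :
  measurable_fun I h ->
  measurable_fun Q (fun k => h (co b k)).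
Proof.
move=> mh; apply: (measurable_comp (F := I) (g := co b)) => //.
- exact: measurable_itv01.
- by move=> _ [t Qt <-]; exact: square_co.
- by case: b; apply: measurable_funTS; [exact: measurable_snd|exact: measurable_fst].
Qed.

(** Extension by zero reduces integrals over the square to integrals over the
    plane. *)
Lemma int_section_patch b (g : R * R -> \bar R) x :
  (\int[lam]_t ((g \_ Q) (pt b t x)) =
  ((fun x => \int[lam]_(t in I) g (pt b t x)) \_ I) x)%E.
Proof.
rewrite !patchE; case: ifPn => [/set_mem Ix|/negP Ix].
  rewrite [RHS]integral_mkcond; apply: eq_integral => t _; rewrite !patchE.
  have [/set_mem It|/negP It] := boolP (t \in I).
    by rewrite mem_set//; exact: square_pt.
  by rewrite memNset// => /(square_co (~~ b)); rewrite coN_pt => /mem_set.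
rewrite integral0_eq// => t _; rewrite patchE memNset//.
by move=> /(square_co b); rewrite co_pt => /mem_set.
Qed.

Lemma measurable_int_section b (g : R * R -> \bar R) :
  (forall k, (0 <= g k)%E) -> measurable_fun Q g ->
  measurable_fun I (fun x => \int[lam]_(t in I) g (pt b t x))%E.
Proof.
move=> g0 mg; apply/(measurable_restrictT _ measurable_itv01).
have -> : (fun x => \int[lam]_(t in I) g (pt b t x))%E \_ I =
    (fun x => \int[lam]_t ((g \_ Q) (pt b t x)))%E.
  by apply/funext => x; rewrite int_section_patch.
have mgQ : measurable_fun setT (g \_ Q).
  by apply/(measurable_restrictT _ measurable_unit_square).
have gQ0 k : (0 <= (g \_ Q) k)%E by rewrite patchE; case: ifP.
case: b; first exact: (measurable_fun_fubini_tonelli_G _ mgQ).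
exact: (measurable_fun_fubini_tonelli_F _ mgQ).
Qed.

Lemma square_tonelli b (g : R * R -> \bar R) :
  (forall k, (0 <= g k)%E) -> measurable_fun Q g ->
  (\int[leb2]_(k in Q) g k = \int[lam]_(x in I) \int[lam]_(t in I) g (pt b t x))%E.
Proof.
move=> g0 mg; rewrite integral_mkcond [RHS]integral_mkcond.
under [RHS]eq_integral do rewrite -int_section_patch.
have mgQ : measurable_fun setT (g \_ Q).
  by apply/(measurable_restrictT _ measurable_unit_square).
have gQ0 k : (0 <= (g \_ Q) k)%E by rewrite patchE; case: ifP.
case: b; first exact: (fubini_tonelli2 _ mgQ).
exact: (fubini_tonelli1 _ mgQ).
Qed.

Lemma square_fubini b (g : R * R -> \bar R) : leb2.-integrable Q g ->
  (\int[lam]_(x in I) \int[lam]_(t in I) g (pt b t x) = \int[leb2]_(k in Q) g k)%E.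
Proof.
move=> /(integrable_mkcond _ measurable_unit_square) ig.
rewrite integral_mkcond [RHS]integral_mkcond.
under [LHS]eq_integral do rewrite -int_section_patch.
case: b; first exact: (fubini2 ig).
exact: (fubini1 ig).
Qed.

(** The positive and the negative part are handled separately by Tonelli, as a
    section may fail to be integrable. *)
Lemma measurable_Rint_section b (g : R * R -> R) : measurable_fun Q g ->
  measurable_fun I (fun x => \int[lam]_(t in I) g (pt b t x))%R.
Proof.
move=> mg; have mEg : measurable_fun Q (fun k => (g k)%:E) by exact/measurable_EFinP.
rewrite /Rintegral; apply: (measurable_comp (F := setT) (f := fine)) => //.
under eq_fun do rewrite integralE.
apply: emeasurable_funB.
- have mp : measurable_fun Q (fun k => (g k)%:E)^\+%E by exact: measurable_funepos.
  apply: eq_measurable_fun (measurable_int_section b (funepos_ge0 _) mp) => x _.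
  by apply: eq_integral => t _; rewrite !funeposE.
- have mn : measurable_fun Q (fun k => (g k)%:E)^\-%E by exact: measurable_funeneg.
  apply: eq_measurable_fun (measurable_int_section b (funeneg_ge0 _) mn) => x _.
  by apply: eq_integral => t _; rewrite !funenegE.
Qed.

(** A continuous function is measurable because an open set is a union of
    rectangles with rational centres and sides. *)
Lemma ucont_real_measurable (g : R * R -> R) :
  (forall e : R, 0 < e -> exists2 d : R, 0 < d &
    forall k k' : R * R, Q k -> Q k' -> `|k.1 - k'.1| < d -> `|k.2 - k'.2| < d ->
    `|g k - g k'| < e) -> measurable_fun Q g.
Proof.
move=> ug; apply: (measurability _ (RGenOInfty.measurableE R)).
move=> _ [_ [a ->] <-].
pose box (r s : rat) (n : nat) : set (measurableTypeR R * measurableTypeR R) :=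
  ball (ratr r : R) n.+1%:R^-1 `*` ball (ratr s : R) n.+1%:R^-1.
pose U := \bigcup_(r : rat) \bigcup_(s : rat) \bigcup_(n : nat)
  [set k | box r s n k /\ Q `&` box r s n `<=` [set y | a < g y]].
have -> : Q `&` g @^-1` `]a, +oo[ = Q `&` U.
  apply/seteqP; split => k [Qk].
    rewrite /= in_itv/= andbT => agk; split=> //.
    have [|e e0 eH] := ug (g k - a); first by rewrite subr_gt0.
    pose n := Num.truncn (2 / e).
    have ne : n.+1%:R^-1 < e / 2.
      rewrite -[e / 2]invrK ltf_pV2 ?posrE ?invr_gt0 ?divr_gt0// invf_div.
      exact: truncnS_gt.
    have rn (x : R) : exists r : rat, ball (ratr r : R) n.+1%:R^-1 x.
      have [r] := @rat_in_itvoo R (x - n.+1%:R^-1) (x + n.+1%:R^-1) ltac:(rewrite ltrD2l gtrN//).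
      rewrite in_itv/= => /andP[h1 h2]; exists r.
      by rewrite -ball_normE/= ltr_distlC ltrBlDr h2 -ltrBlDr.
    have [r rk] := rn k.1; have [s sk] := rn k.2.
    exists r => //; exists s => //; exists n => //; split => // y [Qy [y1 y2]] /=.
    have tri (x z w : R) : ball w n.+1%:R^-1 x -> ball w n.+1%:R^-1 z -> `|x - z| < e.
      move: (n.+1%:R^-1 : R) ne => dl ne.
      rewrite -!ball_normE/= => h1 h2; have := ler_distD w x z; rewrite [`|x - w|]distrC; lra.
    have := eH _ _ Qk Qy (tri _ _ _ rk y1) (tri _ _ _ sk y2).
    rewrite ltr_norml; lra.
  by move=> [r _ [s _ [n _ [kb Hb]]]]; split=> //=; rewrite in_itv/= andbT; exact: Hb.
apply: measurableI; first exact: measurable_unit_square.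
apply: bigcupT_measurable_rat => r; apply: bigcupT_measurable_rat => s.
apply: bigcupT_measurable => n.
have [H|H] := pselect (Q `&` box r s n `<=` [set y | a < g y]); last first.
  rewrite [X in measurable X](_ : _ = set0); first exact: measurable0.
  by apply/seteqP; split => // k [].
rewrite [X in measurable X](_ : _ = box r s n); last first.
  by apply/seteqP; split => // k [].
by apply: measurableX; exact: measurable_ball.
Qed.

Lemma ucont_cmeas f : ucont f -> cmeas Q f.
Proof.
move=> uf; split; apply: ucont_real_measurable => e /uf[d d0 H]; exists d => // k k' *.
  apply: le_lt_trans (H k k' _ _ _ _) => //.
  by apply: le_trans (Re_cabs _); case: (f k) => ? ?; case: (f k').
apply: le_lt_trans (H k k' _ _ _ _) => //.
by apply: le_trans (Im_cabs _); case: (f k) => ? ?; case: (f k').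
Qed.

Lemma mcont_mxmeas m n (F : R * R -> 'M[C]_(m, n)) : mcont F -> mxmeas Q F.
Proof. by move=> uF i j; exact: ucont_cmeas. Qed.

Lemma cmeas_section b x (f : R * R -> C) : I x -> cmeas Q f -> cmeas I (fun t => f (pt b t x)).
Proof.
by move=> Ix [fr fi]; split; [apply: measurable_section Ix fr|apply: measurable_section Ix fi].
Qed.

Lemma mxmeas_section m n b x (F : R * R -> 'M[C]_(m, n)) :
  I x -> mxmeas Q F -> mxmeas I (fun t => F (pt b t x)).
Proof. by move=> Ix mF i j; exact: cmeas_section Ix (mF i j). Qed.

(** Convertible to [avg1] and [avg2] for the two values of b. *)
Definition avg (m n : nat) b (F : R * R -> 'M[C]_(m, n)) (x : R) : 'M[C]_(m, n) :=
  mxintegral lam I (fun t => F (pt b t x)).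

Lemma mxmeas_avg m n b (F : R * R -> 'M[C]_(m, n)) : mxmeas Q F ->
  mxmeas Q (fun k => avg b F (co b k)).
Proof.
move=> mF i j; have [mr mi] := mF i j.
split; under eq_fun do rewrite mxE /=.
  apply: (measurable_co b (h := fun x => \int[lam]_(t in I) Re (F (pt b t x) i j))).
  exact: (measurable_Rint_section b mr).
apply: (measurable_co b (h := fun x => \int[lam]_(t in I) Im (F (pt b t x) i j))).
exact: (measurable_Rint_section b mi).
Qed.

Lemma mcont_section_integrable m n b x (F : R * R -> 'M[C]_(m, n)) :
  I x -> mcont F -> mxintegrable lam I (fun t => F (pt b t x)).
Proof.
move=> Ix uF i j; have [M _ FM] := mcont_bounded uF.
apply: (@bounded_cintegrable _ _ _ _ _ _ _ _ M).
- exact: measurable_itv01.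
- exact: measure_itv01_fin.
- exact: cmeas_section (mcont_mxmeas uF i j).
- by move=> t It; apply: FM; exact: square_pt.
Qed.

Lemma mcont_avg m n b (F : R * R -> 'M[C]_(m, n)) : mcont F ->
  mcont (fun k => avg b F (co b k)).
Proof.
move=> uF i j e e0.
have [d d0 H] := uF i j (e / 3) (divr_gt0 e0 (ltr0n _ 3)).
exists d => // k k' Qk Qk' k1 k2.
have iF x Ix := @mcont_section_integrable m n b x F Ix uF i j.
have iN : cintegrable lam I (fun t => -1 * F (pt b t (co b k')) i j).
  by apply: cintegrableZ; [exact: measurable_itv01|apply: iF; exact: square_co].
have -> : avg b F (co b k) i j - avg b F (co b k') i j =
    Cintegral lam I (fun t => F (pt b t (co b k)) i j + -1 * F (pt b t (co b k')) i j).
  rewrite CintegralD//; first last.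
    - by apply: iF; exact: square_co.
    - exact: measurable_itv01.
  rewrite CintegralZ ?mulN1r//; first by rewrite !mxE.
    exact: measurable_itv01.
  by apply: iF; exact: square_co.
apply: (@le_lt_trans _ _ (2 * \int[lam]_(t in I) (e / 3))).
  apply: cabs_Cintegral.
  - exact: measurable_itv01.
  - apply: cintegrable_meas; apply: cintegrableD iN; first exact: measurable_itv01.
    by apply: iF; exact: square_co.
  - exact: (integrable_cst measurable_itv01 measure_itv01_fin).
  - move=> t It; rewrite mulN1r ltW//; apply: H; try (by apply: square_pt => //; exact: square_co).
      by case: (b) => //=; rewrite subrr normr0.
    by case: (b) => //=; rewrite subrr normr0.
rewrite Rintegral_itv01_cst; lra.
Qed.

End Square.

(** * Representatives with square integrable sections *)

Section Nice.
Local Open Scope complex_scope.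
Local Notation Re := complex.Re.
Local Notation Im := complex.Im.
Context {R : realType}.
Local Notation C := R[i].
Local Notation I := (@unit_itv R).
Local Notation Q := (@unit_square R).
Local Notation lam := (@lebesgue_measure R).
Let mI := @measurable_itv01 R.
Let lI := @measure_itv01_fin R.
Let mQ := @measurable_unit_square R.
Let lQ := @measure_square_fin R.

Lemma L2fun_sqint m (f : R * R -> 'cV[C]_m) : f \in L2fun <-> sqint leb2 Q f.
Proof.
split=> [/L2funP[mf lf]|[mf lf]]; first by split => // i j; rewrite ord1; exact: mf.
by apply/L2funP; split => // i; exact: mf.
Qed.

(** With c the mean of g, integrate g^2 >= 2 c g - c^2. *)
Lemma Rint_sqr (g : R -> R) : lam.-integrable I (EFin \o g) ->
  lam.-integrable I (EFin \o (fun x => g x ^+ 2)) ->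
  (\int[lam]_(x in I) g x) ^+ 2 <= \int[lam]_(x in I) (g x ^+ 2).
Proof.
move=> ig ig2; set c := \int[lam]_(x in I) g x.
have icg : lam.-integrable I (EFin \o (fun x => 2 * c * g x)).
  by move: (integrableZl mI (2 * c) ig); apply: eq_integrable => // x _; rewrite /= EFinM.
have icc : lam.-integrable I (EFin \o (fun=> c ^+ 2)) := integrable_cst mI lI (c ^+ 2).
have -> : c ^+ 2 = \int[lam]_(x in I) (2 * c * g x - c ^+ 2).
  by rewrite RintegralB// RintegralZl// Rintegral_itv01_cst -/c; ring.
apply: le_Rintegral => //.
  by move: (integrableB mI icg icc); apply: eq_integrable => // x _; rewrite /= EFinB.
by move=> x _; rewrite -subr_ge0; have := sqr_ge0 (g x - c); nra.
Qed.

(** Jensen's inequality for the probability measure of the unit interval. *)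
Lemma sqnorm_mxintegral m (F : R -> 'cV[C]_m) : sqint lam I F ->
  ((sqnorm (mxintegral lam I F))%:E <= \int[lam]_(x in I) (sqnorm (F x))%:E)%E.
Proof.
move=> sF; have [mF iF] := sF; have intF := sqint_integrable mI lI sF.
have m2 (h : R -> R) : measurable_fun I h -> measurable_fun I (fun x => (h x ^+ 2)%:E).
  by move=> mh; apply/measurable_EFinP; exact: measurable_funX.
have i2 (h : R -> R) i : measurable_fun I h -> (forall x, h x ^+ 2 <= cabs (F x i 0) ^+ 2) ->
    lam.-integrable I (EFin \o (fun x => h x ^+ 2)).
  move=> mh hF; apply/integrableP; split; first exact: m2.
  apply: le_lt_trans iF; apply: ge0_le_integral => //.
  - by apply: measurableT_comp => //; exact: m2.
  - exact: mxmeas_sqnorm.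
  - move=> x Ix; rewrite gee0_abs ?lee_fin ?sqr_ge0// (le_trans (hF x))//.
    exact: cabs_sqnorm.
have j2 (h : R -> R) i : measurable_fun I h -> lam.-integrable I (EFin \o h) -> 
   (forall x, h x ^+ 2 <= cabs (F x i 0) ^+ 2) ->
  (((\int[lam]_(x in I) h x) ^+ 2)%:E <= \int[lam]_(x in I) (h x ^+ 2)%:E)%E.
  move=> mh ih hF; have ih2 := i2 _ _ mh hF.
  rewrite -[leRHS]fineK; last exact: integrable_fin_num ih2.
  by rewrite lee_fin; exact: Rint_sqr.
rewrite /sqnorm -sumEFin.
under [leRHS]eq_integral do rewrite -sumEFin.
have mre i : measurable_fun I (fun x => Re (F x i 0)) by have [] := mF i 0.
have mim i : measurable_fun I (fun x => Im (F x i 0)) by have [] := mF i 0.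
rewrite ge0_integral_sum//; first last.
- by move=> i x _; rewrite lee_fin addr_ge0 ?sqr_ge0.
- move=> i; apply/measurable_EFinP; by apply: measurable_funD; exact: measurable_funX.
apply: lee_sum => i _; rewrite EFinD; under eq_integral do rewrite EFinD.
rewrite ge0_integralD//; first last.
- exact: m2.
- by move=> x _; rewrite lee_fin sqr_ge0.
- exact: m2.
- by move=> x _; rewrite lee_fin sqr_ge0.
rewrite mxE/=; have [ri ii] := intF i 0.
apply: leeD; apply: (j2 _ i) => //.
- by move=> x; rewrite cabs_sqr lerDl sqr_ge0.
- by move=> x; rewrite cabs_sqr lerDr sqr_ge0.
Qed.

(** The unit interval has measure 1, so a function of the free variable has
    the same integral over the square as over the interval. *)
Lemma square_tonelli_marginal b (h : R * R -> \bar R) :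
  (forall k, (0 <= h k)%E) -> measurable_fun Q h ->
  (\int[leb2]_(k in Q) \int[lam]_(t in I) h (pt b t (co b k)) =
   \int[leb2]_(k in Q) h k)%E.
Proof.
move=> h0 mh; have mm := measurable_int_section b h0 mh.
rewrite (square_tonelli b (fun k => integral_ge0 _ _))//; last first.
  exact: (measurable_co b (h := fun x => \int[lam]_(t in I) h (pt b t x))%E).
rewrite (square_tonelli b h0 mh); apply: eq_integral => x /set_mem Ix.
under eq_integral do rewrite co_pt.
by rewrite integral_cst//= measure_itv01 mule1.
Qed.

(** The members of a class in L2 whose sections in both directions are all
    square integrable; on them averages are computed pointwise. *)
Definition nice m (f : R * R -> 'cV[C]_m) :=
  sqint leb2 Q f /\ forall b x, I x -> sqint lam I (fun t => f (pt b t x)).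

Lemma nice_L2fun m (f : R * R -> 'cV[C]_m) : nice f -> f \in L2fun.
Proof. by move=> [/L2fun_sqint]. Qed.

Lemma eq_nice m (f g : R * R -> 'cV[C]_m) : (forall k, Q k -> f k = g k) ->
  nice f -> nice g.
Proof.
move=> fg [sf nf]; split; first exact: eq_sqint fg sf.
by move=> b x Ix; apply: eq_sqint (nf b x Ix) => // t It; rewrite fg//; exact: square_pt.
Qed.

Lemma niceD m (f g : R * R -> 'cV[C]_m) : nice f -> nice g ->
  nice (fun k => f k + g k).
Proof.
move=> [sf nf] [sg ng]; split; first exact: sqintD.
by move=> b x Ix; exact: sqintD (nf b x Ix) (ng b x Ix).
Qed.

Lemma niceM m n (F : R * R -> 'M[C]_(m, n)) (f : R * R -> 'cV[C]_n) :
  mcont F -> nice f -> nice (fun k => F k *m f k).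
Proof.
move=> uF [sf nf]; have [M _ FM] := mcont_bounded uF; have mF := mcont_mxmeas uF.
split; first exact: sqintM mF FM sf.
move=> b x Ix; apply: sqintM (nf b x Ix) => //.
  exact: (mxmeas_section b Ix mF).
by move=> t It; apply: FM; exact: square_pt.
Qed.

Lemma niceZ m (c : C) (f : R * R -> 'cV[C]_m) : nice f -> nice (fun k => c *: f k).
Proof.
move=> nf; apply: eq_nice (niceM (mcont_cst c%:M) nf) => k _.
by rewrite mul_scalar_mx.
Qed.

Lemma mxmeas_avg_itv m b (f : R * R -> 'cV[C]_m) : mxmeas Q f ->
  mxmeas I (avg b f).
Proof.
move=> mf; have I0 : I 0 by rewrite /unit_itv/= in_itv/= lexx ler01.
have := mxmeas_section (~~ b) I0 (mxmeas_avg b mf).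
by move=> + i j => /(_ i j); apply: eq_cmeas => t It; rewrite co_ptN.
Qed.

(** Averaging is a contraction, by Jensen on each section. *)
Lemma int_avg_le m b (f : R * R -> 'cV[C]_m) : nice f ->
  (\int[lam]_(x in I) (sqnorm (avg b f x))%:E <=
   \int[leb2]_(k in Q) (sqnorm (f k))%:E)%E.
Proof.
move=> [[mf lf] nf].
have s0 k : (0 <= (sqnorm (f k))%:E)%E by rewrite lee_fin sqnorm_ge0.
rewrite (square_tonelli b s0 (mxmeas_sqnorm mf)); apply: ge0_le_integral => //.
- by move=> x _; rewrite lee_fin sqnorm_ge0.
- by apply: mxmeas_sqnorm; exact: mxmeas_avg_itv.
- exact: measurable_int_section s0 (mxmeas_sqnorm mf).
- by move=> x Ix; exact: sqnorm_mxintegral (nf b x Ix).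
Qed.

Lemma int_co b (h : R -> \bar R) : (forall x, (0 <= h x)%E) ->
  measurable_fun I h ->
  (\int[leb2]_(k in Q) h (co b k) = \int[lam]_(x in I) h x)%E.
Proof.
move=> h0 mh; rewrite (square_tonelli b)//; last exact: measurable_co.
apply: eq_integral => x _; under eq_integral do rewrite co_pt.
by rewrite integral_cst//= measure_itv01 mule1.
Qed.

Lemma int_avg_co m b (f : R * R -> 'cV[C]_m) : mxmeas Q f ->
  (\int[leb2]_(k in Q) (sqnorm (avg b f (co b k)))%:E =
   \int[lam]_(x in I) (sqnorm (avg b f x))%:E)%E.
Proof.
move=> mf; apply: (int_co b (h := fun x => (sqnorm (avg b f x))%:E)).
  by move=> x; rewrite lee_fin sqnorm_ge0.
by apply: mxmeas_sqnorm; exact: mxmeas_avg_itv.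
Qed.

Lemma nice_avg m b (f : R * R -> 'cV[C]_m) : nice f ->
  nice (fun k => avg b f (co b k)).
Proof.
move=> nf; have [[mf lf] sf] := nf.
have la := le_lt_trans (int_avg_le b nf) lf.
split; first by split; [exact: mxmeas_avg|rewrite int_avg_co].
move=> b' x Ix; split; first exact: mxmeas_section (mxmeas_avg b mf).
have [->|/negPf bb] := eqVneq b' b.
  under eq_integral do rewrite co_pt.
  by rewrite integral_cst//= measure_itv01 mule1 ltry.
have {bb} -> : b' = ~~ b by case: (b) (b') bb => -[].
by under eq_integral do rewrite co_ptN.
Qed.

(** Set the function to zero on the lines where its squared norm is not
    integrable; by Tonelli they form a null set in each direction. *)
Lemma nice_repr m (f : R * R -> 'cV[C]_m) : f \in L2fun ->
  exists2 g, nice g & {ae leb2, forall k, Q k -> f k = g k}.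
Proof.
move=> /L2fun_sqint sf; have [mf lf] := sf.
have s0 k : (0 <= (sqnorm (f k))%:E)%E by rewrite lee_fin sqnorm_ge0.
have ms := mxmeas_sqnorm mf.
pose a b x := (\int[lam]_(t in I) (sqnorm (f (pt b t x)))%:E)%E.
have a0 b x : (0 <= a b x)%E by exact: integral_ge0.
have ma b : measurable_fun I (a b) by exact (measurable_int_section b s0 ms).
have mac b : measurable_fun Q (fun k => a b (co b k)) by exact: measurable_co.
have ia b : leb2.-integrable Q (fun k => a b (co b k)).
  apply/integrableP; split => //.
  under eq_integral do rewrite gee0_abs//.
  by rewrite (square_tonelli_marginal b s0 ms).
pose S b := Q `&` [set k | a b (co b k) \is a fin_num].
have mS b : measurable (S b).
  exact: (emeasurable_fin_num mQ (mac b)).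
(* the points on integrable lines in both directions *)
pose g k : 'cV[C]_m := (\1_(S true `&` S false) k : R)%:C *: f k.
have mi : cmeas Q (fun k => (\1_(S true `&` S false) k : R)%:C).
  split => /=; last exact: measurable_cst.
  by apply: measurable_indic; exact: measurableI.
have mg : mxmeas Q g.
  by move=> i j; apply: eq_cmeas (cmeasM mi (mf i j)) => k _; rewrite mxE.
have gf k : sqnorm (g k) <= 1 * sqnorm (f k).
  rewrite sqnormZ/= expr0n addr0 ler_wpM2r ?sqnorm_ge0//.
have gfin b k : Q k -> (a b (co b k) < +oo)%E = false -> g k = 0.
  move=> Qk ak; rewrite /g indicE memNset ?scale0r//.
  by move=> [[_ h1] [_ h2]]; move: ak; case: b => /=; rewrite -ge0_fin_numE//= ?h1 ?h2.
exists g.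
  split; first exact: (sqint_le mQ ler01 mg (fun k _ => gf k) sf).
  move=> b x Ix; have mgx := mxmeas_section b Ix mg.
  case: (boolP (a b x < +oo)%E) => [ax|/negbTE ax].
    apply: (sqint_le mI ler01 mgx (fun k _ => gf (pt b k x))).
    by split => //; exact: mxmeas_section.
  have g0 t : I t -> g (pt b t x) = 0.
    by move=> It; apply: (gfin b); [exact: square_pt|rewrite co_pt].
  split => //; under eq_integral => t /set_mem It do rewrite g0// sqnorm0.
  by rewrite integral0 ltry.
apply: filterS2 (integrable_ae mQ (ia true)) (integrable_ae mQ (ia false)) => k h1 h2 Qk.
rewrite /g indicE mem_set ?scale1r//; split; split => //=; [exact: h1|exact: h2].
Qed.

(** Averages of functions that agree almost everywhere agree almost
    everywhere: the squared distance has zero integral, hence, by Tonelli,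
    zero integral over almost every section. *)
Lemma avg_ae m b (f g : R * R -> 'cV[C]_m) : mxmeas Q f -> mxmeas Q g ->
  {ae leb2, forall k, Q k -> f k = g k} ->
  {ae leb2, forall k, Q k -> avg b f (co b k) = avg b g (co b k)}.
Proof.
move=> mf mg fg.
pose h k := sqnorm (f k + (-1)%:M *m g k).
have mfg : mxmeas Q (fun k => f k + (-1)%:M *m g k).
  apply: mxmeasD => //; exact: mxmeasM.
have h0 k : (0 <= (h k)%:E)%E by rewrite lee_fin sqnorm_ge0.
have mh := mxmeas_sqnorm mfg.
have hi : (\int[leb2]_(k in Q) (h k)%:E = 0)%E.
  rewrite -[RHS](integral0 leb2 Q); apply: ae_eq_integral => //.
  apply: filterS fg => k fg Qk; rewrite /h fg// mul_scalar_mx scaleN1r subrr.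
  by rewrite sqnorm0.
have ma : measurable_fun Q (fun k => \int[lam]_(t in I) (h (pt b t (co b k)))%:E)%E.
  exact: (measurable_co b (measurable_int_section b h0 mh)).
have := square_tonelli_marginal b h0 mh; rewrite hi => hi0.
have /(ae_eq_integral_abs _ mQ ma) : (\int[leb2]_(k in Q)
    `|\int[lam]_(t in I) (h (pt b t (co b k)))%:E| = 0)%E.
  by under eq_integral do rewrite gee0_abs ?integral_ge0//.
apply: filterS => k + Qk => /(_ Qk)/= ik0.
have Ik := square_co b Qk.
have /(ae_eq_integral_abs _ mI) : (\int[lam]_(t in I) `|(h (pt b t (co b k)))%:E| = 0)%E.
  by under eq_integral do rewrite gee0_abs//.
move=> /(_ (mxmeas_sqnorm (mxmeas_section b Ik mfg))) hae.
have fgt : {ae lam, forall t, I t -> f (pt b t (co b k)) = g (pt b t (co b k))}.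
  apply: filterS hae => t + It => /(_ It) [] /sqnorm_eq0/eqP.
  by rewrite mul_scalar_mx scaleN1r subr_eq0 => /eqP.
apply/matrixP => i j; rewrite !mxE; congr (_ +i* _); congr fine.
- apply: ae_eq_integral => //.
  + by apply/measurable_EFinP; have [] := mxmeas_section b Ik mf i j.
  + by apply/measurable_EFinP; have [] := mxmeas_section b Ik mg i j.
  + by apply: filterS fgt => t + It => /(_ It) ->.
- apply: ae_eq_integral => //.
  + by apply/measurable_EFinP; have [] := mxmeas_section b Ik mf i j.
  + by apply/measurable_EFinP; have [] := mxmeas_section b Ik mg i j.
  + by apply: filterS fgt => t + It => /(_ It) ->.
Qed.

(** Fubini for functions all of whose sections are integrable. *)
Lemma avg12_avg m b (f : R * R -> 'cV[C]_m) : nice f ->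
  avg12 f = mxintegral lam I (avg b f).
Proof.
move=> [sf nf]; have intf := sqint_integrable mQ lQ sf.
apply/matrixP => i j; rewrite !mxE; have [fr fi] := intf i j.
have sec (g : R * R -> R) : leb2.-integrable Q (fun k => (g k)%:E) ->
    (forall x, I x -> lam.-integrable I (fun t => (g (pt b t x))%:E)) ->
    \int[leb2]_(k in Q) g k = \int[lam]_(x in I) \int[lam]_(t in I) g (pt b t x).
  move=> ig sg; rewrite /Rintegral -(square_fubini b ig); congr fine.
  apply: eq_integral => x /set_mem Ix; rewrite fineK//.
  exact: integrable_fin_num (sg x Ix).
have ns x Ix := sqint_integrable mI lI (nf b x Ix) i j.
congr (_ +i* _); rewrite sec//.
- by apply: eq_Rintegral => x _; rewrite mxE.
- by move=> x Ix; have [] := ns x Ix.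
- by apply: eq_Rintegral => x _; rewrite mxE.
- by move=> x Ix; have [] := ns x Ix.
Qed.

End Nice.

(** * Multiplication and averaging operators on L2 *)

Section L2Operators.
Local Open Scope complex_scope.
Local Notation Re := complex.Re.
Local Notation Im := complex.Im.
Context {R : realType}.
Local Notation C := R[i].
Local Notation I := (@unit_itv R).
Local Notation Q := (@unit_square R).
Local Notation lam := (@lebesgue_measure R).
Let mI := @measurable_itv01 R.
Let lI := @measure_itv01_fin R.
Let mQ := @measurable_unit_square R.
Let lQ := @measure_square_fin R.

Lemma eq_L2fun m (f g : R * R -> 'cV[C]_m) : (forall k, Q k -> f k = g k) ->
  f \in L2fun -> g \in L2fun.
Proof. by move=> fg /L2fun_sqint/(eq_sqint mQ fg)/L2fun_sqint. Qed.

Lemma toL2_ae m (f g : R * R -> 'cV[C]_m) : f \in L2fun -> g \in L2fun ->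
  {ae leb2, forall k, Q k -> f k = g k} -> toL2 f = toL2 g.
Proof. by move=> fL gL fg; rewrite !toL2E; apply/L2class_eq. Qed.

Lemma toL2_ext m (f g : R * R -> 'cV[C]_m) : (forall k, Q k -> f k = g k) ->
  toL2 f = toL2 g.
Proof.
move=> fg; have [fL|fN] := boolP (f \in L2fun).
  by apply: toL2_ae => //; [exact: eq_L2fun fL|exact: aeW].
rewrite /toL2 !insubN//; apply: contra fN; apply: eq_L2fun => k Qk.
by rewrite fg.
Qed.

Lemma L2repr_L2fun m (u : L2 R m) : (u : R * R -> 'cV[C]_m) \in L2fun.
Proof. exact: L2fun_valP. Qed.

Lemma L2repr_toL2 m (f : R * R -> 'cV[C]_m) : f \in L2fun ->
  {ae leb2, forall k, Q k -> toL2 f k = f k}.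
Proof. by move=> fL; rewrite toL2E; have /L2class_eq := L2classK (L2class (L2Fun fL)). Qed.

Lemma toL2K m (u : L2 R m) : toL2 u = u.
Proof.
rewrite (toL2E (L2repr_L2fun u)) -[RHS]L2classK; apply/L2class_eq.
exact: aeW.
Qed.

Lemma L2_nice m (u : L2 R m) : exists2 f, nice f & u = toL2 f.
Proof.
have [f nf uf] := nice_repr (L2repr_L2fun u); exists f => //.
by rewrite -[LHS]toL2K; apply: toL2_ae => //; [exact: L2repr_L2fun|exact: nice_L2fun].
Qed.

Lemma toL2D m (f g : R * R -> 'cV[C]_m) : f \in L2fun -> g \in L2fun ->
  toL2 (fun k => f k + g k) = toL2 f + toL2 g.
Proof.
move=> fL gL; rewrite (toL2E fL) (toL2E gL) -L2classD.
have fgL : (fun k => f k + g k) \in L2fun.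
  exact: (L2fun_valP (L2Fun fL + L2Fun gL)).
by rewrite (toL2E fgL); congr L2class; exact: val_inj.
Qed.

Lemma toL2Z m (c : C) (f : R * R -> 'cV[C]_m) : f \in L2fun ->
  toL2 (fun k => c *: f k) = c *: toL2 f.
Proof.
move=> fL; rewrite (toL2E fL) -L2classZ.
have cfL : (fun k => c *: f k) \in L2fun.
  exact: (L2fun_valP (c *: L2Fun fL)).
by rewrite (toL2E cfL); congr L2class; exact: val_inj.
Qed.

Lemma norm_toL2 m (f : R * R -> 'cV[C]_m) : f \in L2fun ->
  `|toL2 f| = (Num.sqrt (\int[leb2]_(k in Q) sqnorm (f k)))%:C.
Proof. by move=> fL; rewrite toL2E L2normE. Qed.

Lemma le_norm_toL2 m n (f : R * R -> 'cV[C]_m) (g : R * R -> 'cV[C]_n) (c : R) :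
  f \in L2fun -> g \in L2fun -> 0 <= c ->
  (\int[leb2]_(k in Q) (sqnorm (g k))%:E <=
   (c ^+ 2)%:E * \int[leb2]_(k in Q) (sqnorm (f k))%:E)%E ->
  `|toL2 g| <= c%:C * `|toL2 f|.
Proof.
move=> fL gL c0 fg; rewrite !norm_toL2// -rmorphM lecR.
have ff p (h : R * R -> 'cV[C]_p) (hL : h \in L2fun) := @L2norm_fin R _ (L2Fun hL).
rewrite -[c]ger0_norm// -sqrtr_sqr -sqrtrM ?sqr_ge0//; apply: ler_wsqrtr.
by rewrite -lee_fin EFinM /Rintegral !fineK//; exact: ff.
Qed.

(** Bounded linear maps between spaces of vector fields of possibly different
    dimensions. *)
Definition bop m n (T : L2 R m -> L2 R n) :=
  linear T /\ exists2 c : R, 0 <= c & forall u, `|T u| <= c%:C * `|u|.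

Lemma bop_bounded_operator m (T : L2 R m -> L2 R m) : bop T -> bounded_operator T.
Proof. by move=> [lT [c c0 Tc]]; split => //; exists c%:C. Qed.

Lemma bop_id m : bop (@id (L2 R m)).
Proof.
by split=> //; exists 1 => // u; rewrite mul1r.
Qed.

Lemma bop_comp m n p (S : L2 R n -> L2 R p) (T : L2 R m -> L2 R n) :
  bop S -> bop T -> bop (S \o T).
Proof.
move=> [lS [c c0 Sc]] [lT [d d0 Td]]; split.
  by move=> a u v /=; rewrite lT lS.
exists (c * d); first exact: mulr_ge0.
move=> u /=; rewrite rmorphM -mulrA (le_trans (Sc _))//.
by rewrite ler_wpM2l// ler0c.
Qed.

Lemma bop_add m n (S T : L2 R m -> L2 R n) :
  bop S -> bop T -> bop (fun u => S u + T u).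
Proof.
move=> [lS [c c0 Sc]] [lT [d d0 Td]]; split.
  by move=> a u v /=; rewrite lT lS scalerDr addrACA.
exists (c + d); first exact: addr_ge0.
by move=> u; rewrite rmorphD mulrDl (le_trans (ler_normD _ _))// lerD.
Qed.

Lemma bop_opp m n (T : L2 R m -> L2 R n) : bop T -> bop (fun u => - T u).
Proof.
move=> [lT [d d0 Td]]; split.
  by move=> a u v /=; rewrite lT opprD scalerN.
by exists d => // u; rewrite normrN.
Qed.

(** Linearity and a bound are checked on representatives. *)
Lemma pointwise_bop m n (T : L2 R m -> L2 R n)
  (t : (R * R -> 'cV[C]_m) -> R * R -> 'cV[C]_n) (c : R) : 0 <= c ->
  (forall f, nice f -> nice (t f)) ->
  (forall f, nice f -> T (toL2 f) = toL2 (t f)) ->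
  (forall a f g k, nice f -> nice g -> Q k ->
     t (fun k => a *: f k + g k) k = a *: t f k + t g k) ->
  (forall f, nice f -> (\int[leb2]_(k in Q) (sqnorm (t f k))%:E <=
     (c ^+ 2)%:E * \int[leb2]_(k in Q) (sqnorm (f k))%:E)%E) ->
  bop T.
Proof.
move=> c0 nt Tt lt bt; split.
  move=> a u v; have [f nf ->] := L2_nice u; have [g ng ->] := L2_nice v.
  have naf := niceZ a nf; have naf' := niceZ a (nt _ nf).
  have nL p := @nice_L2fun R p.
  rewrite -(toL2Z a (nL _ _ nf)) -(toL2D (nL _ _ naf) (nL _ _ ng)).
  rewrite (Tt _ (niceD naf ng)) (Tt _ nf) (Tt _ ng).
  rewrite -(toL2Z a (nL _ _ (nt _ nf))) -(toL2D (nL _ _ naf') (nL _ _ (nt _ ng))).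
  by apply: toL2_ext => k Qk; exact: lt.
exists c => // u; have [f nf ->] := L2_nice u; rewrite Tt//.
by apply: le_norm_toL2 => //; [exact: nice_L2fun|apply: nice_L2fun; exact: nt|exact: bt].
Qed.

Lemma mulop_toL2 m n (F : R * R -> 'M[C]_(m, n)) f : mcont F -> f \in L2fun ->
  mulop F (toL2 f) = toL2 (fun k => F k *m f k).
Proof.
move=> uF fL; have [M _ FM] := mcont_bounded uF; have mF := mcont_mxmeas uF.
apply: toL2_ae.
- by apply/L2fun_sqint/(sqintM _ mF FM) => //; apply/L2fun_sqint/L2repr_L2fun.
- by apply/L2fun_sqint/(sqintM _ mF FM) => //; apply/L2fun_sqint.
- by apply: filterS (L2repr_toL2 fL) => k + Qk => /(_ Qk) ->.
Qed.

Lemma eq_mulop m n (F G : R * R -> 'M[C]_(m, n)) u :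
  (forall k, Q k -> F k = G k) -> mulop F u = mulop G u.
Proof. by move=> FG; apply: toL2_ext => k Qk; rewrite FG. Qed.

Lemma bop_mulop m n (F : R * R -> 'M[C]_(m, n)) : mcont F -> bop (mulop F).
Proof.
move=> uF; have [M M0 FM] := mcont_bounded uF; have mF := mcont_mxmeas uF.
have K0 : 0 <= m%:R * (n%:R * M) ^+ 2 by rewrite mulr_ge0 ?sqr_ge0.
apply: (pointwise_bop (t := fun f k => F k *m f k) (sqrtr_ge0 (m%:R * (n%:R * M) ^+ 2))).
- by move=> f nf; exact: niceM.
- by move=> f nf; rewrite mulop_toL2//; exact: nice_L2fun.
- by move=> a f g k nf ng Qk; rewrite mulmxDr scalemxAr.
- move=> f [[mf _] _]; rewrite sqr_sqrtr//; apply: le_int_sqnorm => //.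
    exact: mxmeasM.
  by move=> k Qk; apply: sqnorm_mulmx => i j; exact: FM.
Qed.

Definition avgop m b (u : L2 R m) : L2 R m := toL2 (fun k => avg b u (co b k)).

(** The arbitrary representative behind [avgop] has the same averages almost
    everywhere, hence is handled by [avg_ae]. *)
Lemma avgop_toL2 m b (f : R * R -> 'cV[C]_m) : nice f ->
  avgop b (toL2 f) = toL2 (fun k => avg b f (co b k)).
Proof.
move=> nf; have fL := nice_L2fun nf; have naf := nice_L2fun (nice_avg b nf).
have mf : mxmeas Q f by case: nf => -[].
have mu : mxmeas Q (toL2 f : R * R -> 'cV[C]_m).
  by have /L2fun_sqint[] := L2repr_L2fun (toL2 f).
have aef := avg_ae b mu mf (L2repr_toL2 fL).
have uL : (fun k => avg b (toL2 f : R * R -> 'cV[C]_m) (co b k)) \in L2fun.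
  apply/L2fun_sqint; split; first exact: mxmeas_avg.
  suff -> : (\int[leb2]_(x in Q) (sqnorm (avg b (toL2 f : R * R -> 'cV[C]_m) (co b x)))%:E =
      \int[leb2]_(x in Q) (sqnorm (avg b f (co b x)))%:E)%E by case/L2fun_sqint: naf.
  apply: ae_eq_integral.
  - exact: mQ.
  - exact: (mxmeas_sqnorm (mxmeas_avg b mu)).
  - exact: (mxmeas_sqnorm (mxmeas_avg b mf)).
  - by apply: filterS aef => k + Qk => /(_ Qk) ->.
exact: (toL2_ae uL naf aef).
Qed.

Lemma avgD m b (f g : R * R -> 'cV[C]_m) x : nice f -> nice g -> I x ->
  avg b (fun k => f k + g k) x = avg b f x + avg b g x.
Proof.
move=> [_ nf] [_ ng] Ix; apply: mxintegralD => //.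
  exact: sqint_integrable (nf b x Ix).
exact: sqint_integrable (ng b x Ix).
Qed.

Lemma avgMl m n b (A : 'M[C]_(m, n)) (f : R * R -> 'cV[C]_n) x : nice f -> I x ->
  avg b (fun k => A *m f k) x = A *m avg b f x.
Proof.
by move=> [_ nf] Ix; apply: mxintegralMl => //; exact: sqint_integrable (nf b x Ix).
Qed.

Lemma bop_avgop m b : bop (@avgop m b).
Proof.
apply: (pointwise_bop (t := fun f k => avg b f (co b k)) ler01).
- by move=> f nf; exact: nice_avg.
- by move=> f nf; exact: avgop_toL2.
- move=> a f g k nf ng Qk; rewrite avgD//; [|exact: niceZ|exact: square_co].
  congr (_ + _); rewrite -mul_scalar_mx -avgMl//; last exact: square_co.
  by apply: eq_mxintegral => t _; rewrite mul_scalar_mx.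
- move=> f nf; rewrite expr1n mul1e int_avg_co; last by case: nf => -[].
  exact: int_avg_le.
Qed.

(** A kernel that is continuous in its second variable acts pointwise on any
    square integrable representative. *)
Lemma kernelop_toL2 m n (D : R * R -> R * R -> 'M[C]_(m, n)) f :
  (forall k, Q k -> mcont (D k)) -> f \in L2fun ->
  kernelop D (toL2 f) = toL2 (fun k => avg12 (fun k' => D k k' *m f k')).
Proof.
move=> uD fL; apply: toL2_ext => k Qk.
have mDf (g : R * R -> 'cV[C]_n) : g \in L2fun -> mxmeas Q (fun k' => D k k' *m g k').
  by move=> /L2fun_sqint[mg _]; apply: mxmeasM => //; exact: mcont_mxmeas (uD k Qk).
have mf := mDf _ fL; have mu := mDf _ (L2repr_L2fun (toL2 f)).
have ae : {ae leb2, forall k', Q k' -> D k k' *m toL2 f k' = D k k' *m f k'}.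
  by apply: filterS (L2repr_toL2 fL) => k' + Qk' => /(_ Qk') ->.
apply/matrixP => i j; rewrite !mxE; congr (_ +i* _); congr fine.
- apply: ae_eq_integral => //.
  + by apply/measurable_EFinP; have [] := mu i j.
  + by apply/measurable_EFinP; have [] := mf i j.
  + by apply: filterS ae => t + It => /(_ It) ->.
- apply: ae_eq_integral => //.
  + by apply/measurable_EFinP; have [] := mu i j.
  + by apply/measurable_EFinP; have [] := mf i j.
  + by apply: filterS ae => t + It => /(_ It) ->.
Qed.

(** An average is constant along its own direction, so it comes out of a
    second average in that direction. *)
Lemma avgop_mulop_avgop m n b (F : R * R -> 'M[C]_(m, n)) u : mcont F ->
  avgop b (mulop F (avgop b u)) = mulop (fun k => avg b F (co b k)) (avgop b u).
Proof.
move=> uF; have [f nf ->] := L2_nice u; have naf := nice_avg b nf.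
rewrite avgop_toL2// mulop_toL2//; last exact: nice_L2fun.
rewrite avgop_toL2; last exact: niceM.
rewrite mulop_toL2; [|exact: mcont_avg|exact: nice_L2fun].
apply: toL2_ext => k Qk; have Ik := square_co b Qk.
rewrite -[RHS](mxintegralMr mI lI _ (mcont_section_integrable b Ik uF)).
by apply: eq_mxintegral => t It; rewrite co_pt.
Qed.

Lemma mulop_comp m n p (F : R * R -> 'M[C]_(m, n)) (G : R * R -> 'M[C]_(n, p)) u :
  mcont F -> mcont G -> mulop F (mulop G u) = mulop (fun k => F k *m G k) u.
Proof.
move=> uF uG; have [f nf ->] := L2_nice u.
have nL q := @nice_L2fun R q.
rewrite mulop_toL2 ?nL// mulop_toL2 ?nL//; last exact: niceM.
rewrite mulop_toL2 ?nL//; last exact: mcontM.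
by apply: toL2_ext => k _; rewrite mulmxA.
Qed.

Lemma mulopDl m n (F G : R * R -> 'M[C]_(m, n)) u :
  mcont F -> mcont G -> mulop (fun k => F k + G k) u = mulop F u + mulop G u.
Proof.
move=> uF uG; have [f nf ->] := L2_nice u.
have nL q := @nice_L2fun R q.
rewrite !mulop_toL2 ?nL//; last exact: mcontD.
rewrite -toL2D; [|by apply: nL; exact: niceM|by apply: nL; exact: niceM].
by apply: toL2_ext => k _; rewrite mulmxDl.
Qed.

Lemma mulop_scalar m (c : C) (u : L2 R m) : mulop (fun=> c%:M) u = c *: u.
Proof.
have [f nf ->] := L2_nice u; rewrite mulop_toL2; [|exact: mcont_cst|exact: nice_L2fun].
rewrite -toL2Z; last exact: nice_L2fun.
by apply: toL2_ext => k _; rewrite mul_scalar_mx.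
Qed.

End L2Operators.

(** * Elimination of one averaging direction *)

Section Elimination.
Local Open Scope complex_scope.
Local Notation Re := complex.Re.
Local Notation Im := complex.Im.
Context {R : realType}.
Local Notation C := R[i].
Local Notation I := (@unit_itv R).
Local Notation Q := (@unit_square R).
Local Notation lam := (@lebesgue_measure R).
Let mI := @measurable_itv01 R.
Let lI := @measure_itv01_fin R.
Let mQ := @measurable_unit_square R.
Let lQ := @measure_square_fin R.

Lemma bopD m n (T : L2 R m -> L2 R n) u v : bop T -> T (u + v) = T u + T v.
Proof. by move=> [lT _]; rewrite -[u]scale1r lT !scale1r. Qed.

Lemma bop0 m n (T : L2 R m -> L2 R n) : bop T -> T 0 = 0.
Proof.
move=> bT; have := bopD 0 0 bT; rewrite addr0 => /eqP.
by rewrite -subr_eq0 opprD addrA subrr add0r oppr_eq0 => /eqP.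
Qed.

Lemma bopN m n (T : L2 R m -> L2 R n) u : bop T -> T (- u) = - T u.
Proof.
move=> bT; apply/eqP; rewrite -subr_eq0 opprK -bopD// addrC subrr.
by rewrite bop0.
Qed.

Lemma bopB m n (T : L2 R m -> L2 R n) u v : bop T -> T (u - v) = T u - T v.
Proof. by move=> bT; rewrite bopD// bopN. Qed.

Lemma mulopNl m n (F : R * R -> 'M[C]_(m, n)) u :
  mcont F -> mulop (fun k => - F k) u = - mulop F u.
Proof.
move=> uF; rewrite -scaleN1r -(mulop_scalar (-1) (mulop F u)).
rewrite (mulop_comp u (mcont_cst _) uF).
by apply: eq_mulop => k _; rewrite mul_scalar_mx scaleN1r.
Qed.

Lemma mulopBl m n (F G : R * R -> 'M[C]_(m, n)) u :
  mcont F -> mcont G -> mulop (fun k => F k - G k) u = mulop F u - mulop G u.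
Proof. by move=> uF uG; rewrite mulopDl ?mulopNl//; exact: mcontN. Qed.

Lemma mulop1 m (u : L2 R m) : mulop (fun=> 1%:M) u = u.
Proof. by rewrite mulop_scalar scale1r. Qed.

Section OneDirection.
Variables (b : bool) (M m : nat).
Variables (F : R * R -> 'M[C]_(M, m)) (B : R * R -> 'M[C]_(m, M)).
Hypotheses (uF : mcont F) (uB : mcont B).

(** This is E_b when F is C_b; [block] is then I + C_b P_b, and [block_inv] is
    I - C_b E_b^-1 P_b. *)
Definition symbol (x : R) : 'M[C]_m := 1%:M + avg b (fun k => B k *m F k) x.
Definition avg_mulop (u : L2 R M) : L2 R m := avgop b (mulop B u).
Definition block (u : L2 R M) : L2 R M := u + mulop F (avg_mulop u).
Definition block_inv (u : L2 R M) : L2 R M :=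
  u - mulop (fun k => F k *m invmx (symbol (co b k))) (avg_mulop u).

Lemma mcont_symbol : mcont (fun k => symbol (co b k)).
Proof. by apply: mcontD; [exact: mcont_cst|apply: mcont_avg; exact: mcontM]. Qed.

Lemma bop_avg_mulop : bop avg_mulop.
Proof. exact: bop_comp (bop_avgop _ b) (bop_mulop uB). Qed.

Lemma avg_mulop_mulop (v : L2 R m) : 
  avg_mulop (mulop F (avgop b v)) = mulop (fun k => symbol (co b k) - 1%:M) (avgop b v).
Proof.
rewrite /avg_mulop mulop_comp// avgop_mulop_avgop; last exact: mcontM.
by apply: eq_mulop => k _; rewrite /symbol addrC addKr.
Qed.

Lemma bop_block : bop block.
Proof. exact: bop_add (@bop_id R M) (bop_comp (bop_mulop uF) bop_avg_mulop). Qed.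

Hypothesis symbol_neq0 : forall x, I x -> \det (symbol x) != 0.

Lemma mcont_inv_symbol : mcont (fun k => invmx (symbol (co b k))).
Proof.
by apply: mcont_invmx; [exact: mcont_symbol|move=> k Qk; apply: symbol_neq0; exact: square_co].
Qed.

Lemma mcont_mul_inv_symbol : mcont (fun k => F k *m invmx (symbol (co b k))).
Proof. by apply: mcontM => //; exact: mcont_inv_symbol. Qed.

Lemma bop_block_inv : bop block_inv.
Proof.
exact: bop_add (@bop_id R M) (bop_opp (bop_comp (bop_mulop mcont_mul_inv_symbol) bop_avg_mulop)).
Qed.

Lemma symbol_unit k : Q k -> symbol (co b k) \in unitmx.
Proof. by move=> Qk; rewrite unitmxE unitfE; apply: symbol_neq0; exact: square_co. Qed.

(** The identity P F P = (E - I) P of [avg_mulop_mulop] does the algebra: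
    F E^-1 (I + (E - I)) = F. *)
Lemma blockK : cancel block block_inv.
Proof.
move=> u; rewrite /block_inv (bopD _ _ bop_avg_mulop) avg_mulop_mulop.
have bY := bop_mulop mcont_mul_inv_symbol.
have uE1 : mcont (fun k => symbol (co b k) - 1%:M).
  by apply: mcontB; [exact: mcont_symbol|exact: mcont_cst].
rewrite (bopD _ _ bY) mulop_comp//; last exact: mcont_mul_inv_symbol.
rewrite -(mulopDl _ mcont_mul_inv_symbol); last by apply: mcontM => //; exact: mcont_mul_inv_symbol.
rewrite -[RHS]addr0 /block -addrA; congr (_ + _); apply/eqP; rewrite subr_eq0.
apply/eqP/eq_mulop => k Qk.
by rewrite -mulmxA mulmxBr mulmx1 mulVmx ?symbol_unit// mulmxBr mulmx1 addrC subrK.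
Qed.

Lemma avg_mulop_mulop_inv (v : L2 R m) :
  avg_mulop (mulop (fun k => F k *m invmx (symbol (co b k))) (avgop b v)) =
  mulop (fun k => 1%:M - invmx (symbol (co b k))) (avgop b v).
Proof.
rewrite /avg_mulop mulop_comp//; last exact: mcont_mul_inv_symbol.
rewrite avgop_mulop_avgop; last by apply: mcontM => //; exact: mcont_mul_inv_symbol.
apply: eq_mulop => k Qk; have Ik := square_co b Qk.
transitivity (avg b (fun k => B k *m F k) (co b k) *m invmx (symbol (co b k))).
  rewrite -[RHS](mxintegralMr mI lI _
    (mcont_section_integrable b Ik (mcontM uB uF))).
  by apply: eq_mxintegral => t It; rewrite co_pt mulmxA.
rewrite -[avg _ _ _](addKr 1%:M) -/(symbol _) mulmxDl mulmxV ?symbol_unit//.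
by rewrite mulNmx mul1mx addrC.
Qed.

Lemma block_invK : cancel block_inv block.
Proof.
move=> u; rewrite /block (bopB _ _ bop_avg_mulop) avg_mulop_mulop_inv.
have u1 : mcont (fun k => 1%:M - invmx (symbol (co b k))).
  by apply: mcontB; [exact: mcont_cst|exact: mcont_inv_symbol].
rewrite (bopB _ _ (bop_mulop uF)) mulop_comp// -(mulopBl _ uF); last exact: mcontM.
rewrite /block_inv -addrA -[RHS]addr0; congr (_ + _); apply/eqP.
rewrite addrC subr_eq0; apply/eqP/eq_mulop => k Qk.
by rewrite mulmxBr mulmx1 subKr.
Qed.

End OneDirection.

Lemma mcont_freeze m n b c (F : R * R -> 'M[C]_(m, n)) x : I x -> mcont F ->
  mcont (fun k => F (pt b (co c k) x)).
Proof.
move=> Ix uF i j e /(uF i j)[d d0 H]; exists d => // k k' Qk Qk' k1 k2.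
apply: H.
- by apply: square_pt => //; exact: square_co.
- by apply: square_pt => //; exact: square_co.
- by case: b; case: c => //=; rewrite subrr normr0.
- by case: b; case: c => //=; rewrite subrr normr0.
Qed.

Section Kernel.
Variables (M M1 M2 : nat).
Variables (P : R * R -> 'M[C]_(M, M1)) (B1 : R * R -> 'M[C]_(M1, M)).
Variables (C2 : R * R -> 'M[C]_(M, M2)) (B2 : R * R -> 'M[C]_(M2, M)).
Variables (S : R * R -> 'M[C]_(M, M2)).
Hypotheses (uP : mcont P) (uB1 : mcont B1) (uC2 : mcont C2) (uB2 : mcont B2).
Hypothesis uS : mcont S.

(** Here P stands for C_1 E_1^-1 and S for C_2 E_2^-1; [kerD1] and [kerD2] are
    then D_1 and D_2, and [D1op] is P P_1 C_2 P_2 as a composition of averages. *)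
Definition kerD1 (k k' : R * R) : 'M[C]_M :=
  P k *m B1 (k'.1, k.2) *m C2 (k'.1, k.2) *m B2 k'.
Definition kerD2 (k k' : R * R) : 'M[C]_M :=
  S k *m avg2 (fun q => B2 q *m kerD1 q k') k.1.
Definition D1op (u : L2 R M) : L2 R M :=
  mulop P (avg_mulop true B1 (mulop C2 (avg_mulop false B2 u))).

Let G (q : R * R) := B1 q *m C2 q.
Let uG : mcont G. Proof. exact: mcontM. Qed.
Let H (k1 : R) (q : R * R) := B2 (k1, q.2) *m P (k1, q.2).
Let uH k1 : I k1 -> mcont (H k1).
Proof.
move=> I1; apply: mcontM.
  exact: (mcont_freeze false true I1 uB2).
exact: (mcont_freeze false true I1 uP).
Qed.
Let W (k1 : R) (k' : R * R) := avg false (fun q => H k1 q *m G q) (co false k').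
Let uW k1 : I k1 -> mcont (W k1).
Proof. by move=> I1; apply: mcont_avg; apply: mcontM => //; exact: uH. Qed.

Lemma kerD1E k k' : kerD1 k k' = P k *m (G (k'.1, k.2) *m B2 k').
Proof. by rewrite /kerD1 /G !mulmxA. Qed.

Lemma mcont_kerD1 k : Q k -> mcont (kerD1 k).
Proof.
move=> [_ I2]; apply: (@eq_mcont R _ _ (fun k' => P k *m (G (k'.1, k.2) *m B2 k'))).
  by move=> k' _; rewrite kerD1E.
apply: mcontM; first exact: mcont_cst.
apply: mcontM => //; exact: (mcont_freeze true false I2 uG).
Qed.

Lemma kerD2E k k' : Q k -> Q k' -> kerD2 k k' = S k *m (W k.1 k' *m B2 k').
Proof.
move=> [I1 _] [I1' _]; rewrite /kerD2; congr (_ *m _).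
have uHG : mcont (fun q => H k.1 q *m G q) by apply: mcontM => //; exact: uH.
rewrite -[RHS](mxintegralMr mI lI _ (mcont_section_integrable false I1' uHG)).
by apply: eq_mxintegral => t It; rewrite kerD1E /H !mulmxA.
Qed.

Lemma mcont_kerD2 k : Q k -> mcont (kerD2 k).
Proof.
move=> Qk; apply: (@eq_mcont R _ _ (fun k' => S k *m (W k.1 k' *m B2 k'))).
  by move=> k' Qk'; rewrite kerD2E.
apply: mcontM; first exact: mcont_cst.
by apply: mcontM => //; apply: uW; case: Qk.
Qed.

Lemma avg12Ml m n (A : 'M[C]_(m, n)) (f : R * R -> 'cV[C]_n) : nice f ->
  avg12 (fun k => A *m f k) = A *m avg12 f.
Proof. by move=> [sf _]; apply: mxintegralMl => //; exact: sqint_integrable. Qed.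

(** Pointwise on a nice representative f, with g the average of B_2 f in the
    second variable.  The kernel D_1 depends on k' through a factor times
    B_2(k'), so one use of Fubini produces g and then the outer average.  The
    kernel D_2 contains one more average in its first argument, which a second
    use of Fubini exchanges with the integration of g. *)
Lemma kernelop_D2D1 u :
  kernelop (fun k k' => kerD2 k k' - kerD1 k k') u =
  mulop S (avg_mulop false B2 (D1op u)) - D1op u.
Proof.
have [f nf ->] := L2_nice u; have fL := nice_L2fun nf.
have nB2f := niceM uB2 nf.
pose g x := avg false (fun k => B2 k *m f k) x.
have ng : nice (fun k => g (co false k)) := nice_avg false nB2f.
have nGg := niceM uG ng.
pose h k := P k *m avg true (fun q => G q *m g (co false q)) (co true k).
have nh : nice h := niceM uP (nice_avg true nGg).
have Dh : D1op (toL2 f) = toL2 h.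
  rewrite /D1op /avg_mulop (mulop_toL2 uB2 fL) (avgop_toL2 false nB2f).
  rewrite (mulop_toL2 uC2 (nice_L2fun ng)).
  rewrite (mulop_toL2 uB1 (nice_L2fun (niceM uC2 ng))).
  rewrite (avgop_toL2 true (niceM uB1 (niceM uC2 ng))).
  rewrite (mulop_toL2 uP (nice_L2fun (nice_avg true (niceM uB1 (niceM uC2 ng))))).
  apply: toL2_ext => k Qk; congr (_ *m _); apply: eq_mxintegral => t It.
  by rewrite /G mulmxA.
have nB2h := niceM uB2 nh; have nSh := niceM uS (nice_avg false nB2h).
rewrite Dh /avg_mulop (mulop_toL2 uB2 (nice_L2fun nh)) (avgop_toL2 false nB2h).
rewrite (mulop_toL2 uS (nice_L2fun (nice_avg false nB2h))).
rewrite -[- toL2 h]scaleN1r -(toL2Z (-1) (nice_L2fun nh)).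
rewrite -(toL2D (nice_L2fun nSh) (nice_L2fun (niceZ (-1) nh))).
rewrite (kernelop_toL2 _ fL); last first.
  by move=> k Qk; apply: mcontB; [exact: mcont_kerD2|exact: mcont_kerD1].
apply: toL2_ext => k Qk; have [I1 I2] := Qk.
have uGk : mcont (fun k' => G (k'.1, k.2)).
  exact: (mcont_freeze true false I2 uG).
have nG := niceM uGk nB2f.
have nW := niceM (uW I1) nB2f.
have -> : avg12 (fun k' => (kerD2 k k' - kerD1 k k') *m f k') =
    S k *m avg12 (fun k' => W k.1 k' *m (B2 k' *m f k')) -
    P k *m avg12 (fun k' => G (k'.1, k.2) *m (B2 k' *m f k')).
  rewrite -mulNmx -(avg12Ml _ nW) -(avg12Ml _ nG).
  have nSW := niceM (mcont_cst (S k)) nW; have nPG := niceM (mcont_cst (- P k)) nG.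
  rewrite -[RHS](mxintegralD mQ (sqint_integrable mQ lQ nSW.1) (sqint_integrable mQ lQ nPG.1)).
  apply: eq_mxintegral => k' Qk'.
  by rewrite mulmxBl kerD2E// kerD1E -!mulmxA mulNmx.
rewrite scaleN1r; congr (_ + - _); congr (_ *m _).
- pose Z q := H k.1 q *m (G q *m g (co false q)).
  have nZ : nice Z := niceM (uH I1) nGg.
  transitivity (avg12 Z).
    rewrite (avg12_avg false nW) (avg12_avg false nZ).
    apply: eq_mxintegral => x Ix.
    have uHG : mcont (fun q => H k.1 q *m G q) by apply: mcontM => //; exact: uH.
    transitivity (avg false (fun q => H k.1 q *m G q) x *m g x).
      rewrite -[RHS](avgMl _ _ nB2f Ix); apply: eq_mxintegral => t It.
      by rewrite /W co_pt.
    rewrite -[LHS](mxintegralMr mI lI _ (mcont_section_integrable false Ix uHG)).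
    by apply: eq_mxintegral => t It; rewrite /Z co_pt mulmxA.
  rewrite (avg12_avg true nZ); apply: eq_mxintegral => t It.
  transitivity (H k.1 (k.1, t) *m avg true (fun q => G q *m g (co false q)) t).
    by rewrite -[RHS](avgMl _ _ nGg It); apply: eq_mxintegral => x Ix.
  by rewrite /h /H /= mulmxA.
- rewrite (avg12_avg false nG); apply: eq_mxintegral => x Ix.
  by rewrite -[RHS](avgMl _ _ nB2f Ix); apply: eq_mxintegral => t It.
Qed.

End Kernel.
End Elimination.

(** * Reduction to a compact perturbation of the identity *)

Section Transfer.
Local Open Scope complex_scope.
Local Notation Re := complex.Re.
Local Notation Im := complex.Im.
Context {K : numFieldType} {V : normedModType K}.
Implicit Types S T : V -> V.

Lemma bounded_operator_comp S T :
  bounded_operator S -> bounded_operator T -> bounded_operator (S \o T).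
Proof.
move=> [lS [c Sc]] [lT [d Td]]; split.
  by move=> a u v /=; rewrite lT lS.
exists (`|c| * `|d|) => u /=; rewrite -mulrA.
have le (e : K) (a b : V) : `|a| <= e * `|b| -> `|a| <= `|e| * `|b|.
  move=> h; have e0 : e * `|b| \is Num.real.
    by rewrite realE (le_trans (normr_ge0 a) h).
  by rewrite (le_trans h)// (le_trans (real_ler_norm e0))// normrM normr_id.
rewrite (le_trans (le _ _ _ (Sc (T u))))// ler_wpM2l//.
exact: le (Td u).
Qed.

(** Invertibility is not affected by a bounded change of unknown with bounded
    inverse. *)
Lemma invertible_operator_left (Rf Ri T J : V -> V) :
  bounded_operator Rf -> bounded_operator Ri ->
  cancel Rf Ri -> cancel Ri Rf -> (forall u, Rf (T u) = J u) ->
  invertible_operator T <-> invertible_operator J.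
Proof.
move=> bR bRi RK RiK RT; split => -[S [bS SK KS]].
- exists (S \o Ri); split; first exact: bounded_operator_comp.
    by move=> u /=; rewrite -RT SK RiK.
  by move=> u /=; rewrite -RT RK KS.
- exists (S \o Rf); split; first exact: bounded_operator_comp.
    by move=> u /=; apply: (can_inj RK); rewrite RT SK.
  by move=> u /=; rewrite RT KS.
Qed.

End Transfer.

Section Regular.
Local Open Scope complex_scope.
Local Notation Re := complex.Re.
Local Notation Im := complex.Im.
Context {R : realType}.
Local Notation C := R[i].
Local Notation I := (@unit_itv R).
Local Notation Q := (@unit_square R).
Variables (M M1 M2 : nat) (A0 : R * R -> 'M[C]_M).
Variables (A1 : R * R -> 'M[C]_(M, M1)) (B1 : R * R -> 'M[C]_(M1, M)).
Variables (A2 : R * R -> 'M[C]_(M, M2)) (B2 : R * R -> 'M[C]_(M2, M)).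
Variables (K : L2 R M -> L2 R M) (lambda : C).
Hypotheses (uA0 : mcont A0) (uA1 : mcont A1) (uB1 : mcont B1).
Hypotheses (uA2 : mcont A2) (uB2 : mcont B2).

Lemma mcont_E0 : mcont (E0 A0 lambda).
Proof. by apply: mcontB => //; exact: mcont_cst. Qed.

Lemma mulop_E0 u : mulop (E0 A0 lambda) u = mulop A0 u - lambda *: u.
Proof.
rewrite (mulopBl u uA0 (mcont_cst lambda%:M)); congr (_ - _).
exact: mulop_scalar.
Qed.

Hypothesis E0_neq0 : forall k, Q k -> \det (E0 A0 lambda k) != 0.

Lemma mcont_C0 : mcont (C0 A0 lambda).
Proof. by apply: mcont_invmx => //; exact: mcont_E0. Qed.

Lemma mcont_C1 : mcont (C1 A0 A1 lambda).
Proof. by apply: mcontM => //; exact: mcont_C0. Qed.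

Lemma mcont_C2 : mcont (C2 A0 A2 lambda).
Proof. by apply: mcontM => //; exact: mcont_C0. Qed.

Lemma E0_unit k : Q k -> E0 A0 lambda k \in unitmx.
Proof. by move=> Qk; rewrite unitmxE unitfE E0_neq0. Qed.

Lemma mulop_C0K u : mulop (C0 A0 lambda) (mulop (E0 A0 lambda) u) = u.
Proof.
rewrite (mulop_comp u mcont_C0 mcont_E0) -[RHS]mulop1; apply: eq_mulop => k Qk.
by rewrite mulVmx// E0_unit.
Qed.

Lemma mulop_E0K u : mulop (E0 A0 lambda) (mulop (C0 A0 lambda) u) = u.
Proof.
rewrite (mulop_comp u mcont_E0 mcont_C0) -[RHS]mulop1; apply: eq_mulop => k Qk.
by rewrite mulmxV// E0_unit.
Qed.

Let C1l := C1 A0 A1 lambda.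
Let C2l := C2 A0 A2 lambda.

Hypothesis E1_neq0 : forall x, I x -> \det (E1 A0 A1 B1 lambda x) != 0.
Hypothesis E2_neq0 : forall x, I x -> \det (E2 A0 A2 B2 lambda x) != 0.

Let X1 : L2 R M -> L2 R M := block true C1l B1.
Let X2 : L2 R M -> L2 R M := block false C2l B2.
Let Y1 : L2 R M -> L2 R M := block_inv true C1l B1.
Let Y2 : L2 R M -> L2 R M := block_inv false C2l B2.

Definition Rinv : L2 R M -> L2 R M := mulop (E0 A0 lambda) \o X1 \o X2.

Let Rl := Rop A0 A1 B1 A2 B2 lambda.

Lemma RopE u : Rl u = Y2 (Y1 (mulop (C0 A0 lambda) u)).
Proof. by []. Qed.

Lemma RopK : cancel Rl Rinv.
Proof.
move=> u; rewrite RopE /Rinv /=.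
have K2 : cancel Y2 X2 := block_invK (b := false) mcont_C2 uB2 E2_neq0.
have K1 : cancel Y1 X1 := block_invK (b := true) mcont_C1 uB1 E1_neq0.
by rewrite K2 K1 mulop_E0K.
Qed.

Lemma RinvK : cancel Rinv Rl.
Proof.
move=> u; rewrite RopE /Rinv /=.
have K2 : cancel X2 Y2 := blockK (b := false) mcont_C2 uB2 E2_neq0.
have K1 : cancel X1 Y1 := blockK (b := true) mcont_C1 uB1 E1_neq0.
by rewrite mulop_C0K K1 K2.
Qed.

Lemma bop_Y1 : bop Y1.
Proof. exact: (bop_block_inv (b := true) mcont_C1 uB1 E1_neq0). Qed.

Lemma bop_Y2 : bop Y2.
Proof. exact: (bop_block_inv (b := false) mcont_C2 uB2 E2_neq0). Qed.

Lemma bop_Rop : bop Rl.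
Proof. exact (bop_comp (bop_comp bop_Y2 bop_Y1) (bop_mulop mcont_C0)). Qed.

Lemma bop_Rinv : bop Rinv.
Proof.
have b1 : bop X1 := bop_block true mcont_C1 uB1.
have b2 : bop X2 := bop_block false mcont_C2 uB2.
exact (bop_comp (bop_comp (bop_mulop mcont_E0) b1) b2).
Qed.

(** The two blocks cancel in turn against their inverses; what remains besides
    the identity and R K are the cross terms of [kernelop_D2D1]. *)
Lemma Rop_elimination u :
  Rl (mulop (E0 A0 lambda) u + mulop A1 (avg1op (mulop B1 u))
      + mulop A2 (avg2op (mulop B2 u)) + K u) =
  u + K1 A0 A1 B1 A2 B2 K lambda u.
Proof.
have uC0 := mcont_C0; have bC0 := bop_mulop uC0.
rewrite RopE !(bopD _ _ bC0) mulop_C0K.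
rewrite (mulop_comp (avg1op (mulop B1 u)) uC0 uA1) (mulop_comp (avg2op (mulop B2 u)) uC0 uA2).
set w := mulop (C0 A0 lambda) (K u).
set v := mulop _ (avg2op (mulop B2 u)).
rewrite -[u + mulop _ _]/(X1 u) (bopD (X1 u + v) w bop_Y1) (bopD (X1 u) v bop_Y1).
have -> : Y1 (X1 u) = u.
  exact: (blockK (b := true) mcont_C1 uB1 E1_neq0).
pose P k := C1l k *m invmx (E1 A0 A1 B1 lambda k.2).
pose S k := C2l k *m invmx (E2 A0 A2 B2 lambda k.1).
pose Du := D1op P B1 C2l B2 u.
have -> : u + Y1 v = X2 u - Du by rewrite /Y1 /block_inv addrA.
transitivity (Y2 (X2 u) - Y2 Du + Y2 (Y1 w)).
  move: (X2 u) Du (Y1 w) bop_Y2; move: Y2 => T a d e bT.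
  by rewrite (bopD _ _ bT) (bopB _ _ bT).
have -> : Y2 (X2 u) = u.
  exact: (blockK (b := false) mcont_C2 uB2 E2_neq0).
rewrite -addrA; congr (_ + _); rewrite /K1; congr (_ + _).
have uP : mcont P := mcont_mul_inv_symbol (b := true) mcont_C1 uB1 E1_neq0.
have uS : mcont S := mcont_mul_inv_symbol (b := false) mcont_C2 uB2 E2_neq0.
have := kernelop_D2D1 uP uB1 mcont_C2 uB2 uS u.
rewrite -[kernelop _ u]/(kernelop (fun k k' =>
  D2 A0 A1 B1 A2 B2 lambda k k' - D1 A0 A1 B1 A2 B2 lambda k k') u).
by move=> ->; rewrite /Y2 /block_inv opprB.
Qed.

End Regular.

(** * Singular sequences *)

Section WeylAbstract.
Local Open Scope complex_scope.
Local Notation Re := complex.Re.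
Local Notation Im := complex.Im.
Context {K : numFieldType} {V : normedModType K}.
Implicit Types S T : V -> V.

(** The images of the rescaled sequence have a cluster point, which infinitely
    many of them approach. *)
Lemma compact_operator_close (T : V -> V) (u : nat -> V) (c : K) :
  compact_operator T -> 0 < c -> (forall n, `|u n| <= c) ->
  forall (e : K) N, 0 < e ->
  exists n m, [/\ (N <= n)%N, (n < m)%N & `|T (u n) - T (u m)| < e].
Proof.
move=> [lT]; rewrite precompactE => cT c0 uc e N e0.
pose v n := T (c^-1 *: u n).
have vT n : (T @` [set w | `|w| <= 1]) (v n).
  exists (c^-1 *: u n) => //=.
  by rewrite normrZ gtr0_norm ?invr_gt0// mulrC ler_pdivrMr// mul1r.
have [|p [_ clp]] := cT (v @ \oo) _.
  by exists 0%N => // n _; apply: subset_closure; exact: vT.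
have e2 : 0 < e / c / 2 by rewrite !divr_gt0.
have pick N' : exists2 n, (N' <= n)%N & ball p (e / c / 2) (v n).
  have [|_ [[n nN <-] bn]] := clp (v @` [set n | (N' <= n)%N]) _ _ (nbhsx_ballx p _ e2).
    by exists N' => // n /= nN; exists n.
  by exists n.
have [n Nn bn] := pick N; have [m nm bm] := pick n.+1.
exists n, m; split=> //.
have Tv k : T (u k) = c *: v k.
  have TZ a w : T (a *: w) = a *: T w.
    have T0 : T 0 = 0.
      have := lT (-1) 0 0; rewrite scaleN1r oppr0 addr0 => {1}->.
      by rewrite scaleN1r addNr.
    by rewrite -[a *: w]addr0 lT T0 addr0.
  by rewrite /v -TZ scalerA divff ?gt_eqF// scale1r.
rewrite !Tv -scalerBr normrZ gtr0_norm// mulrC -ltr_pdivlMr//.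
rewrite [e / c]splitr (le_lt_trans (ler_distD p _ _))// ltrD//.
  by rewrite distrC; move: bn; rewrite -ball_normE.
by move: bm; rewrite -ball_normE.
Qed.

(** A bounded separated sequence that is asymptotically annihilated by T0
    prevents every compact perturbation of T0 from having a bounded inverse:
    the compact part brings two members of the sequence close together after
    applying the operator, and a bounded inverse would bring them close too. *)
Lemma singular_sequence (T0 T Kc : V -> V) (u : nat -> V) (c d : K) (N : nat) :
  compact_operator Kc -> (forall v, T v = T0 v + Kc v) ->
  0 < c -> (forall n, `|u n| <= c) ->
  0 < d -> (forall n m, (N <= n)%N -> (n < m)%N -> d <= `|u n - u m|) ->
  (forall e, 0 < e -> exists N', forall n, (N' <= n)%N -> `|T0 (u n)| <= e) ->
  ~ invertible_operator T.
Proof.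
move=> cK TE c0 uc d0 sep small [S [[lS [C SC]] _ SK]].
pose D := `|C| + 1.
have D0 : 0 < D by rewrite ltr_wpDl.
(* three error terms, each at most a quarter of d / D *)
have e0 : 0 < d / (D * 4) by rewrite divr_gt0// mulr_gt0.
have [N' HN'] := small _ e0.
have [n [m [nN nm Knm]]] := compact_operator_close cK c0 uc (maxn N N') e0.
have {nN} [nN nN'] : (N <= n)%N /\ (N' <= n)%N by move: nN; rewrite geq_max => /andP.
have SD x y : S x - S y = S (x - y).
  by rewrite [x - y]addrC -[- y]scaleN1r lS scaleN1r [RHS]addrC.
have := sep n m nN nm; rewrite -[u n]SK -[u m]SK SD => dS.
have : d <= D * `|T (u n) - T (u m)|.
  apply: (le_trans dS); apply: (le_trans (SC _)).
  have h : C * `|T (u n) - T (u m)| \is Num.real.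
    by rewrite realE (le_trans (normr_ge0 _) (SC _)).
  apply: (le_trans (real_ler_norm h)); rewrite normrM normr_id ler_wpM2r//.
  by rewrite lerDl.
rewrite mulrC -ler_pdivrMr// !TE opprD addrACA => dT.
have : d / D < d / D.
  apply: (le_lt_trans dT); apply: (le_lt_trans (ler_normD _ _)).
  have -> : d / D = (d / (D * 4) + d / (D * 4)) + d / (D * 4) + d / (D * 4).
    by field; rewrite gt_eqF.
  rewrite -[ltRHS]addrA ler_ltD//; last by rewrite (lt_trans Knm)// ltrDl.
  rewrite (le_trans (ler_normB _ _))// lerD// HN'// (leq_trans nN')//.
  exact: ltnW.
by rewrite ltxx.
Qed.

End WeylAbstract.

Section Bumps.
Local Open Scope complex_scope.
Local Notation Re := complex.Re.
Local Notation Im := complex.Im.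
Context {R : realType}.
Local Notation C := R[i].
Local Notation I := (@unit_itv R).
Local Notation Q := (@unit_square R).
Local Notation lam := (@lebesgue_measure R).
Let mI := @measurable_itv01 R.
Let lI := @measure_itv01_fin R.
Let mQ := @measurable_unit_square R.
Let lQ := @measure_square_fin R.

(** Nonnegative bounded functions of norm one in L2 of the unit interval. *)
Definition unit_bump (phi : R -> R) := [/\ measurable_fun I phi,
  forall x, 0 <= phi x, exists B, forall x, phi x <= B &
  (\int[lam]_(x in I) (phi x ^+ 2)%:E = 1)%E].

Lemma unit_bump1 : unit_bump (fun=> 1).
Proof.
split => //; first by exists 1.
by under eq_integral do rewrite expr1n; rewrite integral_cst//= measure_itv01 mule1.
Qed.

Lemma bump_integrable phi : unit_bump phi -> lam.-integrable I (EFin \o phi).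
Proof.
move=> [mphi p0 [B pB] _].
apply: (le_integrable mI _ _ (integrable_cst mI lI B)); first exact/measurable_EFinP.
move=> x Ix /=; rewrite lee_fin !ger0_norm//.
by rewrite (le_trans (p0 x)).
Qed.

(** The normalized indicator of the interval from a to a + s. *)
Definition itv_bump (a s x : R) : R := \1_(`[a, a + s]%classic) x * (Num.sqrt s)^-1.

Lemma itv_bumpE a s x : itv_bump a s x != 0 -> a <= x <= a + s.
Proof.
rewrite /itv_bump indicE; case: (boolP (x \in _)) => [/set_mem|_]; last by rewrite mul0r eqxx.
by rewrite /= in_itv.
Qed.

Lemma measurable_itv_bump a s D : measurable_fun D (itv_bump a s).
Proof.
by apply: measurable_funM; [apply: measurable_indic; exact: measurable_itv|exact: measurable_cst].
Qed.

Lemma integral_itv_indic a s : 0 <= a -> 0 < s -> a + s <= 1 ->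
  (\int[lam]_(x in I) (\1_(`[a, a + s]%classic) x)%:E = s%:E)%E.
Proof.
move=> a0 s0 as1; rewrite (integral_indic lam mI (measurable_itv _)).
have -> : `[a, a + s]%classic `&` I = `[a, a + s]%classic :> set R.
  apply/seteqP; split => x; first by case.
  rewrite /unit_itv /= !in_itv/= => /andP[ax xs]; split; first by rewrite ax.
  by rewrite (le_trans a0 ax) (le_trans xs as1).
have := @lebesgue_measure_itv R `[a, a + s].
by rewrite /= lte_fin ltrDl s0 -EFinB [a + s]addrC addrK.
Qed.

Lemma itv_bump_bump a s : 0 <= a -> 0 < s -> a + s <= 1 -> unit_bump (itv_bump a s).
Proof.
move=> a0 s0 as1; split.
- exact: measurable_itv_bump.
- by move=> x; rewrite mulr_ge0 ?invr_ge0 ?sqrtr_ge0.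
- exists (Num.sqrt s)^-1 => x; by rewrite ler_piMl ?invr_ge0 ?sqrtr_ge0.
- have -> : (\int[lam]_(x in I) (itv_bump a s x ^+ 2)%:E =
     \int[lam]_(x in I) (s^-1%:E * (\1_(`[a, a + s]%classic) x)%:E))%E.
    apply: eq_integral => x _; rewrite -EFinM; congr EFin.
    rewrite /itv_bump exprMn exprVn sqr_sqrtr ?(ltW s0)// mulrC; congr (_ * _).
    by rewrite indicE; case: (x \in _); rewrite ?expr1n ?expr0n.
  rewrite ge0_integralZl//.
  + by rewrite integral_itv_indic// -EFinM mulVf// gt_eqF.
  + by apply/measurable_EFinP; apply: measurable_indic; exact: measurable_itv.
  + by rewrite lee_fin invr_ge0 ltW.
Qed.

Lemma Rintegral_itv_bump a s : 0 <= a -> 0 < s -> a + s <= 1 ->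
  \int[lam]_(x in I) itv_bump a s x = Num.sqrt s.
Proof.
move=> a0 s0 as1; rewrite /Rintegral.
have -> : (\int[lam]_(x in I) (itv_bump a s x)%:E =
     \int[lam]_(x in I) ((Num.sqrt s)^-1%:E * (\1_(`[a, a + s]%classic) x)%:E))%E.
  by apply: eq_integral => x _; rewrite -EFinM mulrC.
rewrite ge0_integralZl//.
- rewrite integral_itv_indic//= -[X in _ * X]sqr_sqrtr ?(ltW s0)// expr2 mulrA.
  by rewrite mulVf ?mul1r// gt_eqF// sqrtr_gt0.
- by apply/measurable_EFinP; apply: measurable_indic; exact: measurable_itv.
Qed.

(** Disjoint unit bumps that shrink to a given point: the n-th one sits at
    distance between 2 s and 3 s from the point, where s = 2 ^ - (n + 3). *)
Lemma bump_sequence (x0 : R) : I x0 -> exists phi : nat -> R -> R,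
  [/\ forall n, unit_bump (phi n),
      forall n m x, n != m -> phi n x * phi m x = 0 &
      forall e, 0 < e -> exists N, forall n, (N <= n)%N ->
        \int[lam]_(x in I) phi n x <= e /\
        forall x, phi n x != 0 -> `|x - x0| < e].
Proof.
rewrite /unit_itv/= in_itv/= => /andP[x00 x01].
pose s n : R := (1 / 8) * (1 / 2) ^+ n.
have s0 n : 0 < s n by rewrite mulr_gt0// exprn_gt0.
have sS n : s n.+1 = s n / 2 by rewrite /s exprS; field.
have sle n m : (n <= m)%N -> s m <= s n.
  move=> nm; rewrite ler_pM2l// ler_wiXn2l//; lra.
have s8 n : s n <= 1 / 8 by rewrite (le_trans (sle 0%N n _))// /s expr0 mulr1.
(* to the right of a point of the left half, and vice versa, so as to stay
   in the unit interval *)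
pose a n := if x0 <= 1 / 2 then x0 + 2 * s n else x0 - 3 * s n.
have a0 n : 0 <= a n.
  rewrite /a; case: (lerP x0 (1 / 2)) => h; have := s8 n; have := s0 n; lra.
have a1 n : a n + s n <= 1.
  rewrite /a; case: (lerP x0 (1 / 2)) => h; have := s8 n; have := s0 n; lra.
have ax n x : itv_bump (a n) (s n) x != 0 -> 2 * s n <= `|x - x0| <= 3 * s n.
  move=> /itv_bumpE/andP[]; rewrite /a; have := s0 n.
  case: (lerP x0 (1 / 2)) => h sn h1 h2.
    by rewrite ger0_norm; [apply/andP; split|]; lra.
  by rewrite ler0_norm; [apply/andP; split|]; lra.
have disj n m x : (n < m)%N -> itv_bump (a n) (s n) x * itv_bump (a m) (s m) x = 0.
  move=> nm; apply/eqP; rewrite mulf_eq0; apply/negPn; rewrite negb_or.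
  apply/negP => /andP[/ax/andP[h1 _] /ax/andP[_ h2]].
  have := sle _ _ nm; rewrite sS; have := s0 n; lra.
exists (fun n => itv_bump (a n) (s n)); split.
- by move=> n; exact: itv_bump_bump.
- move=> n m x; rewrite neq_ltn => /orP[nm|nm]; first exact: disj.
  by rewrite mulrC disj.
- move=> e e0.
  pose e' := Num.min (e ^+ 2) (e / 4).
  have e'0 : 0 < e' by rewrite lt_min exprn_gt0// divr_gt0.
  have [N Ne] : exists N, s N <= e'.
    have h1 : `|1 / 2 : R| < 1 by rewrite ger0_norm; lra.
    have /cvgrPdist_le/(_ _ e'0)[N _ /(_ N (leqnn N))] := cvg_expr h1.
    rewrite sub0r normrN => hN; exists N; apply: le_trans hN.
    by rewrite ger0_norm ?exprn_ge0// ?ler_piMl ?exprn_ge0//; lra.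
  exists N => n Nn; have sn := le_trans (sle _ _ Nn) Ne.
  have [sn1 sn2] : s n <= e ^+ 2 /\ s n <= e / 4 by move: sn; rewrite le_min => /andP.
  split.
    rewrite Rintegral_itv_bump// -[leRHS]ger0_norm ?(ltW e0)// -sqrtr_sqr.
    exact: ler_wsqrtr.
  by move=> x /ax/andP[_ h]; rewrite (le_lt_trans h)//; have := s0 n; lra.
Qed.

End Bumps.

(** * Windows *)

Section Windows.
Local Open Scope complex_scope.
Local Notation Re := complex.Re.
Local Notation Im := complex.Im.
Context {R : realType}.
Local Notation C := R[i].
Local Notation I := (@unit_itv R).
Local Notation Q := (@unit_square R).
Local Notation lam := (@lebesgue_measure R).
Let mI := @measurable_itv01 R.
Let lI := @measure_itv01_fin R.
Let mQ := @measurable_unit_square R.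
Let lQ := @measure_square_fin R.

Lemma bounded_sqint d (T : measurableType d) (mu : {measure set T -> \bar R})
  (D : set T) m (g : T -> 'cV[C]_m) (c : R) :
  measurable D -> (mu D < +oo)%E -> mxmeas D g ->
  (forall k, D k -> forall i, cabs (g k i 0) <= c) -> sqint mu D g.
Proof.
move=> mD lD mg gc; split => //.
apply: (@le_lt_trans _ _ (\int[mu]_(x in D) (m%:R * c ^+ 2)%:E)%E).
  apply: ge0_le_integral => //.
  - by move=> x _; rewrite lee_fin sqnorm_ge0.
  - exact: mxmeas_sqnorm.
  - by move=> x Dx; rewrite lee_fin; apply: sqnorm_le; exact: gc.
rewrite integral_cst// lte_mul_pinfty// lee_fin.
by rewrite mulr_ge0 ?sqr_ge0.
Qed.

Lemma bounded_nice m (g : R * R -> 'cV[C]_m) (c : R) : mxmeas Q g ->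
  (forall k, Q k -> forall i, cabs (g k i 0) <= c) -> nice g.
Proof.
move=> mg gc; split; first exact: bounded_sqint gc.
move=> b x Ix; apply: (bounded_sqint mI lI (mxmeas_section b Ix mg)) => t It i.
by apply: gc; exact: square_pt.
Qed.

(** A product of two bumps; the second one is in the variable that the average
    in direction b leaves free. *)
Definition win (b : bool) (phi psi : R -> R) (k : R * R) : R :=
  phi (co (~~ b) k) * psi (co b k).

Lemma winC b phi psi : win b phi psi = win (~~ b) psi phi.
Proof. by apply/funext => k; rewrite /win negbK mulrC. Qed.

Lemma win_pt b phi psi t x : win b phi psi (pt b t x) = phi t * psi x.
Proof. by rewrite /win coN_pt co_pt. Qed.

Lemma win_ge0 b phi psi k : unit_bump phi -> unit_bump psi -> 0 <= win b phi psi k.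
Proof. by move=> [_ p0 _ _] [_ q0 _ _]; exact: mulr_ge0. Qed.

Lemma win_bounded b phi psi : unit_bump phi -> unit_bump psi ->
  exists B, forall k, win b phi psi k <= B.
Proof.
move=> [_ p0 [B pB] _] [_ q0 [B' qB] _]; exists (B * B') => k.
by apply: ler_pM.
Qed.

Lemma measurable_win b phi psi : unit_bump phi -> unit_bump psi ->
  measurable_fun Q (win b phi psi).
Proof.
move=> [mp _ _ _] [mq _ _ _]; apply: measurable_funM.
  exact: measurable_co mp.
exact: measurable_co mq.
Qed.

Lemma int_win_sqr b phi psi : unit_bump phi -> unit_bump psi ->
  (\int[leb2]_(k in Q) (win b phi psi k ^+ 2)%:E = 1)%E.
Proof.
move=> bp bq; have mw := measurable_win b bp bq.
have [mp p0 _ ip] := bp; have [mq q0 _ iq] := bq.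
have mp2 : measurable_fun I (fun x => (phi x ^+ 2)%:E).
  by apply/measurable_EFinP; exact: measurable_funX.
rewrite (square_tonelli b (g := fun k => (win b phi psi k ^+ 2)%:E)); last 2 first.
- by move=> k; rewrite lee_fin sqr_ge0.
- by apply/measurable_EFinP; exact: measurable_funX.
rewrite -[RHS]iq; apply: eq_integral => x _.
transitivity (\int[lam]_(t in I) ((psi x ^+ 2)%:E * (phi t ^+ 2)%:E))%E.
  by apply: eq_integral => t _; rewrite win_pt exprMn mulrC EFinM.
rewrite ge0_integralZl ?lee_fin ?sqr_ge0//.
  by rewrite ip mule1.
by move=> t _; rewrite lee_fin sqr_ge0.
Qed.

(** A window has norm one, so a field bounded by c times a window has norm at
    most c, up to the factor coming from the number of components. *)
Lemma norm_le_win m b phi psi (g : R * R -> 'cV[C]_m) (c : R) :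
  unit_bump phi -> unit_bump psi -> nice g -> 0 <= c ->
  (forall k, Q k -> forall i, cabs (g k i 0) <= c * win b phi psi k) ->
  `|toL2 g| <= (Num.sqrt m%:R * c)%:C.
Proof.
move=> bp bq ng c0 gc; rewrite (norm_toL2 (nice_L2fun ng)) lecR.
have -> : Num.sqrt m%:R * c = Num.sqrt (m%:R * c ^+ 2).
  by rewrite sqrtrM ?ler0n// sqrtr_sqr ger0_norm.
apply: ler_wsqrtr; have [[mg lg] _] := ng.
have fg := @L2norm_fin R m (L2Fun (nice_L2fun ng)).
rewrite -lee_fin /Rintegral fineK//.
have mw2 : measurable_fun Q (fun k => (win b phi psi k ^+ 2)%:E).
  by apply/measurable_EFinP; apply: measurable_funX; exact: measurable_win.
have -> : ((m%:R * c ^+ 2)%:E =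
    \int[leb2]_(k in Q) ((m%:R * c ^+ 2)%:E * (win b phi psi k ^+ 2)%:E))%E.
  rewrite ge0_integralZl//.
  - by rewrite int_win_sqr// mule1.
  - by move=> k _; rewrite lee_fin sqr_ge0.
  - by rewrite lee_fin mulr_ge0 ?sqr_ge0.
apply: ge0_le_integral => //.
- by move=> x _; rewrite lee_fin sqnorm_ge0.
- exact: mxmeas_sqnorm.
- by apply: emeasurable_funM => //; exact: measurable_cst.
- move=> k Qk; rewrite -EFinM lee_fin -mulrA -exprMn.
  by apply: sqnorm_le => i; exact: gc.
Qed.

Definition wfield m b phi psi (w : R * R -> 'cV[C]_m) (k : R * R) : 'cV[C]_m :=
  (win b phi psi k)%:C *: w k.

Lemma cabs_wfield m b phi psi (w : R * R -> 'cV[C]_m) k i :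
  unit_bump phi -> unit_bump psi ->
  cabs (wfield b phi psi w k i 0) = win b phi psi k * cabs (w k i 0).
Proof.
move=> bp bq; rewrite mxE cabsM; congr (_ * _).
by rewrite /= expr0n addr0 sqrtr_sqr ger0_norm// win_ge0.
Qed.

Lemma nice_wfield m b phi psi (w : R * R -> 'cV[C]_m) :
  unit_bump phi -> unit_bump psi -> mcont w -> nice (wfield b phi psi w).
Proof.
move=> bp bq uw; have [M M0 wM] := mcont_bounded uw.
have [B wB] := win_bounded b bp bq.
apply: (@bounded_nice _ _ (B * M)).
  move=> i j; apply: (@eq_cmeas _ _ _ _ (fun k => (win b phi psi k)%:C * w k i j)).
    by move=> k _; rewrite mxE.
  apply: cmeasM; last exact: (mcont_mxmeas uw).
  by split => /=; [exact: measurable_win|exact: measurable_cst].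
move=> k Qk i; rewrite cabs_wfield//; apply: ler_pM => //.
- exact: win_ge0.
- exact: cabs_ge0.
- exact: wM.
Qed.

Lemma norm_wfield m b phi psi (w : R * R -> 'cV[C]_m) (c : R) :
  unit_bump phi -> unit_bump psi -> mcont w -> 0 <= c ->
  (forall k, Q k -> win b phi psi k != 0 -> forall i, cabs (w k i 0) <= c) ->
  `|toL2 (wfield b phi psi w)| <= (Num.sqrt m%:R * c)%:C.
Proof.
move=> bp bq uw c0 wc; apply: (norm_le_win (b := b) bp bq (nice_wfield b bp bq uw) c0).
move=> k Qk i; rewrite cabs_wfield// mulrC.
have [->|w0] := eqVneq (win b phi psi k) 0; first by rewrite !mulr0.
by rewrite ler_wpM2r ?win_ge0// wc.
Qed.

(** The average of a bounded field seen through a window is bounded by the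
    remaining bump times the integral of the averaged one. *)
Lemma norm_avg_wfield m b phi psi (w : R * R -> 'cV[C]_m) (c : R) :
  unit_bump phi -> unit_bump psi -> mcont w -> 0 <= c ->
  (forall k, Q k -> forall i, cabs (w k i 0) <= c) ->
  `|avgop b (toL2 (wfield b phi psi w))| <=
  (Num.sqrt m%:R * (2 * c * \int[lam]_(t in I) phi t))%:C.
Proof.
move=> bp bq uw c0 wc; have nw := nice_wfield b bp bq uw.
have [mp p0 _ _] := bp; have [mq q0 _ _] := bq.
rewrite (avgop_toL2 b nw).
have i0 : 0 <= \int[lam]_(t in I) phi t by apply: Rintegral_ge0 => x _.
apply: (norm_le_win (b := b) unit_bump1 bq (nice_avg b nw)).
  by rewrite !mulr_ge0.
move=> k Qk i; have Ik := square_co b Qk.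
have mw : mxmeas Q (wfield b phi psi w) by case: nw => -[].
have ip : lam.-integrable I (EFin \o (fun t => (c * psi (co b k)) * phi t)).
  have := integrableZl mI (c * psi (co b k)) (bump_integrable bp).
  by apply: eq_integrable => // x _; rewrite /= EFinM.
rewrite mxE; apply: (le_trans (cabs_Cintegral mI
  (mxmeas_section b Ik mw i 0) ip _)).
  move=> t It; rewrite cabs_wfield// win_pt.
  have -> : c * psi (co b k) * phi t = phi t * psi (co b k) * c by ring.
  by apply: ler_wpM2l; [exact: mulr_ge0|apply: wc; exact: square_pt].
rewrite RintegralZl//; last exact: bump_integrable.
by rewrite le_eqVlt; apply/orP; left; apply/eqP; rewrite /win; ring.
Qed.

Lemma mulop_wfield m n b phi psi (F : R * R -> 'M[C]_(m, n)) (w : R * R -> 'cV[C]_n) :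
  unit_bump phi -> unit_bump psi -> mcont F -> mcont w ->
  mulop F (toL2 (wfield b phi psi w)) = toL2 (wfield b phi psi (fun k => F k *m w k)).
Proof.
move=> bp bq uF uw; rewrite (mulop_toL2 uF (nice_L2fun (nice_wfield b bp bq uw))).
by apply: toL2_ext => k _; rewrite /wfield scalemxAr.
Qed.

Lemma wfieldB m b phi psi (w w' : R * R -> 'cV[C]_m) :
  unit_bump phi -> unit_bump psi -> mcont w -> mcont w' ->
  toL2 (wfield b phi psi (fun k => w k - w' k)) =
  toL2 (wfield b phi psi w) - toL2 (wfield b phi psi w').
Proof.
move=> bp bq uw uw'; have nw := nice_wfield b bp bq uw.
have nw' := nice_wfield b bp bq uw'.
rewrite -[- toL2 _]scaleN1r -(toL2Z (-1) (nice_L2fun nw')).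
rewrite -(toL2D (nice_L2fun nw) (nice_L2fun (niceZ (-1) nw'))).
by apply: toL2_ext => k _; rewrite /wfield scalerBr scaleN1r.
Qed.

(** Constant vectors seen through windows with disjoint supports are
    orthogonal. *)
Lemma norm_disjoint_wfield m b phi psi phi' psi' (v : 'cV[C]_m) :
  unit_bump phi -> unit_bump psi -> unit_bump phi' -> unit_bump psi' ->
  (forall k, win b phi psi k * win b phi' psi' k = 0) ->
  `|toL2 (wfield b phi psi (fun=> v)) - toL2 (wfield b phi' psi' (fun=> v))| =
  (Num.sqrt (2 * sqnorm v))%:C.
Proof.
move=> bp bq bp' bq' disj; have uv := mcont_cst v.
have nw := nice_wfield b bp bq uv; have nw' := nice_wfield b bp' bq' uv.
rewrite -[- toL2 _]scaleN1r -(toL2Z (-1) (nice_L2fun nw')).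
rewrite -(toL2D (nice_L2fun nw) (nice_L2fun (niceZ (-1) nw'))).
rewrite (norm_toL2 (nice_L2fun (niceD nw (niceZ (-1) nw')))).
congr (Num.sqrt _)%:C.
have m2 p q : unit_bump p -> unit_bump q -> measurable_fun Q (fun k => (win b p q k ^+ 2)%:E).
  by move=> hp hq; apply/measurable_EFinP; apply: measurable_funX; exact: measurable_win.
transitivity (fine (\int[leb2]_(k in Q) ((sqnorm v)%:E *
    ((win b phi psi k ^+ 2)%:E + (win b phi' psi' k ^+ 2)%:E)))%E).
  congr fine; apply: eq_integral => k _.
  rewrite /wfield scalerA -scalerDl sqnormZ -EFinD -EFinM; congr EFin.
  rewrite mulrC; congr (_ * _).
  rewrite Defs.ReD Defs.ImD Defs.ReM Defs.ImM /=.
  have := disj k; set x := win _ _ _ _; set y := win _ _ _ _ => xy.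
  by transitivity (x ^+ 2 + y ^+ 2 - 2 * (x * y)); [ring|rewrite xy; ring].
rewrite ge0_integralZl//; last 3 first.
- by apply: emeasurable_funD; exact: m2.
- by move=> k _; rewrite -EFinD lee_fin addr_ge0 ?sqr_ge0.
- by rewrite lee_fin sqnorm_ge0.
rewrite ge0_integralD//; last 4 first.
- by move=> k _; rewrite lee_fin sqr_ge0.
- exact: m2.
- by move=> k _; rewrite lee_fin sqr_ge0.
- exact: m2.
by rewrite !int_win_sqr//= mulrC.
Qed.

End Windows.

(** * Degenerate symbols *)

Section Singular.
Local Open Scope complex_scope.
Local Notation Re := complex.Re.
Local Notation Im := complex.Im.
Context {R : realType}.
Local Notation C := R[i].
Local Notation I := (@unit_itv R).
Local Notation Q := (@unit_square R).
Local Notation lam := (@lebesgue_measure R).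

Definition vanishing m (u : nat -> L2 R m) := forall e : R, 0 < e ->
  exists N, forall n, (N <= n)%N -> `|u n| <= e%:C.

Lemma vanishingD m (u v : nat -> L2 R m) :
  vanishing u -> vanishing v -> vanishing (fun n => u n + v n).
Proof.
move=> su sv e e0; have e2 : 0 < e / 2 by rewrite divr_gt0.
have [N uN] := su _ e2; have [N' vN] := sv _ e2.
exists (maxn N N') => n; rewrite geq_max => /andP[/uN h1 /vN h2].
by rewrite (le_trans (ler_normD _ _))// [e]splitr rmorphD lerD.
Qed.

Lemma vanishing_bop m n (T : L2 R m -> L2 R n) (u : nat -> L2 R m) :
  bop T -> vanishing u -> vanishing (fun n => T (u n)).
Proof.
move=> [_ [c c0 Tc]] su e e0; have c1 : 0 < c + 1 by rewrite ltr_wpDl.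
have [N uN] := su _ (divr_gt0 e0 c1); exists N => k /uN h.
rewrite (le_trans (Tc _))// (@le_trans _ _ ((c + 1)%:C * (e / (c + 1))%:C))//.
  by apply: ler_pM => //; rewrite ?ler0c// lecR lerDl.
by rewrite -rmorphM mulrC divfK// gt_eqF.
Qed.

Lemma vanishing_wfield m b (phi psi : nat -> R -> R) (w : R * R -> 'cV[C]_m) :
  (forall n, unit_bump (phi n)) -> (forall n, unit_bump (psi n)) -> mcont w ->
  (forall e, 0 < e -> exists N, forall n k, (N <= n)%N -> Q k ->
     win b (phi n) (psi n) k != 0 -> forall i, cabs (w k i 0) <= e) ->
  vanishing (fun n => toL2 (wfield b (phi n) (psi n) w)).
Proof.
move=> bp bq uw ws e e0; pose d := Num.sqrt m%:R + 1 : R.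
have d0 : 0 < d by rewrite ltr_wpDl// sqrtr_ge0.
have [N HN] := ws _ (divr_gt0 e0 d0); exists N => n Nn.
have ed : 0 <= e / d by rewrite ltW// divr_gt0.
apply: (le_trans (norm_wfield (bp n) (bq n) uw ed _)).
  by move=> k Qk wk i; exact: (HN n k Nn Qk wk i).
rewrite lecR -[leRHS](divfK (lt0r_neq0 d0)) mulrC ler_wpM2l//.
by rewrite /d lerDl.
Qed.

Lemma vanishing_avg m b (phi psi : nat -> R -> R) (w : R * R -> 'cV[C]_m) :
  (forall n, unit_bump (phi n)) -> (forall n, unit_bump (psi n)) -> mcont w ->
  (forall e, 0 < e -> exists N, forall n, (N <= n)%N ->
     \int[lam]_(x in I) phi n x <= e) ->
  vanishing (fun n => avgop b (toL2 (wfield b (phi n) (psi n) w))).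
Proof.
move=> bp bq uw ps e e0; have [M M0 wM] := mcont_bounded uw.
pose d := Num.sqrt m%:R * (2 * M) + 1 : R.
have d0 : 0 < d by rewrite ltr_wpDl// mulr_ge0 ?sqrtr_ge0// mulr_ge0// ltW.
have [N HN] := ps _ (divr_gt0 e0 d0); exists N => n Nn.
apply: (le_trans (norm_avg_wfield b (bp n) (bq n) uw (ltW M0) _)).
  by move=> k Qk i; exact: wM.
rewrite lecR mulrA -[leRHS](divfK (lt0r_neq0 d0)) [leRHS]mulrC.
apply: ler_pM; [| |by rewrite /d lerDl|exact: HN].
- by rewrite mulr_ge0 ?sqrtr_ge0// mulr_ge0// ltW.
- by apply: Rintegral_ge0 => x _; case: (bp n).
Qed.

Lemma wfield_bounded m b (phi psi : nat -> R -> R) (w : R * R -> 'cV[C]_m) :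
  (forall n, unit_bump (phi n)) -> (forall n, unit_bump (psi n)) -> mcont w ->
  exists2 c : C, 0 < c & forall n, `|toL2 (wfield b (phi n) (psi n) w)| <= c.
Proof.
move=> bp bq uw; have [M M0 wM] := mcont_bounded uw.
exists (Num.sqrt m%:R * M + 1)%:C.
  by rewrite ltcR ltr_wpDl// mulr_ge0 ?sqrtr_ge0// ltW.
move=> n; apply: (le_trans (norm_wfield (bp n) (bq n) uw (ltW M0) _)).
  by move=> k Qk _ i; exact: wM.
by rewrite lecR lerDl.
Qed.

Lemma vanishing_C m (u : nat -> L2 R m) : vanishing u ->
  forall e : C, 0 < e -> exists N, forall n, (N <= n)%N -> `|u n| <= e.
Proof.
move=> su [a b]; rewrite ltcE /= => /andP[/eqP b0 a0].
by have [N uN] := su _ a0; exists N => n /uN; rewrite b0.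
Qed.

Lemma mcont_modulus m (w : R * R -> 'cV[C]_m) (e : R) : mcont w -> 0 < e ->
  exists2 d : R, 0 < d & forall k k' : R * R, Q k -> Q k' ->
    `|k.1 - k'.1| < d -> `|k.2 - k'.2| < d ->
    forall i, cabs (w k i 0 - w k' i 0) < e.
Proof.
move=> uw e0; have H i := cid2 (uw i 0 e e0).
exists (\big[Num.min/1]_i s2val (H i)).
  by apply/bigmin_gtP; split => // i _; case: (H i).
move=> k k' Qk Qk' k1 k2 i.
have di : \big[Num.min/1]_i s2val (H i) <= s2val (H i) by exact: bigmin_le_cond.
exact: (s2valP' (H i) k k' Qk Qk' (lt_le_trans k1 di) (lt_le_trans k2 di)).
Qed.

Lemma det0_ker n (A : 'M[C]_n) : \det A = 0 -> exists2 v : 'cV[C]_n, v != 0 & A *m v = 0.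
Proof.
move=> A0; have /det0P[v v0 vA] : \det A^T == 0 by rewrite det_tr A0.
exists v^T; first by rewrite -trmx0 (inj_eq trmx_inj).
by rewrite -[A]trmxK -trmx_mul vA trmx0.
Qed.

Lemma sqnorm_gt0 n (v : 'cV[C]_n) : v != 0 -> 0 < sqnorm v.
Proof.
move=> v0; rewrite lt0r sqnorm_ge0 andbT; apply: contra_neq v0.
exact: sqnorm_eq0.
Qed.

Lemma wfieldC m b phi psi (w : R * R -> 'cV[C]_m) :
  wfield b phi psi w = wfield (~~ b) psi phi w.
Proof. by apply/funext => k; rewrite /wfield [win b _ _]winC. Qed.

Lemma avg_mulop_wfield m n b c phi psi (B : R * R -> 'M[C]_(m, n)) (w : R * R -> 'cV[C]_n) :
  unit_bump phi -> unit_bump psi -> mcont B -> mcont w ->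
  avg_mulop b B (toL2 (wfield c phi psi w)) =
  avgop b (toL2 (wfield c phi psi (fun k => B k *m w k))).
Proof. by move=> bp bq uB uw; rewrite /avg_mulop mulop_wfield. Qed.

Variables (b : bool) (M m m' : nat) (A0 : R * R -> 'M[C]_M).
Variables (A : R * R -> 'M[C]_(M, m)) (B : R * R -> 'M[C]_(m, M)).
Variables (A' : R * R -> 'M[C]_(M, m')) (B' : R * R -> 'M[C]_(m', M)).
Variables (K T : L2 R M -> L2 R M) (lambda : C).
Hypotheses (uA0 : mcont A0) (uA : mcont A) (uB : mcont B).
Hypotheses (uA' : mcont A') (uB' : mcont B').
Hypothesis cK : compact_operator K.

(** A_0 - lambda + A P_b + A' P_b', where b' is the other direction: the two
    terms play different roles when the symbol in direction b degenerates. *)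
Definition noncompact_part u := mulop (E0 A0 lambda) u + mulop A (avg_mulop b B u)
  + mulop A' (avg_mulop (~~ b) B' u).

Hypothesis TE : forall u, T u = noncompact_part u + K u.

(** If the multiplier degenerates at a point, unit bumps around that point in
    the direction of its kernel are asymptotically annihilated: the averages
    of such bumps are small. *)
Lemma singular_E0 k0 : Q k0 -> \det (E0 A0 lambda k0) = 0 ->
  ~ invertible_operator T.
Proof.
move=> Qk0 /det0_ker[v v0 Ev].
have [phi [bphi dphi sphi]] := bump_sequence (square_co (~~ b) Qk0).
have [psi [bpsi dpsi spsi]] := bump_sequence (square_co b Qk0).
have uv := mcont_cst v; have uE := mcont_E0 lambda uA0.
pose u n := toL2 (wfield b (phi n) (psi n) (fun=> v)).
have [c c0 uc] := wfield_bounded b bphi bpsi uv.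
apply: (@singular_sequence _ _ noncompact_part T K u c (Num.sqrt (2 * sqnorm v))%:C 0%N) => //.
- by rewrite ltcR sqrtr_gt0 mulr_gt0// sqnorm_gt0.
- move=> n p _ np; rewrite norm_disjoint_wfield// => k.
  by rewrite mulrACA dphi ?mul0r// ltn_eqF.
apply: vanishing_C; apply: vanishingD; first apply: vanishingD.
- have -> : (fun n => mulop (E0 A0 lambda) (u n)) =
      (fun n => toL2 (wfield b (phi n) (psi n) (fun k => E0 A0 lambda k *m v))).
    by apply/funext => n; rewrite mulop_wfield.
  have uEv : mcont (fun k => E0 A0 lambda k *m v) by exact: mcontM.
  apply: vanishing_wfield => // e e0.
  have [d d0 Hd] : exists2 d, 0 < d & forall k, Q k -> `|k.1 - k0.1| < d ->
      `|k.2 - k0.2| < d -> forall i, cabs ((E0 A0 lambda k *m v) i 0) <= e.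
    have [d d0 Hd] := mcont_modulus uEv e0; exists d => // k Qk k1 k2 i.
    have w0 : (E0 A0 lambda k0 *m v) i 0 = 0 by rewrite Ev mxE.
    rewrite -[X in cabs X]subr0 -[X in _ - X]w0 ltW//.
    exact: (Hd k k0 Qk Qk0 k1 k2 i).
  have [N1 H1] := sphi _ d0; have [N2 H2] := spsi _ d0.
  exists (maxn N1 N2) => n k; rewrite geq_max => /andP[/H1[_ h1] /H2[_ h2]] Qk.
  rewrite mulf_eq0 negb_or => /andP[/h1 h1' /h2 h2'].
  by move: h1' h2'; case: (b) => h1' h2'; apply: Hd.
- apply: (vanishing_bop (bop_mulop uA)).
  have -> : (fun n => avg_mulop b B (u n)) =
      (fun n => avgop b (toL2 (wfield b (phi n) (psi n) (fun k => B k *m v)))).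
    by apply/funext => n; rewrite /u avg_mulop_wfield.
  apply: vanishing_avg => //; first exact: mcontM.
  by move=> e /sphi[N HN]; exists N => n /HN[].
- apply: (vanishing_bop (bop_mulop uA')).
  have -> : (fun n => avg_mulop (~~ b) B' (u n)) =
      (fun n => avgop (~~ b) (toL2 (wfield (~~ b) (psi n) (phi n) (fun k => B' k *m v)))).
    apply/funext => n; rewrite /u (wfieldC b (phi n)).
    by rewrite (avg_mulop_wfield _ _ (bpsi n) (bphi n) uB' uv).
  apply: vanishing_avg => //; first exact: mcontM.
  by move=> e /spsi[N HN]; exists N => n /HN[].
Qed.

Hypothesis E0_neq0 : forall k, Q k -> \det (E0 A0 lambda k) != 0.

Let F k := C0 A0 lambda k *m A k.
Let uF : mcont F.
Proof. by apply: mcontM => //; exact: mcont_C0. Qed.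

(** If the symbol E degenerates at a value x0 of the free variable, the fields
    F v, with v in its kernel, localized around that value are asymptotically
    annihilated, because averaging them gives (E - I) v. *)
Lemma singular_E x0 : I x0 -> \det (symbol b F B x0) = 0 ->
  ~ invertible_operator T.
Proof.
move=> Ix0 /det0_ker[v v0 Ev].
have [phi [bphi dphi sphi]] := bump_sequence Ix0.
pose one : R -> R := fun=> 1.
have b1 (n : nat) : unit_bump one := @unit_bump1 R.
have uv := mcont_cst v; have uE0 := mcont_E0 lambda uA0.
have uE : mcont (fun k => symbol b F B (co b k)) := mcont_symbol b uF uB.
have uFv : mcont (fun k => F k *m v) by exact: mcontM.
have uEv : mcont (fun k => symbol b F B (co b k) *m v) by exact: mcontM.
pose u n := toL2 (wfield b one (phi n) (fun k => F k *m v)).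
pose g n := toL2 (wfield b one (phi n) (fun k => symbol b F B (co b k) *m v)).
pose w n := toL2 (wfield b one (phi n) (fun=> v)).
have Pu n : avg_mulop b B (u n) = g n - w n.
  have bn := bphi n; have nu := nice_wfield b (b1 n) bn (mcontM uB uFv).
  rewrite /u (avg_mulop_wfield _ _ (b1 n) bn uB uFv) (avgop_toL2 b nu).
  rewrite -(wfieldB b (b1 n) bn uEv uv).
  apply: toL2_ext => k Qk; have Ik := square_co b Qk.
  have uBF := mcontM uB uF.
  transitivity ((win b one (phi n) k)%:C *:
      (avg b (fun k => B k *m F k) (co b k) *m v)); last first.
    by congr (_ *: _); rewrite /symbol mulmxDl mul1mx [v + _]addrC addrK.
  rewrite -mul_scalar_mx.
  rewrite -(mxintegralMr (@measurable_itv01 R) (@measure_itv01_fin R) _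
    (mcont_section_integrable b Ik uBF)).
  rewrite -(mxintegralMl (@measurable_itv01 R) (@measure_itv01_fin R)); last first.
    apply: mxintegrableMr; first exact: measurable_itv01.
      exact: measure_itv01_fin.
    exact: (mcont_section_integrable b Ik uBF).
  apply: eq_mxintegral => t It.
  by rewrite mul_scalar_mx /wfield win_pt mulmxA /win.
have vg : vanishing g.
  apply: vanishing_wfield => // e e0.
  have [d d0 Hd] : exists2 d, 0 < d & forall k, Q k -> `|co b k - x0| < d ->
      forall i, cabs ((symbol b F B (co b k) *m v) i 0) <= e.
    have [d d0 Hd] := mcont_modulus uEv e0; exists d => // k Qk kx i.
    pose k' := pt b (co (~~ b) k) x0.
    have Qk' : Q k' by apply: square_pt => //; exact: square_co.
    have w0 : (symbol b F B (co b k') *m v) i 0 = 0 by rewrite co_pt Ev mxE.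
    rewrite -[X in cabs X]subr0 -[X in _ - X]w0 ltW//.
    apply: (Hd k k' Qk Qk' _ _ i); move: kx; rewrite /k'; case: (b) => //= _;
      by rewrite subrr normr0.
  have [N HN] := sphi _ d0; exists N => n k /HN[_ h] Qk.
  rewrite /win mulf_eq0 negb_or => /andP[_ /h h'].
  by apply: Hd.
have bP := bop_avg_mulop b uB; have [_ [cP cP0 HP]] := bP.
have [c c0 uc] := wfield_bounded b b1 bphi uFv.
pose s : R := Num.sqrt (2 * sqnorm v).
have s0 : 0 < s by rewrite sqrtr_gt0 mulr_gt0// sqnorm_gt0.
have cP1 : 0 < cP + 1 by rewrite ltr_wpDl.
have [N gN] := vg _ (divr_gt0 s0 (ltr0n _ 4)).
(* half of s remains after the two vanishing terms; the other factor comes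
   from the bound of the averaged multiplication *)
apply: (@singular_sequence _ _ noncompact_part T K u c (s / 2 / (cP + 1))%:C N) => //.
- by rewrite ltcR !divr_gt0.
- move=> n p Nn np; have Np : (N <= p)%N := leq_trans Nn (ltnW np).
  have wnp : `|w n - w p| = s%:C.
    apply: (norm_disjoint_wfield v (b1 n) (bphi n) (b1 p) (bphi p)) => k.
    by rewrite mulrACA dphi ?mulr0// ltn_eqF.
  have wE : w n - w p = (g n - g p) - avg_mulop b B (u n - u p).
    have -> : avg_mulop b B (u n - u p) = (g n - w n) - (g p - w p).
      rewrite (_ : avg_mulop b B (u n - u p) = avg_mulop b B (u n) - avg_mulop b B (u p)).
        by congr (_ - _); exact: Pu.
      exact (bopB (u n) (u p) bP).
    move: (g n) (g p) (w n) (w p) => x y z t.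
    by rewrite opprB addrA subrKA opprB addrC subrKA.
  have : s%:C <= (s / 4)%:C + (s / 4)%:C + (cP + 1)%:C * `|u n - u p|.
    rewrite -wnp wE (le_trans (ler_normB _ _))// lerD//.
      by rewrite (le_trans (ler_normB _ _))// lerD// gN.
    by rewrite (le_trans (HP _))// ler_wpM2r// lecR lerDl.
  have -> : s%:C = (s / 4)%:C + (s / 4)%:C + (s / 2)%:C.
    by rewrite -!rmorphD; congr (_%:C); field.
  rewrite lerD2l => h.
  have -> : (s / 2 / (cP + 1))%:C = (s / 2)%:C / (cP + 1)%:C.
    by rewrite [LHS]rmorphM fmorphV.
  by rewrite ler_pdivrMr ?ltcR// [leRHS]mulrC.
apply: vanishing_C; apply: vanishingD.
- have -> : (fun n => mulop (E0 A0 lambda) (u n) + mulop A (avg_mulop b B (u n))) =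
     (fun n => mulop A (g n)).
    apply/funext => n; have bn := bphi n; rewrite Pu (bopB (g n) (w n) (bop_mulop uA)).
    suff -> : mulop (E0 A0 lambda) (u n) = mulop A (w n) by rewrite addrC subrK.
    rewrite /u /w (mulop_wfield b (b1 n) bn uE0 uFv) (mulop_wfield b (b1 n) bn uA uv).
    apply: toL2_ext => k Qk.
    by rewrite /wfield /F !mulmxA mulmxV ?mul1mx// unitmxE unitfE E0_neq0.
  exact: (vanishing_bop (bop_mulop uA)).
- apply: (vanishing_bop (bop_mulop uA')).
  have -> : (fun n => avg_mulop (~~ b) B' (u n)) =
      (fun n => avgop (~~ b) (toL2 (wfield (~~ b) (phi n) one (fun k => B' k *m (F k *m v))))).
    by apply/funext => n; rewrite /u (wfieldC b one) (avg_mulop_wfield _ _ (bphi n) (b1 n) uB' uFv).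
  apply: vanishing_avg => //; first exact: mcontM.
  by move=> e /sphi[N' HN]; exists N' => n /HN[].
Qed.

End Singular.

(** * The spectrum *)

Unset Implicit Arguments.
Set Strict Implicit.
Set Printing Implicit Defensive.

Theorem mainTheorem3 (R : realType) (M M1 M2 : nat)
  (M_gt0 : (0 < M)%N) (M1_gt0 : (0 < M1)%N) (M2_gt0 : (0 < M2)%N)
  (A0 : R * R -> 'M[R[i]]_M)
  (A1 : R * R -> 'M[R[i]]_(M, M1)) (B1 : R * R -> 'M[R[i]]_(M1, M))
  (A2 : R * R -> 'M[R[i]]_(M, M2)) (B2 : R * R -> 'M[R[i]]_(M2, M))
  (K : L2 R M -> L2 R M) (A : L2 R M -> L2 R M)
  (A0_cont : continuous_on_square A0)
  (A1_cont : continuous_on_square A1) (B1_cont : continuous_on_square B1)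
  (A2_cont : continuous_on_square A2) (B2_cont : continuous_on_square B2)
  (K_compact : compact_operator K)
  (A_algebra : operator_algebra A)
  (A_form : forall u : L2 R M,
     A u = mulop A0 u + mulop A1 (avg1op (mulop B1 u))
           + mulop A2 (avg2op (mulop B2 u)) + K u) :
  spectrum A = sigma0 A0 `|` sigma1 A0 A1 B1 `|` sigma2 A0 A2 B2
               `|` sigma3 A0 A1 B1 A2 B2 K.
Proof.
have uA0 := continuous_mcont A0_cont.
have uA1 := continuous_mcont A1_cont; have uB1 := continuous_mcont B1_cont.
have uA2 := continuous_mcont A2_cont; have uB2 := continuous_mcont B2_cont.
have TE lambda u : A u - lambda *: u =
    mulop (E0 A0 lambda) u + mulop A1 (avg1op (mulop B1 u))
    + mulop A2 (avg2op (mulop B2 u)) + K u.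
  rewrite A_form (mulop_E0 lambda uA0 u).
  set x := mulop A0 u; set y := mulop A1 _; set z := mulop A2 _; set w := K u.
  by rewrite [x - _ + y]addrAC [x + y - _ + z]addrAC [_ - _ + w]addrAC.
have TE' lambda u : A u - lambda *: u =
    mulop (E0 A0 lambda) u + mulop A2 (avg2op (mulop B2 u))
    + mulop A1 (avg1op (mulop B1 u)) + K u by rewrite TE; congr (_ + _); rewrite addrAC.
have E0_neq0 lambda : ~ sigma0 A0 lambda ->
    forall k, unit_square k -> \det (E0 A0 lambda k) != 0.
  by move=> s0 k Qk; apply/eqP => dk; apply: s0; exists k.
have H0 lambda : sigma0 A0 lambda -> spectrum A lambda.
  move=> [k Qk dk].
  exact (singular_E0 (b := true) uA0 uA1 uB1 uA2 uB2 K_compact (TE lambda) Qk dk).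
have H1 lambda : sigma1 A0 A1 B1 lambda -> spectrum A lambda.
  move=> [s0 [x Ix dx]].
  exact (singular_E (b := true) uA0 uA1 uB1 uA2 uB2 K_compact (TE lambda)
    (E0_neq0 lambda s0) Ix dx).
have H2 lambda : sigma2 A0 A2 B2 lambda -> spectrum A lambda.
  move=> [s0 [x Ix dx]].
  exact (singular_E (b := false) uA0 uA2 uB2 uA1 uB1 K_compact (TE' lambda)
    (E0_neq0 lambda s0) Ix dx).
have H3 lambda : ~ (sigma0 A0 `|` sigma1 A0 A1 B1 `|` sigma2 A0 A2 B2) lambda ->
    invertible_operator (fun u => A u - lambda *: u) <->
    invertible_operator (fun u => u + K1 A0 A1 B1 A2 B2 K lambda u).
  move=> ns.
  have s0 : ~ sigma0 A0 lambda by move=> h; apply: ns; left; left.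
  have dE0 := E0_neq0 lambda s0.
  have dE1 x : unit_itv x -> \det (E1 A0 A1 B1 lambda x) != 0.
    by move=> Ix; apply/eqP => dx; apply: ns; left; right; split => //; exists x.
  have dE2 x : unit_itv x -> \det (E2 A0 A2 B2 lambda x) != 0.
    by move=> Ix; apply/eqP => dx; apply: ns; right; split => //; exists x.
  apply: (invertible_operator_left
    (bop_bounded_operator (bop_Rop uA0 uA1 uB1 uA2 uB2 dE0 dE1 dE2))
    (bop_bounded_operator (bop_Rinv uA0 uA1 uB1 uA2 uB2 dE0))
    (RopK uA0 uA1 uB1 uA2 uB2 dE0 dE1 dE2)
    (RinvK uA0 uA1 uB1 uA2 uB2 dE0 dE1 dE2)) => u.
  rewrite TE; exact: (Rop_elimination K uA0 uA1 uB1 uA2 uB2 dE0 dE1 dE2 u).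
apply/seteqP; split => lambda.
- move=> sp; have [s|ns] :=
    pselect ((sigma0 A0 `|` sigma1 A0 A1 B1 `|` sigma2 A0 A2 B2) lambda).
    by left.
  by right; split => //; rewrite -H3.
- move=> [[[/H0|/H1]|/H2]|[ns nJ]] //.
  by move=> /(H3 _ ns).
Qed.
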